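(* Let $N_k=\tau_k/\epsilon$ and $\lambda=\xi/\epsilon$ with $\tau_k\in\mathbb R_{\ge 0}$ and $\xi\in\mathfrak h^*_{\ge 0}$. If $\xi=\epsilon\lambda$ remains regular as $\epsilon\to 0$, the asymptotic of the multiplicity $m_\lambda(\{V_k\},\{N_k\})$ of $V_\lambda$ in the tensor product $\bigotimes_{k=1}^m V_k^{\otimes N_k}$ has the following form: $$m_{\lambda}(\{V_k\},\{N_k\})=\epsilon^{\frac r2}\,\frac{\sqrt{\det K}}{(2\pi)^{\frac r2}}\,\Delta(x)\,e^{-(\rho,x)}\,e^{\frac1\epsilon S(\tau,\xi)}\,(1+O(\epsilon)).$$ Here $x\in\mathfrak h$ is the Legendre image of $\xi\in\mathfrak h^*$, the function $S$ and the matrix $K$ are as defined in the context, and $\Delta(x)$ is the denominator in the Weyl formula for characters: $$\Delta(x)=\prod_{\alpha\in\Delta_+}\big(e^{\frac{(x,\alpha)}{2}}-e^{-\frac{(x,\alpha)}{2}}\big).$$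
   Context: $\mathfrak g$ is a simple Lie algebra of rank $r$ with Cartan subalgebra $\mathfrak h$, Weyl group $W$, simple roots $\alpha_1,\dots,\alpha_r$, positive roots $\Delta_+$, and $\rho=\frac12\sum_{\alpha\in\Delta_+}\alpha$. $V_\lambda$ is the irreducible finite-dimensional $\mathfrak g$-module with highest weight $\lambda$, and $\chi_\lambda$ is its character, $\chi_\lambda(e^y)=\mathrm{tr}_{V_\lambda}(e^y)$. $V_k=V_{\nu_k}$, $k=1,\dots,m$, are fixed irreducible finite-dimensional modules, $N_k\ge 0$ are integers, and the multiplicities $m_\lambda(\{V_k\},\{N_k\})$ are defined by the decomposition into irreducibles $$\bigotimes_{k=1}^m V_k^{\otimes N_k}\cong\bigoplus_\lambda V_\lambda^{\oplus m_\lambda(\{V_k\},\{N_k\})},$$ the sum being over the irreducible components of the tensor product. $(\cdot,\cdot)$ is the Killing form; in the basis of simple roots $\xi=\sum_a\xi_a\alpha_a$, $y=\sum_a y_a\alpha_a$ and $(y,\xi)=\sum_{a,b}y_aB_{ab}\xi_b$, where $B_{ab}=d_aC_{ab}=(\alpha_a,\alpha_b)$ is the symmetrized Cartan matrix ($C$ being the Cartan matrix). $\mathfrak h^*_{\ge 0}$ denotes the set of $\xi=\sum_a\xi_a\alpha_a$ with all $\xi_a\ge 0$; $\lambda$ is in the main Weyl chamber. An element is called regular if its stabilizer in the Weyl group $W$ is trivial. Define $f(\tau,y)=\sum_k\tau_k\ln\chi_{\nu_k}(e^y)$, a strictly convex function of $y$, and let $S$ be its Legendre transform $$S(\tau,\xi)=\min_y\big(f(\tau,y)-(y,\xi)\big)=f(\tau,x)-(x,\xi),$$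 where $x$ (the Legendre image of $\xi$) is the critical point where the minimum is achieved, i.e. the unique solution of $\frac{\partial}{\partial x_a}f(\tau,x)=\sum_bB_{ab}\xi_b$, $a=1,\dots,r$. The matrix $K$ is $$K_{ac}=-\frac{\partial^2S(\tau,\xi)}{\partial\xi_a\partial\xi_c}=\sum_{b,d}B_{ad}(D^{-1})_{db}B_{bc},\qquad D_{ab}=\frac{\partial^2}{\partial y_a\partial y_b}f(\tau,y)\Big|_{y=x}.$$ *)

(* Defs.v *)
(* Simple Lie algebras over the complex numbers R[i], R : realType. *)
From mathcomp Require Import all_boot all_order all_algebra.
From mathcomp Require Import complex mxtens ring.
From mathcomp Require Import all_classical all_reals all_analysis.

Set Implicit Arguments.
Unset Strict Implicit.
Unset Printing Implicit Defensive.

Import Order.TTheory GRing.Theory Num.Theory.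
Import passmx.
Import numFieldNormedType.Exports.

Local Open Scope classical_set_scope.
Local Open Scope complex_scope.
Local Open Scope ring_scope.

Record lieAlgebra (F : fieldType) := LieAlgebra {
  lie_carrier :> vectType F;
  bracket : lie_carrier -> lie_carrier -> lie_carrier;
  bracket_linearl : forall z, linear (bracket^~ z);
  bracket_linearr : forall z, linear (bracket z);
  bracketxx : forall x, bracket x x = 0;
  jacobi : forall x y z,
    bracket x (bracket y z) + bracket y (bracket z x)
      + bracket z (bracket x y) = 0 }.

Notation "⟦ x , y ⟧" := (bracket x y) (at level 0, format "⟦ x ,  y ⟧").

Section Algebra.
Context {F : fieldType} {g : lieAlgebra F}.

Definition is_ideal (I : {vspace g}) :=
  forall x y : g, y \in I -> ⟦x, y⟧ \in I.

Definition simple_lie :=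
  (exists x y : g, ⟦x, y⟧ <> 0) /\
  (forall I : {vspace g}, is_ideal I -> I = 0%VS \/ I = fullv).

Definition ad (x : g) : 'End(g) := linfun (bracket x).

Definition killing (x y : g) : F :=
  \tr (mxof (vbasis {:g}) (vbasis {:g}) (ad x \o ad y)%VF).

Definition ad_diagonalizable (x : g) :=
  exists2 b : (\dim {:g}).-tuple g, basis_of {:g} b &
    forall i, exists c : F, ⟦x, tnth b i⟧ = c *: tnth b i.

(* Cartan subalgebra of a complex semisimple Lie algebra: a commutative,
   self-centralizing subalgebra all of whose elements are ad-diagonalizable. *)
Definition cartan_subalgebra (h : {vspace g}) :=
  [/\ {in h &, forall x y, ⟦x, y⟧ = 0},
      forall x, {in h, forall y, ⟦y, x⟧ = 0} -> x \in h &
      {in h, forall x, ad_diagonalizable x}].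

Definition dual (h : {vspace g}) := 'Hom(subvs_of h, F^o).

Section Roots.
Variable h : {vspace g}.

(* The isomorphism h -> h^* given by the restriction of the Killing form, its
   inverse, and the form transported to h^*. *)
Definition flat : 'Hom(subvs_of h, dual h) :=
  linfun (fun t : subvs_of h =>
    linfun (fun u : subvs_of h => killing (vsval t) (vsval u) : F^o) : dual h).

Definition sharp : 'Hom(dual h, subvs_of h) := (flat^-1)%VF.

Definition form (b c : dual h) : F :=
  killing (vsval (sharp b)) (vsval (sharp c)).

Definition root_vector (b : dual h) (X : g) :=
  forall H : subvs_of h, ⟦vsval H, X⟧ = b H *: X.

Definition is_root (b : dual h) :=
  b <> 0 /\ exists2 X : g, X <> 0 & root_vector b X.

Definition nat_comb r (al : r.-tuple (dual h)) (b : dual h) :=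
  exists c : 'I_r -> nat, b = \sum_a (c a)%:R *: tnth al a.

Definition simple_roots r (al : r.-tuple (dual h)) :=
  [/\ basis_of {:dual h} al,
      forall a, is_root (tnth al a) &
      forall b, is_root b -> nat_comb al b \/ nat_comb al (- b)].

Definition positive_root r (al : r.-tuple (dual h)) (b : dual h) :=
  is_root b /\ nat_comb al b.

Definition reflection (b c : dual h) : dual h :=
  c - (2%:R * form c b / form b b) *: b.

(* The element of the Weyl group given by a word in the root reflections. *)
Definition weyl_act (w : seq (dual h)) (c : dual h) : dual h :=
  foldr reflection c w.

Definition regular (c : dual h) :=
  forall w : seq (dual h), {in w, forall b, is_root b} ->
    weyl_act w c = c -> forall b, weyl_act w b = b.

Definition in_root_lattice r (al : r.-tuple (dual h)) (b : dual h) :=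
  exists c : 'I_r -> int, b = \sum_a (c a)%:~R *: tnth al a.

End Roots.

(* Modules are realized on column vectors. *)
Record lieModule := LieModule {
  mdim : nat;
  mact :> g -> 'M[F]_mdim;
  mact_linear : linear mact;
  mact_bracket : forall x y, mact ⟦x, y⟧ = mact x *m mact y - mact y *m mact x }.

Definition module_iso (V W : lieModule) :=
  exists (P : 'M[F]_(mdim W, mdim V)) (Q : 'M[F]_(mdim V, mdim W)),
    [/\ P *m Q = 1%:M, Q *m P = 1%:M & forall x, P *m V x = W x *m P].

Definition irreducible (V : lieModule) :=
  (0 < mdim V)%N /\
  forall U : {vspace 'cV[F]_(mdim V)},
    (forall x, {in U, forall v, V x *m v \in U}) -> U = 0%VS \/ U = fullv.

Definition zero_act n (x : g) : 'M[F]_n := 0.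

Fact zero_act_linear n : linear (zero_act n).
Proof. by move=> c x y; rewrite /zero_act scaler0 addr0. Qed.

Fact zero_act_bracket n (x y : g) :
  zero_act n ⟦x, y⟧ = zero_act n x *m zero_act n y - zero_act n y *m zero_act n x.
Proof. by rewrite /zero_act mul0mx subr0. Qed.

(* The trivial action on F^n; n = 1 is the unit of the tensor product and
   n = 0 the unit of the direct sum. *)
Definition trivial_module n :=
  LieModule (@zero_act_linear n) (@zero_act_bracket n).

Definition tens_act (V W : lieModule) (x : g) : 'M[F]_(mdim V * mdim W) :=
  V x *t 1%:M + 1%:M *t W x.

Fact tens_act_linear V W : linear (tens_act V W).
Proof.
move=> c x y; apply/matrixP => i j.
case: (mxtens_indexP i) => i1 i2; case: (mxtens_indexP j) => j1 j2.
by rewrite /tens_act !mact_linear !(tensmxE, mxE); ring.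
Qed.

Fact tens_act_bracket V W (x y : g) :
  tens_act V W ⟦x, y⟧ = tens_act V W x *m tens_act V W y
                        - tens_act V W y *m tens_act V W x.
Proof.
have tensBl (A B : 'M[F]_(mdim V)) (C : 'M[F]_(mdim W)) :
    (A - B) *t C = A *t C - B *t C.
  apply/matrixP => i j.
  case: (mxtens_indexP i) => i1 i2; case: (mxtens_indexP j) => j1 j2.
  by rewrite !(tensmxE, mxE); ring.
have tensBr (A : 'M[F]_(mdim V)) (B C : 'M[F]_(mdim W)) :
    A *t (B - C) = A *t B - A *t C.
  apply/matrixP => i j.
  case: (mxtens_indexP i) => i1 i2; case: (mxtens_indexP j) => j1 j2.
  by rewrite !(tensmxE, mxE); ring.
rewrite /tens_act !mact_bracket tensBl tensBr !mulmxDl !mulmxDr !tensmx_mul.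
rewrite !mul1mx !mulmx1.
move: ((V x *m V y) *t _) (V x *t W y) (V y *t W x) (_ *t (W x *m W y)).
move: ((V y *m V x) *t _) (_ *t (W y *m W x)) => a b c d e f.
by apply/matrixP => i j; rewrite !mxE; ring.
Qed.

Definition tens_module V W :=
  LieModule (@tens_act_linear V W) (@tens_act_bracket V W).

Definition sum_act (V W : lieModule) (x : g) : 'M[F]_(mdim V + mdim W) :=
  block_mx (V x) 0 0 (W x).

Fact sum_act_linear V W : linear (sum_act V W).
Proof.
move=> c x y; rewrite /sum_act !mact_linear scale_block_mx add_block_mx.
by rewrite !scaler0 !addr0.
Qed.

Fact sum_act_bracket V W (x y : g) :
  sum_act V W ⟦x, y⟧ = sum_act V W x *m sum_act V W y
                       - sum_act V W y *m sum_act V W x.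
Proof.
rewrite /sum_act !mact_bracket !mulmx_block opp_block_mx add_block_mx.
by rewrite !mul0mx !mulmx0 !addr0 !add0r !oppr0.
Qed.

Definition sum_module V W :=
  LieModule (@sum_act_linear V W) (@sum_act_bracket V W).

Definition big_tens (Vs : seq lieModule) := foldr tens_module (trivial_module 1) Vs.
Definition big_sum (Vs : seq lieModule) := foldr sum_module (trivial_module 0) Vs.

Definition tensor_powers m (V : 'I_m -> lieModule) (N : 'I_m -> nat) :=
  big_tens (flatten [seq nseq (N k) (V k) | k <- enum 'I_m]).

Section HighestWeight.
Variables (h : {vspace g}) (r : nat) (al : r.-tuple (dual h)).

Definition has_highest_weight (V : lieModule) (lam : dual h) :=
  exists v : 'cV[F]_(mdim V),
    [/\ v <> 0,
        forall H : subvs_of h, V (vsval H) *m v = lam H *: v &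
        forall (b : dual h) (X : g),
          positive_root al b -> root_vector b X -> V X *m v = 0].

Definition irreducible_hw (V : lieModule) (lam : dual h) :=
  irreducible V /\ has_highest_weight V lam.

(* m is the multiplicity of V_lam in T, i.e. T decomposes as the direct sum of
   the V_mu^{mult mu}, mu in a finite set of weights, and m is the exponent of
   V_lam, understood as 0 if lam does not occur in the sum. *)
Definition multiplicity (T : lieModule) (lam : dual h) (m : nat) :=
  exists (wts : seq (dual h)) (V : dual h -> lieModule) (mult : dual h -> nat),
    [/\ uniq wts,
        {in wts, forall mu, irreducible_hw (V mu) mu},
        module_iso T (big_sum (flatten [seq nseq (mult mu) (V mu) | mu <- wts])) &
        m = if lam \in wts then mult lam else 0%N].

End HighestWeight.
End Algebra.

Arguments simple_lie {F} g.
Arguments lieModule {F} g.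

Section Analysis.
Context {R : realType} {g : lieAlgebra R[i]} {h : {vspace g}}.
Context {r : nat} (al : r.-tuple (dual h)).

(* Real row vectors are coordinates in the basis of simple roots. *)
Definition comb (c : 'rV[R]_r) : dual h := \sum_a (c 0 a)%:C *: tnth al a.

(* The form takes real (even rational) values on real combinations of roots. *)
Definition rform (b c : dual h) : R := complex.Re (form b c).

Definition Bmx : 'M[R]_r := \matrix_(a, b) rform (tnth al a) (tnth al b).

Definition expmx n (A : 'M[R[i]]_n) : 'M[R[i]]_n :=
  limn (fun N => \sum_(k < N) (k`!%:R)^-1 *: A ^+ k).

(* tr_V(e^y), which is real for y in the real span of the simple roots; h^* is
   identified with h by means of the Killing form. *)
Definition chi (V : lieModule g) (y : 'rV[R]_r) : R :=
  complex.Re (\tr (expmx (V (vsval (sharp h (comb y)))))).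

Section Legendre.
Variables (m : nat) (V : 'I_m -> lieModule g) (tau : 'I_m -> R).

Definition fpot (y : 'rV[R]_r) : R := \sum_k tau k * ln (chi (V k) y).

(* inf is a total function: it is the minimum whenever xi has a Legendre image,
   and 0 when the set is not bounded below. *)
Definition legendre (xi : 'rV[R]_r) : R :=
  inf (range (fun y : 'rV[R]_r => fpot y - rform (comb y) (comb xi))).

Definition legendre_image (xi x : 'rV[R]_r) :=
  forall a, 'D_(delta_mx 0 a) fpot x = \sum_b Bmx a b * xi 0 b.

Definition Kmx (xi : 'rV[R]_r) : 'M[R]_r :=
  \matrix_(a, c)
    - 'D_(delta_mx 0 a) (fun z => 'D_(delta_mx 0 c) legendre z) xi.

End Legendre.

Section Denominator.
Variable Dp : seq (dual h).

Definition weyl_vector : dual h := 2%:R^-1 *: \sum_(b <- Dp) b.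

Definition weyl_denominator (x : 'rV[R]_r) : R :=
  \prod_(b <- Dp)
    (expR (rform (comb x) b / 2%:R) - expR (- (rform (comb x) b / 2%:R))).

Definition main_term m (V : 'I_m -> lieModule g)
    (eps : R) (tau : 'I_m -> R) (xi x : 'rV[R]_r) : R :=
  eps `^ (r%:R / 2%:R)
  * (Num.sqrt (\det (Kmx V tau xi)) / (2%:R * pi) `^ (r%:R / 2%:R))
  * weyl_denominator x * expR (- rform weyl_vector (comb x))
  * expR (eps^-1 * legendre V tau xi).

End Denominator.
End Analysis.

(* Main.v *)
(** The product of the character of a representation with the Weyl denominator
    determines the multiplicities: for dominant lambda, m_lambda is the coefficient of
    e^(lambda + rho) in Delta * prod_k chi_k^N_k. For an irreducible representation this is
    proved with the Casimir element: taking its trace on weight spaces shows that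
    Delta * chi_nu is an eigenvector of the Laplacian, and, by antisymmetry, its
    coefficient at lambda + rho vanishes for the dominant lambda other than nu.

    The coefficient is a Fourier integral over a torus, which is moved to the saddle point x.
    There the integrand is, up to the factor e^(S / epsilon), a product of powers of
    characteristic functions of Gibbs measures on the weights. It is compared with a Gaussian
    integral; the cubic term of the exponent is odd, so that the relative error is O(epsilon),
    provided that Delta(x) stays away from 0. This is where regularity enters: xi is in
    the open Weyl chamber, and then so is x, because the Gibbs measure at a point on the wrong
    side of a wall gives the weights a nonpositive mean across this wall. *)

From HB Require Import structures.
Require Import Defs.
From mathcomp Require Import all_boot all_order all_algebra.
From mathcomp Require Import perm complex mxtens ring lra.
From mathcomp Require Import all_classical all_reals all_analysis measurable_realfun.
Set Implicit Arguments.
Unset Strict Implicit.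
Unset Printing Implicit Defensive.
Import Order.TTheory GRing.Theory Num.Theory.
Import passmx.
Import numFieldNormedType.Exports.
Local Open Scope classical_set_scope.
Local Open Scope complex_scope.
Local Open Scope ring_scope.

(** * Exponentials of nilpotent matrices *)

(** The constant in O(epsilon) must serve the whole sequence, while tau, xi and the saddle point
    move with n. The estimates are therefore proved with constants that depend only on bounds: for
    the weights, for their Gibbs probabilities, for epsilon N, and from below for the denominator.
    The bounds hold for large n because the Legendre images converge, which follows from strong
    convexity of the potential near x0.

    Weights are written in simple-root coordinates, where the root lattice is Z^r, and points of h
    in the coordinates u = y B, where the pairing is the dot product. Multiplied by e^rho, the
    denominator has integral exponents, and the integrand becomes a Laurent polynomial with the
    multiplicity, up to a known factor, as constant term.

    Decay away from the saddle point comes from a single module V_k with nonzero weights and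
    positive limit of tau_k. As g is simple, such a module is faithful, so every simple root is a
    difference of two of its weights; on the cube of integration only the origin then gives its
    characteristic function modulus 1. *)

Section NilpotentExponential.
Context {F : numFieldType} {n : nat}.
Implicit Types A B Z : 'M[F]_n.

(** The sum goes one degree beyond the last power that can be nonzero when [Z ^+ n = 0]. It is thus
    nonempty for every n, and index shifts do not leave a boundary term. *)
Definition nil_exp Z : 'M[F]_n := \sum_(k < n.+1) (k`!%:R)^-1 *: Z ^+ k.

Lemma mulscal_l (c : F) A B : (c *: A) * B = c *: (A * B).
Proof. by rewrite -!mulmxE -scalemxAl. Qed.

Lemma mulscal_r (c : F) A B : A * (c *: B) = c *: (A * B).
Proof. by rewrite -!mulmxE -scalemxAr. Qed.

Lemma nil_expE Z m : Z ^+ n = 0 -> (n <= m)%N ->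
  nil_exp Z = \sum_(k < m) (k`!%:R)^-1 *: Z ^+ k.
Proof.
move=> Zn nm; rewrite /nil_exp big_ord_recr /= Zn scaler0 addr0.
rewrite -(subnKC nm) big_split_ord /= [X in _ = _ + X]big1 ?addr0 // => k _.
by rewrite exprD Zn mul0r scaler0.
Qed.

Lemma nil_exp_comm Z : Z * nil_exp Z = nil_exp Z * Z.
Proof.
rewrite /nil_exp mulr_sumr mulr_suml; apply: eq_bigr => k _.
by rewrite mulscal_l mulscal_r -exprS -exprSr.
Qed.

(** The exponential is 1 + Z W with commuting Z and W, hence 1 plus a nilpotent matrix; a finite
    geometric series inverts it. *)
Lemma nil_exp_unit Z : Z ^+ n = 0 -> nil_exp Z \in unitmx.
Proof.
move=> Zn; rewrite /nil_exp big_ord_recl /= fact0 invr1 scale1r expr0.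
pose W : 'M[F]_n := \sum_(k < n) ((k.+1)`!%:R)^-1 *: Z ^+ k.
have -> : \sum_(i < n) ((bump 0 i)`!%:R)^-1 *: Z ^+ bump 0 i = Z * W.
  by rewrite mulr_sumr; apply: eq_bigr => k _; rewrite mulscal_r -exprS.
have ZW : GRing.comm Z W.
  rewrite /GRing.comm mulr_sumr mulr_suml; apply: eq_bigr => k _.
  by rewrite mulscal_r mulscal_l -exprS -exprSr.
have ZWn : (- (Z * W)) ^+ n = 0 by rewrite exprNn exprMn_comm // Zn mul0r mulr0.
have := subrX1 (- (Z * W)) n; rewrite ZWn sub0r -opprD mulNr => /oppr_inj.
by rewrite -mulmxE addrC => /esym /mulmx1_unit[].
Qed.

Lemma commutator_expr A Z c k : A * Z - Z * A = c *: Z ->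
  A * Z ^+ k = Z ^+ k * A + (k%:R * c) *: Z ^+ k.
Proof.
move=> AZ; have AZ1 : A * Z = Z * A + c *: Z by rewrite -AZ addrC subrK.
elim: k => [|k IH]; first by rewrite expr0 mulr1 mul1r mul0r scale0r addr0.
rewrite exprSr mulrA IH mulrDl -mulrA AZ1 mulrDr mulscal_r mulscal_l mulrA.
by rewrite -addrA -scalerDl -[k.+1%:R]natr1 mulrDl mul1r [c + _]addrC.
Qed.

(** The conjugate of A by the exponential is A + [A, Z] + [[A, Z], Z] / 2 + ..., which stops after
    the linear term because [A, Z] is a multiple of Z. *)
Lemma nil_exp_derivl A Z c : Z ^+ n = 0 -> A * Z - Z * A = c *: Z ->
  A * nil_exp Z = nil_exp Z * (A + c *: Z).
Proof.
move=> Zn AZ; rewrite mulrDr mulscal_r -nil_exp_comm.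
rewrite [X in c *: (Z * X)](nil_expE Zn (leqnn n)) /nil_exp.
rewrite mulr_sumr mulr_suml mulr_sumr scaler_sumr.
have -> : \sum_(i < n) c *: (Z * ((i`!%:R)^-1 *: Z ^+ i))
    = \sum_(i < n.+1) (i%:R * c / i`!%:R) *: Z ^+ i.
  rewrite big_ord_recl /= !mul0r scale0r add0r; apply: eq_bigr => k _.
  rewrite mulscal_r -exprS scalerA; congr (_ *: _).
  rewrite /bump /= add1n factS natrM invfM mulrA [_ * c]mulrC mulfK //.
rewrite -big_split /=; apply: eq_bigr => k _.
rewrite mulscal_r (commutator_expr k AZ) scalerDr mulscal_l scalerA.
by rewrite [_ * (_ * c)]mulrC.
Qed.

(** The relations are those of an sl_2-triple: the series for the conjugate of B stops after the
    quadratic term. The proof commutes B with each power of Z. *)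
Lemma nil_exp_derivr B A Z c : Z ^+ n = 0 -> Z * B - B * Z = A ->
  A * Z - Z * A = (2%:R * c) *: Z ->
  nil_exp Z * B = B * nil_exp Z + nil_exp Z * A + c *: (Z * nil_exp Z).
Proof.
move=> Zn ZB AZ; have ZB1 : Z * B = B * Z + A by rewrite -ZB addrC subrK.
have ZBk k : Z ^+ k.+1 * B =
    B * Z ^+ k.+1 + k.+1%:R *: (Z ^+ k * A) + (k.+1%:R * k%:R * c) *: Z ^+ k.
  elim: k => [|k IH].
    by rewrite expr1 expr0 mulr0 mul0r scale0r addr0 mul1r scale1r.
  pose p := k.+1%:R * k%:R * c; pose q := k.+2%:R * k.+1%:R * c.
  rewrite -/p in IH; rewrite -/q (exprS Z k.+1) -mulrA IH !mulrDr !mulscal_r.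
  rewrite !mulrA ZB1 !mulrDl -exprS (commutator_expr k.+1 AZ) -!mulrA -exprS.
  rewrite -!addrA; congr (_ + _).
  have -> : q = k.+1%:R * (2%:R * c) + p by rewrite /q /p -[k.+2%:R]natr1; ring.
  rewrite -[k.+2%:R]natr1 !scalerDl scale1r.
  move: (k.+1%:R *: (Z ^+ k.+1 * A)) ((k.+1%:R * (2%:R * c)) *: Z ^+ k.+1).
  move: (p *: Z ^+ k.+1) (Z ^+ k.+1 * A) => w' u a w.
  by rewrite (addrCA w) (addrA u) (addrC u).
pose d k := (k`!%:R)^-1 *: Z ^+ k : 'M[F]_n.
have dS k : d k.+2 * B = B * d k.+2 + d k.+1 * A + c *: (Z * d k).
  have fk : k`!%:R != 0 :> F by rewrite pnatr_eq0 -lt0n fact_gt0.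
  have k1 : k.+1%:R != 0 :> F by rewrite pnatr_eq0.
  have k2 : k.+2%:R != 0 :> F by rewrite pnatr_eq0.
  rewrite /d !mulscal_l !mulscal_r ZBk !scalerDr !scalerA -exprS.
  congr (_ + _ *: _ + _ *: _); rewrite !factS !natrM;
    move: (k.+2%:R) (k.+1%:R) (k`!%:R) k2 k1 fk => x y z x0 y0 z0;
    by field; rewrite ?x0 ?y0 ?z0.
rewrite [X in X * B](nil_expE (m := n.+2) Zn) ?leqW //.
rewrite [X in B * X](nil_expE (m := n.+2) Zn) ?leqW //.
rewrite [X in X * A](nil_expE (m := n.+1) Zn) ?leqW //.
rewrite [X in Z * X](nil_expE Zn (leqnn n)).
rewrite !mulr_suml !mulr_sumr scaler_sumr.
have S1 (f : nat -> 'M[F]_n) :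
    \sum_(i < n.+1) f i = f 0%N + \sum_(i < n) f i.+1 by rewrite big_ord_recl.
have S2 (f : nat -> 'M[F]_n) :
    \sum_(i < n.+2) f i = f 0%N + (f 1%N + \sum_(i < n) f i.+2).
  by rewrite !big_ord_recl.
rewrite (S2 (fun k => d k * B)) (S2 (fun k => B * d k)) (S1 (fun k => d k * A)).
have d0B : d 0%N * B = B * d 0%N by rewrite /d expr0 mulscal_l mulscal_r mulr1 mul1r.
have d1B : d 1%N * B = B * d 1%N + d 0%N * A.
  by rewrite /d expr0 expr1 invr1 !scale1r mul1r.
have -> : \sum_(i < n) d i.+2 * B = \sum_(i < n) B * d i.+2
    + \sum_(i < n) d i.+1 * A + \sum_(i < n) c *: (Z * d i).
  by rewrite -!big_split; apply: eq_bigr => k _; exact: dS.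
rewrite d0B d1B -!addrA.
by congr (_ + (_ + _)); exact: addrCA.
Qed.

End NilpotentExponential.

(** * Roots and weights *)

Section Brackets.
Context {F : fieldType} {g : lieAlgebra F}.

HB.instance Definition _ (x : g) :=
  GRing.isSemilinear.Build F g g _ (bracket x)
    (GRing.semilinear_linear (bracket_linearr x)).

Lemma adE (x y : g) : ad x y = ⟦x, y⟧.
Proof. by rewrite /ad lfunE. Qed.

Lemma lieDl (z x y : g) : ⟦x + y, z⟧ = ⟦x, z⟧ + ⟦y, z⟧.
Proof. by have := bracket_linearl z 1 x y; rewrite !scale1r. Qed.

Lemma lieDr (z x y : g) : ⟦z, x + y⟧ = ⟦z, x⟧ + ⟦z, y⟧.
Proof. exact: linearD. Qed.

Lemma lieZr c (z x : g) : ⟦z, c *: x⟧ = c *: ⟦z, x⟧.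
Proof. exact: linearZ. Qed.

Lemma lie0r (z : g) : ⟦z, 0⟧ = 0.
Proof. exact: linear0. Qed.

Lemma lieC (x y : g) : ⟦x, y⟧ = - ⟦y, x⟧.
Proof.
have := bracketxx (x + y); rewrite lieDl !lieDr !bracketxx add0r addr0.
by move/eqP; rewrite addr_eq0 => /eqP.
Qed.

Lemma lieZl c (z x : g) : ⟦c *: x, z⟧ = c *: ⟦x, z⟧.
Proof. by rewrite lieC lieZr -scalerN -lieC. Qed.

Lemma lie0l (z : g) : ⟦0, z⟧ = 0.
Proof. by rewrite lieC lie0r oppr0. Qed.

Lemma lieNr (z x : g) : ⟦z, - x⟧ = - ⟦z, x⟧.
Proof. exact: linearN. Qed.

(* The Jacobi identity, read as: [ad x] is a derivation. *)
Lemma lie_der (x y z : g) : ⟦x, ⟦y, z⟧⟧ = ⟦⟦x, y⟧, z⟧ + ⟦y, ⟦x, z⟧⟧.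
Proof.
have := jacobi x y z; rewrite (lieC z x) lieNr (lieC z).
by move/eqP; rewrite -addrA -opprD subr_eq0 addrC => /eqP.
Qed.

End Brackets.

Section Adjoint.
Context {F : fieldType} {g : lieAlgebra F}.
Local Notation gb := (vbasis {:g}).

Lemma gbP : basis_of fullv gb. Proof. exact: vbasisP. Qed.

(** [mxof] acts on row vectors, modules act on columns; hence the transpose. *)
Definition adj_act (x : g) : 'M[F]_(\dim {:g}) := (mxof gb gb (ad x))^T.

Fact adj_act_linear : linear adj_act.
Proof.
move=> c x y; rewrite /adj_act -linearZ /= -linearD /=; congr _^T.
rewrite -linearZ -linearD; congr mxof; apply/lfunP => z.
by rewrite !lfunE /= !lfunE /= !adE lieDl lieZl.
Qed.

Definition colv (v : g) : 'cV[F]_(\dim {:g}) := (rVof gb v)^T.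
Definition vcol (v : 'cV[F]_(\dim {:g})) : g := vecof gb v^T.

Lemma colvK : cancel colv vcol.
Proof. by move=> v; rewrite /colv /vcol trmxK rVofK // gbP. Qed.

Lemma vcolK : cancel vcol colv.
Proof. by move=> v; rewrite /colv /vcol vecofK ?trmxK // gbP. Qed.

Lemma vcol_linear : linear vcol.
Proof. by move=> c u v; rewrite /vcol linearP /= linearP. Qed.

HB.instance Definition _ := GRing.isSemilinear.Build F _ _ _ vcol
  (GRing.semilinear_linear vcol_linear).

Lemma colv_linear : linear colv.
Proof. by move=> c u v; rewrite /colv linearP /= linearP. Qed.

HB.instance Definition _ := GRing.isSemilinear.Build F _ _ _ colv
  (GRing.semilinear_linear colv_linear).

Lemma adj_colv x v : adj_act x *m colv v = colv ⟦x, v⟧.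
Proof. by rewrite /adj_act /colv -trmx_mul -rVof_app ?adE // gbP. Qed.

Lemma adj_vcol x v : vcol (adj_act x *m v) = ⟦x, vcol v⟧.
Proof. by rewrite -[v in LHS]vcolK adj_colv colvK. Qed.

Lemma mulmx_colv_inj (A B : 'M[F]_(\dim {:g})) :
  (forall v, A *m colv v = B *m colv v) -> A = B.
Proof.
move=> AB; apply/matrixP => i j; have := AB (vcol (delta_mx j 0)).
by rewrite vcolK -!colE => /matrixP /(_ i 0); rewrite !mxE.
Qed.

Fact adj_act_bracket x y :
  adj_act ⟦x, y⟧ = adj_act x *m adj_act y - adj_act y *m adj_act x.
Proof.
apply: mulmx_colv_inj => v; rewrite mulmxBl -!mulmxA !adj_colv -linearB.
by congr colv; rewrite lie_der addrK.
Qed.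

Definition adjoint_module := LieModule adj_act_linear adj_act_bracket.

Lemma killingE x y : killing x y = \tr (adj_act x *m adj_act y).
Proof.
rewrite /killing (mxof_comp _ _ gbP) -mxtrace_tr trmx_mul.
by [].
Qed.

Lemma killingC (x y : g) : killing x y = killing y x.
Proof. by rewrite !killingE mxtrace_mulC. Qed.

Lemma killing_linear (x : g) : linear (killing x : g -> F^o).
Proof.
move=> c y z; rewrite !killingE adj_act_linear mulmxDr -scalemxAr.
by rewrite mxtraceD mxtraceZ.
Qed.

HB.instance Definition _ (x : g) :=
  GRing.isSemilinear.Build F g F^o _ (killing x : g -> F^o)
    (GRing.semilinear_linear (killing_linear x)).

Lemma killingDl (x y z : g) : killing (x + y) z = killing x z + killing y z.
Proof. by rewrite !(killingC _ z) (linearD (killing z : {linear g -> F^o})). Qed.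

Lemma killing0r (x : g) : killing x 0 = 0.
Proof. exact: (linear0 (killing x : {linear g -> F^o})). Qed.

Lemma killingZr c (x y : g) : killing x (c *: y) = c * killing x y.
Proof. by have := killing_linear x c y 0; rewrite !addr0 killing0r addr0. Qed.

Lemma killingDr (x y z : g) : killing x (y + z) = killing x y + killing x z.
Proof. exact: (linearD (killing x : {linear g -> F^o})). Qed.

Lemma killing_sumr I (s : seq I) (f : I -> g) (x : g) :
  killing x (\sum_(i <- s) f i) = \sum_(i <- s) killing x (f i).
Proof. exact: (linear_sum (killing x : {linear g -> F^o})). Qed.

Lemma killingZl c (y z : g) : killing (c *: y) z = c * killing y z.
Proof. by rewrite !(killingC _ z) killingZr. Qed.

Lemma killing_inv (x y z : g) : killing ⟦x, y⟧ z = killing x ⟦y, z⟧.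
Proof.
rewrite !killingE !adj_act_bracket mulmxBl mulmxBr !linearB /= !mulmxA.
congr (_ - _); rewrite -!mulmxA mxtrace_mulC -!mulmxA.
by rewrite mxtrace_mulC -!mulmxA mxtrace_mulC -!mulmxA.
Qed.

End Adjoint.

Section Functionals.
Context {F : fieldType} {g : lieAlgebra F} {h : {vspace g}}.

Lemma dual_separates (x : subvs_of h) : (forall b : dual h, b x = 0) -> x = 0.
Proof.
move=> x0; have xv : x \in (fullv : {vspace subvs_of h}) by exact: memvf.
rewrite (coord_vbasis xv) big1 // => i _.
pose c : dual h := linfun (coord (vbasis (fullv : {vspace subvs_of h})) i : _ -> F^o).
by have := x0 c; rewrite lfunE /= => ->; rewrite scale0r.
Qed.

Lemma dim_dual : \dim {:dual h} = \dim {:subvs_of h}.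
Proof. by rewrite !dimvf /dim /= muln1. Qed.

(** Evaluation of the basis on elements of h is injective, since functionals separate points, and
    the dimensions agree. *)
Lemma basis_functional r (al : r.-tuple (dual h)) (c : 'I_r -> F) :
  basis_of {:dual h} al -> exists H : subvs_of h, forall a, tnth al a H = c a.
Proof.
move=> bal; pose f (H : subvs_of h) : 'rV[F]_r := \row_a tnth al a H.
have f_lin : linear f.
  by move=> k x y; apply/rowP => a; rewrite !mxE linearP.
pose fL : {linear subvs_of h -> 'rV[F]_r} :=
  HB.pack f (GRing.isSemilinear.Build F _ _ _ f (GRing.semilinear_linear f_lin)).
have ker0 : lker (linfun fL) == 0%VS.
  apply/eqP/vspaceP => x; rewrite memv0 memv_ker lfunE /=.
  apply/eqP/eqP => [fx0|->]; last first.
    by apply/rowP => a; rewrite !mxE linear0.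
  apply: dual_separates => b; rewrite (coord_basis bal (memvf b)).
  rewrite sum_lfunE big1 // => a _; rewrite lfunE /=.
  have /rowP /(_ a) := fx0; rewrite !mxE (tnth_nth 0) => ->.
  by rewrite scaler0.
have full : limg (linfun fL) = fullv.
  apply/eqP; rewrite eqEdim subvf limg_dim_eq ?(eqP ker0) ?capv0 //.
  by rewrite -dim_dual (size_basis bal) dimvf /dim /= mul1n.
have [H _ eH] : exists2 H, H \in fullv & \row_a c a = linfun fL H.
  by apply/memv_imgP; rewrite full memvf.
exists H => a; move: eH; rewrite lfunE => /rowP /(_ a).
by rewrite /fL /= !mxE => ->.
Qed.

End Functionals.

Definition weight_basis {F : fieldType} {g : lieAlgebra F} {h : {vspace g}}
    (V : lieModule g) (P : 'M[F]_(mdim V)) (mu : 'I_(mdim V) -> dual h) :=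
  P \in unitmx /\
  forall i (H : subvs_of h), V (vsval H) *m col i P = mu i H *: col i P.

Section RootDecomposition.
Context {F : fieldType} {g : lieAlgebra F} {h : {vspace g}}.
Hypothesis h_cartan : cartan_subalgebra h.
Local Notation gb := (vbasis {:g}).

Lemma mxof_ad_diagonalizable (x : g) :
  ad_diagonalizable x -> diagonalizable (mxof gb gb (ad x)).
Proof.
case=> b bb bx; pose P := mxof b gb \1%VF.
have QP : mxof gb b \1%VF *m P = 1%:M.
  by rewrite -(mxof_comp _ _ bb) comp_lfun1l mxof1 // (basis_free gbP).
have Pu : P \in unitmx by case: (mulmx1_unit QP).
exists P => //; apply/diagonalizable_forPex.
have [c cP] := choice bx.
exists (\row_i c i); apply/(simmxP Pu).
rewrite -(mxof_comp _ _ gbP) comp_lfun1r.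
apply/row_matrixP => i; rewrite !rowE mulmxA.
rewrite mul_mxof // vecof_delta adE -tnth_nth cP linearZ /=.
rewrite -rowE row_diag_mx -scalemxAl mul_mxof vecof_delta lfunE /= -tnth_nth.
by rewrite mxE.
Qed.

(** The operators ad H, for H in a basis of h, commute and are diagonalizable, hence simultaneously
    diagonalizable; the diagonal entries are linear in H. *)
Lemma adjoint_weight_basis :
  exists P (be : 'I_(\dim {:g}) -> dual h),
    weight_basis (V := adjoint_module) P be.
Proof.
case: h_cartan => hab hself hdiag.
pose M (x : g) := mxof gb gb (ad x).
have M_lin : linear M.
  by move=> c x y; have := adj_act_linear c x y;
    rewrite /adj_act -linearZ -linearD => /trmx_inj.
pose ML : {linear g -> 'M[F]_(\dim {:g})} :=
  HB.pack M (GRing.isSemilinear.Build F _ _ _ M (GRing.semilinear_linear M_lin)).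
have [|P Pu /allP Pd] := (codiagonalizableP [seq M x | x <- vbasis h]).1.
  split=> [A B /mapP[x xh ->] /mapP[y yh ->]|A /mapP[x xh ->]]; last first.
    by apply: mxof_ad_diagonalizable; apply/hdiag/vbasis_mem.
  rewrite /comm_mx -!(mxof_comp _ _ gbP); congr mxof.
  apply/lfunP => z; rewrite !lfunE /= !adE lie_der.
  by rewrite (hab y x) ?(vbasis_mem xh) ?(vbasis_mem yh) // lie0l add0r.
have Dd (H : subvs_of h) : is_diag_mx (P *m M (vsval H) *m invmx P).
  rewrite (coord_vbasis (subvsP H)) [M _](linear_sum ML) mulmx_sumr mulmx_suml.
  apply/is_diag_mxP => i j ij; rewrite summxE big1 // => k _.
  rewrite [ML _]linearZ /= -scalemxAr -scalemxAl mxE.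
  have kv : (vbasis h)`_k \in vbasis h by rewrite -tnth_nth mem_tnth.
  have /Pd /= /diagonalizable_forPex[D /(simmxP Pu) eD] := map_f M kv.
  rewrite eD mulmxK // !mxE.
  by case: eqVneq => [eij|_]; [rewrite eij eqxx in ij | rewrite mulr0n mulr0].
pose f i (H : subvs_of h) : F^o := (P *m M (vsval H) *m invmx P) i i.
have f_lin i : linear (f i).
  move=> c x y; rewrite /f linearP M_lin mulmxDr mulmxDl -scalemxAr -scalemxAl.
  by rewrite !mxE.
pose fL i : {linear subvs_of h -> F^o} :=
  HB.pack (f i) (GRing.isSemilinear.Build F _ _ _ (f i)
    (GRing.semilinear_linear (f_lin i))).
exists P^T, (fun i => linfun (fL i)); split; first by rewrite unitmx_tr.
move=> i H; rewrite lfunE /= /f -tr_row /adj_act -trmx_mul -linearZ /=; congr _^T.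
have eP : P *m M (vsval H) = (P *m M (vsval H) *m invmx P) *m P by rewrite mulmxKV.
rewrite -row_mul [X in row i X = _]eP row_mul.
have /diag_mxP[D ->] : is_diag_mx (P *m M (vsval H) *m invmx P) by exact: Dd.
by rewrite row_diag_mx -scalemxAl -rowE !mxE eqxx mulr1n.
Qed.

End RootDecomposition.

Lemma col_mulmx (R : pzSemiRingType) m n p (A : 'M[R]_(m, n)) (B : 'M[R]_(n, p)) j :
  col j (A *m B) = A *m col j B.
Proof. by rewrite !colE mulmxA. Qed.

Definition weight_vector {F : fieldType} {g : lieAlgebra F} {h : {vspace g}}
    (V : lieModule g) (mu : dual h) (v : 'cV[F]_(mdim V)) :=
  forall H : subvs_of h, V (vsval H) *m v = mu H *: v.

Section ModuleBasics.
Context {F : fieldType} {g : lieAlgebra F} {h : {vspace g}}.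
Implicit Types (V : lieModule g) (b c mu : dual h).

HB.instance Definition _ V := GRing.isSemilinear.Build F g _ _ (mact V)
  (GRing.semilinear_linear (@mact_linear _ _ V)).

Lemma weight_vectorD V b (X : g) mu v :
  root_vector b X -> weight_vector (V := V) mu v ->
  weight_vector (V := V) (mu + b) (V X *m v).
Proof.
move=> bX muv H; rewrite mulmxA.
have -> : V (vsval H) *m V X = V X *m V (vsval H) + V ⟦vsval H, X⟧.
  by rewrite mact_bracket addrC subrK.
rewrite mulmxDl -mulmxA muv bX [V (_ *: _)]linearZ -scalemxAr -scalemxAl /=.
by rewrite add_lfunE scalerDl.
Qed.

Lemma weight_vector_uniq V mu nu (v : 'cV_(mdim V)) :
  weight_vector mu v -> weight_vector nu v -> v != 0 -> mu = nu.
Proof.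
move=> muv nuv v0; apply/lfunP => H; apply/eqP; rewrite -subr_eq0.
have : (mu H - nu H) *: v = 0 by rewrite scalerBl -muv -nuv subrr.
by move/eqP; rewrite scaler_eq0 (negPf v0) orbF.
Qed.

Lemma root_vectorD b c (X Y : g) :
  root_vector b X -> root_vector c Y -> root_vector (b + c) ⟦X, Y⟧.
Proof.
move=> bX cY H; rewrite lie_der bX cY lieZl lieZr -scalerDl.
by rewrite add_lfunE.
Qed.

Lemma root_vectorZ b k (X : g) : root_vector b X -> root_vector b (k *: X).
Proof. by move=> bX H; rewrite lieZr bX !scalerA mulrC. Qed.

Lemma root_vector_weight b (X : g) :
  root_vector b X -> weight_vector (V := adjoint_module) b (colv X).
Proof. by move=> bX H; rewrite adj_colv bX linearZ. Qed.

End ModuleBasics.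

Section WeightBasis.
Context {F : fieldType} {g : lieAlgebra F} {h : {vspace g}}.
Variables (V : lieModule g) (P : 'M[F]_(mdim V)) (mu : 'I_(mdim V) -> dual h).
Hypothesis wb : weight_basis P mu.

Definition in_basis (x : g) : 'M[F]_(mdim V) := invmx P *m V x *m P.

Lemma basis_unit : P \in unitmx. Proof. by case: wb. Qed.

Lemma in_basisM (x y : g) : in_basis x *m in_basis y = invmx P *m (V x *m V y) *m P.
Proof.
rewrite /in_basis !mulmxA; congr (_ *m _ *m _).
by rewrite -!mulmxA mulmxV ?basis_unit // mulmx1.
Qed.

Lemma in_basis_bracket (x y : g) :
  in_basis ⟦x, y⟧ = in_basis x *m in_basis y - in_basis y *m in_basis x.
Proof. by rewrite !in_basisM /in_basis mact_bracket mulmxBr mulmxBl. Qed.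

Lemma in_basis_linear : linear in_basis.
Proof.
move=> c x y; rewrite /in_basis mact_linear mulmxDr mulmxDl.
by rewrite -scalemxAr -scalemxAl.
Qed.

HB.instance Definition _ := GRing.isSemilinear.Build F g _ _ in_basis
  (GRing.semilinear_linear in_basis_linear).

Lemma basis_weight i : weight_vector (V := V) (mu i) (col i P).
Proof. by case: wb => _ wbi H; exact: wbi. Qed.

Lemma basis_col_neq0 i : col i P != 0.
Proof.
apply/eqP => Pi0; have := mulVmx basis_unit => /matrixP /(_ i i).
rewrite [in RHS]mxE eqxx; have -> : (invmx P *m P) i i = (invmx P *m col i P) i 0.
  by rewrite -col_mulmx [RHS]mxE.
by rewrite Pi0 mulmx0 mxE => /eqP; rewrite eq_sym oner_eq0.
Qed.

Lemma in_basis_h (H : subvs_of h) : in_basis (vsval H) = diag_mx (\row_i mu i H).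
Proof.
apply/matrixP => i j; have := col_mulmx (invmx P) (V (vsval H) *m P) j.
rewrite (col_mulmx (V _)) basis_weight -scalemxAr -col_mulmx mulVmx ?basis_unit //.
rewrite mulmxA => /colP /(_ i); rewrite !mxE => ->.
by case: eqVneq => [->|_]; rewrite ?mulr1 ?mulr1n ?mulr0.
Qed.

Lemma weight_coord nu v i : weight_vector (V := V) nu v ->
  (invmx P *m v) i 0 != 0 -> mu i = nu.
Proof.
move=> nuv vi; apply/lfunP => H; apply: (mulIf vi).
have : invmx P *m (V (vsval H) *m v) = in_basis (vsval H) *m (invmx P *m v).
  by rewrite /in_basis -!mulmxA (mulmxA P) mulmxV ?basis_unit // mul1mx.
rewrite nuv in_basis_h -scalemxAr => /colP /(_ i).
by rewrite mul_diag_mx !mxE.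
Qed.

Lemma basis_decomp v : v = \sum_i (invmx P *m v) i 0 *: col i P.
Proof.
rewrite -[LHS](mulKVmx basis_unit); apply/colP => k; rewrite summxE mxE.
by apply: eq_bigr => i _; rewrite !mxE mulrC.
Qed.

Lemma in_basis_root b (X : g) i j :
  root_vector b X -> in_basis X i j != 0 -> mu i = mu j + b.
Proof.
move=> bX; have -> : in_basis X i j = (invmx P *m (V X *m col j P)) i 0.
  by rewrite /in_basis -!mulmxA -!col_mulmx [RHS]mxE.
by apply/weight_coord/weight_vectorD/basis_weight.
Qed.

Lemma trace_hh (H H' : subvs_of h) :
  \tr (V (vsval H) *m V (vsval H')) = \sum_i mu i H * mu i H'.
Proof.
have -> : \tr (V (vsval H) *m V (vsval H'))
    = \tr (in_basis (vsval H) *m in_basis (vsval H')).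
  by rewrite in_basisM [RHS]mxtrace_mulC mulmxA mulmxV ?basis_unit // mul1mx.
rewrite !in_basis_h /mxtrace; apply: eq_bigr => i _.
by rewrite mul_diag_mx !mxE eqxx mulr1n.
Qed.

End WeightBasis.

(** A free family of maximal size among the vectors with property M. It serves to extract a basis
    that consists of lowering monomials. *)
Lemma free_span_of (K : fieldType) (vT : vectType K) (M : vT -> Prop) :
  exists fam : seq vT, [/\ free fam, forall x, x \in fam -> M x &
    forall w, M w -> w \in <<fam>>%VS].
Proof.
pose Q k := `[< exists fam : seq vT, [/\ free fam, forall x, x \in fam -> M x & size fam = k] >].
have exQ : exists k, Q k.
  by exists 0%N; apply/asboolP; exists [::]; split=> //; exact: nil_free.
have ubQ k : Q k -> (k <= \dim {:vT})%N.
  by move=> /asboolP[fam [fs _ <-]]; rewrite -(eqP fs) dimvS ?subvf.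
case: (ex_maxnP exQ ubQ) => k /asboolP[fam [fs sM sk]] kmax.
exists fam; split=> // w Mw; apply: contraT => ws.
have /kmax : Q k.+1; last by rewrite ltnn.
apply/asboolP; exists (w :: fam); split; rewrite /= ?sk //.
  by rewrite free_cons ws fs.
by move=> x; rewrite inE => /orP[/eqP -> //|]; exact: sM.
Qed.

Lemma mulmx_span_sub (K : fieldType) n (A : 'M[K]_n) (fam : seq 'cV[K]_n)
    (U : {vspace 'cV[K]_n}) (w : 'cV[K]_n) :
  (forall x : 'cV[K]_n, x \in fam -> A *m x \in U) -> w \in <<fam>>%VS -> A *m w \in U.
Proof.
move=> sU /(coord_span (X := in_tuple fam)) ->; rewrite mulmx_sumr.
apply: memv_suml => i _; rewrite -scalemxAr; apply: memvZ; apply: sU.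
exact: mem_nth.
Qed.

(** * Root strings, the Weyl group and the Weyl denominator *)

Local Notation form := Defs.form.

Section RootSystem.
Context {C : numFieldType} {g : lieAlgebra C} {h : {vspace g}}.
Context {r : nat} {al : r.-tuple (dual h)}.
Hypothesis g_simple : simple_lie g.
Hypothesis h_cartan : cartan_subalgebra h.
Hypothesis al_simple : simple_roots al.
Variables (P : 'M[C]_(\dim {:g})) (be : 'I_(\dim {:g}) -> dual h).
Hypothesis wb : weight_basis (V := adjoint_module) P be.
Implicit Types (b c d nu : dual h) (X Y Z : g) (H : subvs_of h).

Let e i : g := vcol (col i P).

Lemma adjoint_basis_root i : root_vector (be i) (e i).
Proof.
by move=> H; rewrite /e -adj_vcol (basis_weight wb) linearZ.
Qed.

Lemma adjoint_decomp X : X = \sum_i (invmx P *m colv X) i 0 *: e i.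
Proof.
rewrite -[LHS]colvK [colv X in LHS](basis_decomp wb) linear_sum.
by apply: eq_bigr => i _; rewrite linearZ.
Qed.

Lemma adjoint_basis_neq0 i : e i != 0.
Proof.
apply: contraNneq (basis_col_neq0 wb i) => ei.
by rewrite -[col i P]vcolK -/(e i) ei linear0.
Qed.

Lemma root_vector0_h X : root_vector (0 : dual h) X -> X \in h.
Proof.
case: h_cartan => _ hself _ X0; apply: hself => y yh.
by have := X0 (Subvs yh); rewrite lfunE /= scale0r.
Qed.

Lemma h_root_vector0 H : root_vector (0 : dual h) (vsval H).
Proof.
by case: h_cartan => hab _ _ H'; rewrite lfunE /= scale0r hab ?subvsP.
Qed.

Lemma adjoint_weight_root i : be i = 0 \/ is_root (be i).
Proof.
have [->|/eqP b0] := eqVneq (be i) 0; [by left | right; split=> //].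
exists (e i); last exact: adjoint_basis_root.
exact/eqP/adjoint_basis_neq0.
Qed.

Lemma root_adjoint_weight b : is_root b -> exists i, be i = b.
Proof.
case=> _ [X X0 bX].
have [i Xi] : exists i, (invmx P *m colv X) i 0 != 0.
  apply/existsP; apply: contra_notT X0; rewrite negb_exists => /forallP Xi.
  rewrite [X]adjoint_decomp big1 // => i _.
  by have := Xi i; rewrite negbK => /eqP ->; rewrite scale0r.
by exists i; apply: weight_coord (root_vector_weight bX) Xi.
Qed.

(** Invariance gives (b + c)(H) (X, Y) = 0 for every H. *)
Lemma killing_orth b c X Y :
  root_vector b X -> root_vector c Y -> b + c != 0 -> killing X Y = 0.
Proof.
move=> bX cY bc; apply: contraNeq bc => XY; apply/eqP/lfunP => H.
rewrite add_lfunE lfunE /=; apply: (mulIf XY).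
rewrite mul0r mulrDl -killingZl -bX -killingZr -cY.
by rewrite lieC -[- _]scaleN1r killingZl killing_inv mulN1r addNr.
Qed.

(** A combination of simple roots takes its height as value at H0. Roots thus have nonzero integers
    as values, and inductions can run over heights. *)
Lemma height_functional : exists H0, forall a, tnth al a H0 = 1.
Proof. by case: al_simple => bal _ _; exact: (basis_functional (fun=> 1) bal). Qed.

Lemma nat_comb_height H0 b : (forall a, tnth al a H0 = 1) ->
  nat_comb al b -> exists2 n : nat, b H0 = n%:R & (n = 0%N -> b = 0).
Proof.
move=> H01 [c ->]; exists (\sum_a c a)%N.
  rewrite sum_lfunE natr_sum; apply: eq_bigr => a _.
  by rewrite lfunE /= H01 /GRing.scale /= mulr1.
move/eqP; rewrite sum_nat_eq0 => /forallP c0.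
by rewrite big1 // => a _; rewrite (eqP (implyP (c0 a) isT)) scale0r.
Qed.

Lemma root_height H0 b : (forall a, tnth al a H0 = 1) -> is_root b ->
  exists2 n : nat, b H0 = n%:R \/ b H0 = - n%:R & (0 < n)%N.
Proof.
move=> H01 rb; have [b0 _] := rb; case: al_simple => _ _ /(_ b rb).
case=> /(nat_comb_height H01)[n bn n0]; exists n.
- by left.
- by rewrite lt0n; apply/eqP => /n0.
- by right; apply/eqP; rewrite -bn opp_lfunE opprK.
- by rewrite lt0n; apply/eqP => /n0 /eqP; rewrite oppr_eq0 => /eqP.
Qed.

Lemma root_exists : exists b : dual h, is_root b.
Proof.
case: (pselect (exists i, is_root (be i))) => [[i ri]|nr]; first by exists (be i).
have gh X : X \in h.
  rewrite [X]adjoint_decomp; apply: memv_suml => i _; apply: memvZ.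
  apply: root_vector0_h; have := adjoint_basis_root i.
  by case: (adjoint_weight_root i) => [-> //|ri]; case: nr; exists i.
case: g_simple => [[x [y xy]] _]; case: xy.
by case: h_cartan => hab _ _; rewrite hab.
Qed.

(** The radical of the form is an ideal by invariance, so it is 0 or everything. In the second case
    (H0, H0) would be 0 for the height element H0; but as a trace it is the sum of the squares of
    the heights of the roots, which are nonzero integers. *)
Lemma killing_nondeg X : (forall Y, killing X Y = 0) -> X = 0.
Proof.
pose f Z : 'Hom(g, C^o) := linfun (killing Z : g -> C^o).
have f_lin : linear f.
  move=> k x y; apply/lfunP => z; rewrite !lfunE /= !lfunE /=.
  by rewrite killingDl killingZl /f lfunE.
pose fL : {linear g -> 'Hom(g, C^o)} :=
  HB.pack f (GRing.isSemilinear.Build C _ _ _ f (GRing.semilinear_linear f_lin)).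
have kerP Z : (Z \in lker (linfun fL)) = (f Z == 0) by rewrite memv_ker lfunE.
have fP Z : f Z = 0 <-> forall Y, killing Z Y = 0.
  split=> [fZ Y|fZ]; last by apply/lfunP => Y; rewrite !lfunE /= fZ.
  by have := congr1 (fun k : 'Hom(g, C^o) => k Y) fZ; rewrite !lfunE.
case: g_simple => _ /(_ (lker (linfun fL))) [|ker0|kerT].
- move=> x y; rewrite !kerP => /eqP /fP y0; apply/eqP/fP => z.
  by rewrite lieC -[- _]scaleN1r killingZl killing_inv y0 mulr0.
- by move=> /fP X0; apply/eqP; rewrite -memv0 -ker0 kerP X0.
have [H0 H01] := height_functional; have [b rb] := root_exists.
have : killing (vsval H0) (vsval H0) = 0.
  have : vsval H0 \in lker (linfun fL) by rewrite kerT memvf.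
  by rewrite kerP => /eqP /fP.
have hi i : exists z : int, be i H0 = z%:~R.
  case: (adjoint_weight_root i) => [->|/(root_height H01)[n [->|->] _]].
  - by exists 0; rewrite lfunE.
  - by exists n.
  - by exists (- n%:Z); rewrite mulrNz.
rewrite killingE (trace_hh wb).
move/eqP; rewrite psumr_eq0 => [/allP all0|i _]; last first.
  by case: (hi i) => z ->; rewrite -intrM ler0z -expr2 sqr_ge0.
have [i ib] := root_adjoint_weight rb.
have := all0 i (mem_index_enum i); rewrite ib /= mulf_eq0 orbb.
have [n + n0] := root_height H01 rb.
by case=> ->; rewrite ?oppr_eq0 pnatr_eq0 eqn0Ngt n0.
Qed.


Lemma vsvalP k (x y : subvs_of h) : vsval (k *: x + y) = k *: vsval x + vsval y.
Proof. by []. Qed.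

Lemma flatE (t u : subvs_of h) : flat h t u = killing (vsval t) (vsval u).
Proof.
pose k (x : subvs_of h) (y : subvs_of h) : C^o := killing (vsval x) (vsval y).
have k_lin x : linear (k x).
  by move=> c y z; rewrite /k vsvalP killingDr killingZr.
pose kL x : {linear subvs_of h -> C^o} :=
  HB.pack (k x) (GRing.isSemilinear.Build C _ _ _ (k x)
    (GRing.semilinear_linear (k_lin x))).
pose f x : dual h := linfun (kL x).
have f_lin : linear f.
  move=> c x y; apply/lfunP => z; rewrite !lfunE /= !lfunE /=.
  by rewrite /k vsvalP killingDl killingZl lfunE.
pose fL : {linear subvs_of h -> dual h} :=
  HB.pack f (GRing.isSemilinear.Build C _ _ _ f (GRing.semilinear_linear f_lin)).
have -> : flat h = linfun fL by [].
by rewrite lfunE /= lfunE.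
Qed.

Lemma killing_h_eq0 (t : subvs_of h) :
  (forall u : subvs_of h, killing (vsval t) (vsval u) = 0) -> t = 0.
Proof.
move=> t0; apply: val_inj; apply: killing_nondeg => Y.
rewrite [Y]adjoint_decomp killing_sumr big1 // => i _; rewrite killingZr.
case: (eqVneq (be i) 0) => [bi|bi0]; last first.
  rewrite (killing_orth (h_root_vector0 t) (adjoint_basis_root i)) ?mulr0 //.
  by rewrite add0r.
have eh : e i \in h by apply: root_vector0_h; rewrite -bi; exact: adjoint_basis_root.
by have := t0 (Subvs eh); rewrite /= => ->; rewrite mulr0.
Qed.

Lemma flat_ker0 : lker (flat h) == 0%VS.
Proof.
apply/eqP/vspaceP => t; rewrite memv0 memv_ker.
apply/eqP/eqP => [ft|->]; last by rewrite linear0.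
by apply: killing_h_eq0 => u; rewrite -flatE ft lfunE.
Qed.

Lemma sharpK b : flat h (sharp h b) = b.
Proof.
rewrite /sharp limg_lfunVK //.
suff -> : limg (flat h) = fullv by rewrite memvf.
apply/eqP; rewrite eqEdim subvf limg_dim_eq ?(eqP flat_ker0) ?capv0 //.
by rewrite dim_dual leqnn.
Qed.

Lemma flatK (t : subvs_of h) : sharp h (flat h t) = t.
Proof. by rewrite /sharp lker0_lfunK // flat_ker0. Qed.

Lemma killing_sharp b H : killing (vsval (sharp h b)) (vsval H) = b H.
Proof. by rewrite -flatE sharpK. Qed.

Lemma formE b c : form b c = b (sharp h c).
Proof. by rewrite /form killing_sharp. Qed.

Lemma formC b c : form b c = form c b.
Proof. by rewrite /form killingC. Qed.

Lemma formDl b c d : form (b + c) d = form b d + form c d.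
Proof. by rewrite !formE add_lfunE. Qed.

Lemma formZl k b d : form (k *: b) d = k * form b d.
Proof. by rewrite !formE scale_lfunE. Qed.

Lemma formNl b d : form (- b) d = - form b d.
Proof. by rewrite -scaleN1r formZl mulN1r. Qed.

Lemma form0l d : form 0 d = 0.
Proof. by rewrite formE lfunE. Qed.

Lemma form_suml I (s : seq I) (Q : pred I) (f : I -> dual h) d :
  form (\sum_(i <- s | Q i) f i) d = \sum_(i <- s | Q i) form (f i) d.
Proof.
exact: (big_morph (fun b => form b d) (fun b c => formDl b c d) (form0l d)).
Qed.

Lemma formDr b c d : form d (b + c) = form d b + form d c.
Proof. by rewrite !(formC d) formDl. Qed.

Lemma formZr k b d : form d (k *: b) = k * form d b.
Proof. by rewrite !(formC d) formZl. Qed.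

Lemma formNr b d : form d (- b) = - form d b.
Proof. by rewrite !(formC d) formNl. Qed.

Lemma form_trace b c :
  form b c = \sum_i be i (sharp h b) * be i (sharp h c).
Proof. by rewrite /form killingE (trace_hh wb). Qed.

Lemma vsvalB k (x y : subvs_of h) : vsval (x - k *: y) = vsval x - k *: vsval y.
Proof. by []. Qed.

(** Both sides lie in h and have, by invariance, the same product with every element of h, where the
    form is nondegenerate. *)
Lemma bracket_opp b X Y : root_vector b X -> root_vector (- b) Y ->
  ⟦X, Y⟧ = killing X Y *: vsval (sharp h b).
Proof.
move=> bX bY; have Zh : ⟦X, Y⟧ \in h.
  by apply: root_vector0_h; have := root_vectorD bX bY; rewrite subrr.
have : Subvs Zh - killing X Y *: sharp h b = 0.
  apply: killing_h_eq0 => u; rewrite vsvalB /=.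
  rewrite killingDl -[- _ in X in _ + X]scaleN1r !killingZl killing_sharp.
  by rewrite killingC -killing_inv bX killingZl mulN1r mulrC subrr.
by move/(congr1 (@vsval _ _ h)) => E; exact: (subr0_eq E).
Qed.

Lemma opp_root_vector b X : X != 0 -> root_vector b X ->
  exists2 Y, root_vector (- b) Y & killing X Y = 1.
Proof.
move=> X0 bX; have [i Xi] : exists i, killing X (e i) != 0.
  apply/existsP; apply: contraNT X0; rewrite negb_exists => /forallP Xi.
  apply/eqP/killing_nondeg => Y; rewrite [Y]adjoint_decomp killing_sumr.
  rewrite big1 // => i _; rewrite killingZr.
  by have := Xi i; rewrite negbK => /eqP ->; rewrite mulr0.
have bi : be i = - b.
  apply/eqP; rewrite -addr_eq0 addrC; apply: contraNT Xi => bi.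
  by rewrite (killing_orth bX (adjoint_basis_root i)).
exists ((killing X (e i))^-1 *: e i).
  by apply: root_vectorZ; rewrite -bi; exact: adjoint_basis_root.
by rewrite killingZr mulVf.
Qed.

(** * Strings of weights in the direction of a root *)

Section Strings.
Variables (V : lieModule g) (Q : 'M[C]_(mdim V)) (mu : 'I_(mdim V) -> dual h).
Hypothesis wbV : weight_basis Q mu.

Lemma weight_iter c (Z : g) nu (v : 'cV_(mdim V)) k :
  root_vector c Z -> weight_vector nu v ->
  weight_vector (V := V) (nu + k%:R *: c) (iter k (mulmx (V Z)) v).
Proof.
move=> cZ nuv; elim: k => [|k IH] /=; first by rewrite scale0r addr0.
by rewrite -natr1 scalerDl scale1r addrA; exact: weight_vectorD.
Qed.

Lemma weight_in_basis nu (v : 'cV_(mdim V)) :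
  weight_vector nu v -> v != 0 -> exists i, mu i = nu.
Proof.
move=> nuv v0; have [i vi] : exists i, (invmx Q *m v) i 0 != 0.
  apply/existsP; apply: contraNT v0; rewrite negb_exists => /forallP vi.
  rewrite [v](basis_decomp wbV) big1 // => i _.
  by have := vi i; rewrite negbK => /eqP ->; rewrite scale0r.
by exists i; apply: weight_coord vi.
Qed.

(** If the iterates up to this one were nonzero, the nu + k c would be [mdim V + 1] different
    weights of V. *)
Lemma weight_nilpotent c (Z : g) nu (v : 'cV_(mdim V)) :
  c != 0 -> root_vector c Z -> weight_vector nu v ->
  iter (mdim V) (mulmx (V Z)) v = 0.
Proof.
move=> c0 cZ nuv; apply/eqP; apply: contraT => vn.
have nz k : (k <= mdim V)%N -> iter k (mulmx (V Z)) v != 0.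
  move=> kn; apply: contraNneq vn => vk.
  have vjk j : iter (j + k) (mulmx (V Z)) v = 0.
    by elim: j => //= j ->; rewrite mulmx0.
  by have := vjk (mdim V - k)%N; rewrite subnK // => ->.
have mui (k : 'I_(mdim V).+1) : exists i, mu i = nu + k%:R *: c.
  apply: weight_in_basis (weight_iter k cZ nuv) (nz k _).
  by rewrite -ltnS.
have [f fE] := choice mui.
have : injective f.
  move=> k l kl; have := fE k; rewrite kl fE => /addrI /eqP.
  rewrite -subr_eq0 -scalerBl scaler_eq0 (negPf c0) orbF subr_eq0 eqr_nat.
  by move/eqP/val_inj.
by move/leq_card; rewrite !card_ord ltnn.
Qed.

Lemma string_end c (Z : g) nu (v : 'cV_(mdim V)) :
  c != 0 -> root_vector c Z -> weight_vector nu v -> v != 0 ->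
  exists n, iter n (mulmx (V Z)) v != 0 /\ iter n.+1 (mulmx (V Z)) v = 0.
Proof.
move=> c0 cZ nuv v0; have vn := weight_nilpotent c0 cZ nuv.
have ex : exists n, iter n (mulmx (V Z)) v == 0 by exists (mdim V); rewrite vn.
case: (ex_minnP ex) => [[|n]]; first by rewrite /= (negPf v0).
move=> /eqP vn0 nmin; exists n; split=> //.
by apply/negP => /nmin; rewrite ltnn.
Qed.

(** X sends Y^(k+1) v to a scalar multiple of Y^k v, and at the end of the string this scalar is 0.
    The conclusion is not divided by [form b b], which is shown to be nonzero only with its help. *)
Lemma string_highest b X Y nu (v : 'cV_(mdim V)) :
  b != 0 -> root_vector b X -> root_vector (- b) Y -> killing X Y = 1 ->
  v != 0 -> weight_vector nu v -> V X *m v = 0 ->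
  exists n : nat, 2%:R * form nu b = n%:R * form b b.
Proof.
move=> b0 bX bY XY v0 nuv Xv; have mb0 : - b != 0 by rewrite oppr_eq0.
have [n [wn wn1]] := string_end mb0 bY nuv v0.
exists n; pose w k := iter k (mulmx (V Y)) v.
have Xw k : V X *m w k.+1 =
    ((k.+1)%:R * form nu b - ('C(k.+1, 2))%:R * form b b) *: w k.
  have wk j : V ⟦X, Y⟧ *m w j = (form nu b - j%:R * form b b) *: w j.
    rewrite (bracket_opp bX bY) XY scale1r (weight_iter _ bY nuv).
    by rewrite add_lfunE scale_lfunE opp_lfunE -!formE scalerN.
  have XYw j : V X *m w j.+1 = V Y *m (V X *m w j) + V ⟦X, Y⟧ *m w j.
    by rewrite mact_bracket /= mulmxBl !mulmxA addrC subrK.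
  elim: k => [|k IH]; rewrite XYw wk.
    by rewrite [w 0%N]/= Xv mulmx0 add0r !mul0r mul1r.
  rewrite IH -scalemxAr -[V Y *m w k]/(w k.+1) -scalerDl; congr (_ *: _).
  rewrite [in RHS]binS bin1 natrD -[k.+2%:R]natr1.
  ring.
have := Xw n; rewrite [w n.+1]wn1 mulmx0 => /esym/eqP; rewrite scaler_eq0 (negPf wn) orbF.
rewrite subr_eq0 => /eqP E.
have n1 : n.+1%:R != 0 :> C by rewrite pnatr_eq0.
apply: (mulfI n1); rewrite mulrCA E !mulrA -!natrM; congr (_%:R * _).
by rewrite mulnC -bin2_sum; have := bin2 n.+1; rewrite -bin2_sum /= => ->;
   rewrite -divn2; rewrite divnK // dvdn2 oddM /= andNb.
Qed.

Lemma string_integral b nu (v : 'cV_(mdim V)) :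
  is_root b -> v != 0 -> weight_vector nu v ->
  exists z : int, 2%:R * form nu b = z%:~R * form b b.
Proof.
case=> /eqP b0 [X /eqP X0 bX] v0 nuv.
have [Y bY XY] := opp_root_vector X0 bX.
have [p [xp xp1]] := string_end b0 bX nuv v0.
have [n] := string_highest b0 bX bY XY xp (weight_iter p bX nuv) xp1.
rewrite formDl formZl mulrDr => E; exists (n%:Z - (2 * p)%:Z).
rewrite intrB mulrBl /= -!pmulrn -E natrM mulrA; ring.
Qed.

End Strings.

Lemma adjoint_root_vector_weight b X : X != 0 -> root_vector b X ->
  colv X != 0 /\ weight_vector (V := adjoint_module) b (colv X).
Proof.
move=> X0 bX; split; last exact: root_vector_weight.
by apply: contraNneq X0 => X0; rewrite -[X]colvK X0 linear0.
Qed.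

Lemma root_form_integral b i : is_root b ->
  exists z : int, 2%:R * form (be i) b = z%:~R * form b b.
Proof.
move=> rb; apply: (string_integral wb rb (basis_col_neq0 wb i)).
exact: (basis_weight wb).
Qed.

(** If (b, b) = 0, integrality makes b orthogonal to all roots. The form is a sum over the roots of
    products of their values, so b is then orthogonal to everything. *)
Lemma root_form_neq0 b : is_root b -> form b b != 0.
Proof.
move=> rb; apply/eqP => fb; case: (rb) => b0 _; apply: b0.
have fi i : form (be i) b = 0.
  have [z] := root_form_integral i rb; rewrite fb mulr0 => /eqP.
  by rewrite mulf_eq0 pnatr_eq0 /= => /eqP.
have fc c : form b c = 0.
  rewrite form_trace big1 // => i _.
  by rewrite -formE fi mul0r.
by apply/lfunP => H; rewrite -[H]flatK -formE fc lfunE.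
Qed.

(** With (beta, b) = z_beta (b, b) / 2 for each weight beta of the adjoint module, the trace formula
    reads (b, b) = (b, b)^2 \sum (z_beta / 2)^2, so the inverse of (b, b) is a sum of squares of
    rationals. *)
Lemma root_form_gt0 b : is_root b -> 0 < form b b.
Proof.
move=> rb; have fb := root_form_neq0 rb.
have [z zP] := choice (fun i => root_form_integral i rb).
have fi i : form (be i) b = (z i)%:~R / 2%:R * form b b.
  by apply: (@mulfI _ 2%:R); rewrite ?pnatr_eq0 // zP; field.
have E : 1 = form b b * \sum_i ((z i)%:~R / 2%:R) ^+ 2.
  apply: (mulfI fb); rewrite mulr1 {1}form_trace mulrA mulr_sumr.
  by apply: eq_bigr => i _; rewrite -!formE !fi; ring.
have s0 : 0 <= \sum_i ((z i)%:~R / 2%:R) ^+ 2 :> C.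
  apply: sumr_ge0 => i _; rewrite expr_div_n; apply: mulr_ge0.
    by rewrite -rmorphXn ler0z sqr_ge0.
  by rewrite invr_ge0 exprn_ge0 ?ler0n.
have s1 : \sum_i ((z i)%:~R / 2%:R) ^+ 2 != 0 :> C.
  by apply/eqP => s; move: E; rewrite s mulr0 => /eqP; rewrite oner_eq0.
rewrite -(@pmulr_lgt0 _ (\sum_i ((z i)%:~R / 2%:R) ^+ 2)) ?lt0r ?s1 //.
by rewrite -E oner_eq0 ler01.
Qed.

(* A lowest weight vector cannot have a negative multiple of b as its weight. *)
Lemma ad_inj_negative b X Z m : X != 0 -> is_root b -> root_vector b X ->
  (0 < m)%N -> root_vector (- (m%:R *: b)) Z -> ⟦X, Z⟧ = 0 -> Z = 0.
Proof.
move=> X0 rb bX m0 mZ XZ; apply/eqP; apply: contraT => Z0.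
have [Y bY XY] := opp_root_vector X0 bX.
have [vZ wZ] := adjoint_root_vector_weight Z0 mZ.
have b0 : b != 0 by case: rb => /eqP.
have [|n] := string_highest wb b0 bX bY XY vZ wZ.
  by rewrite adj_colv XZ linear0.
rewrite formNl formZl mulrN mulrA -mulNr => /(mulIf (root_form_neq0 rb)) /eqP.
rewrite eq_sym -addr_eq0 -natrM -natrD pnatr_eq0 addn_eq0 muln_eq0 /=.
by rewrite (eqn0Ngt m) m0 andbF.
Qed.

Lemma is_rootN b : is_root b -> is_root (- b).
Proof.
case=> /eqP b0 [X /eqP X0 bX]; have [Y bY XY] := opp_root_vector X0 bX.
split; first by apply/eqP; rewrite oppr_eq0.
exists Y => // Y0; move: XY; rewrite Y0 killing0r => /eqP.
by rewrite eq_sym oner_eq0.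
Qed.

(** Let X be a root vector for -b, and Y one for b with (X, Y) = 1. The vector Z - (X, Z) Y is
    orthogonal to X, hence commutes with X, and [ad_inj_negative] for the root -b shows that it
    vanishes. *)
Lemma root_space_dim1 b : is_root b ->
  exists Y, forall Z, root_vector b Z -> exists k, Z = k *: Y.
Proof.
move=> rb; have rNb := is_rootN rb; case: (rNb) => _ [X /eqP X0 bX].
have [Y bY XY] := opp_root_vector X0 bX; rewrite opprK in bY.
exists Y => Z bZ; exists (killing X Z).
apply/subr0_eq/(ad_inj_negative (m := 1) X0 rNb bX) => //.
  rewrite scale1r opprK => H; rewrite lieDr lieNr lieZr bZ bY scalerBr.
  by rewrite !scalerA mulrC.
have bW : root_vector (- - b) (Z - killing X Z *: Y).
  rewrite opprK => H; rewrite lieDr lieNr lieZr bZ bY scalerBr.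
  by rewrite !scalerA mulrC.
rewrite (bracket_opp bX bW) killingDr -scaleNr killingZr XY mulr1 subrr.
by rewrite scale0r.
Qed.

(** A root vector Z for - m b commutes with X: for m > 2 because the next space is 0 by induction;
    for m = 2 because [X, Z] itself commutes with X, as (X, [X, Z]) = ([X, X], Z) = 0, and so
    vanishes. *)
Lemma root_multiple b m : is_root b -> (1 < m)%N -> ~ is_root (m%:R *: b).
Proof.
move=> rb m1; suff K Z : root_vector (- (m%:R *: b)) Z -> Z = 0.
  move/is_rootN => [_ [Z Z0 bZ]]; exact/Z0/K.
case: (rb) => _ [X /eqP X0 bX].
have XZ k W : root_vector (- (k.+1%:R *: b)) W ->
    root_vector (- (k%:R *: b)) ⟦X, W⟧.
  move=> kW; have := root_vectorD bX kW.
  by rewrite -natr1 scalerDl scale1r opprD addrCA subrr addr0.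
elim: m m1 Z => // -[//|[|m]] IH _ Z mZ; apply: (ad_inj_negative X0 rb bX _ mZ) => //.
  have b1 := XZ _ _ mZ; apply: (ad_inj_negative (m := 1) X0 rb bX) => //.
  rewrite scale1r in b1.
  by rewrite (bracket_opp bX b1) -killing_inv bracketxx killingC killing0r scale0r.
by apply: IH => //; exact: XZ.
Qed.

Section Reflections.
Variables (V : lieModule g) (Q : 'M[C]_(mdim V)) (mu : 'I_(mdim V) -> dual h).
Hypothesis wbV : weight_basis Q mu.

Lemma root_vector_nilpotent c (Z : g) : c != 0 -> root_vector c Z ->
  (V Z : 'M[C]_(mdim V)) ^+ mdim V = 0.
Proof.
move=> c0 cZ; apply/matrixP => i j; rewrite [in RHS]mxE.
suff E : (V Z : 'M[C]_(mdim V)) ^+ mdim V *m Q = 0.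
  by rewrite -(mulmxK (basis_unit wbV) (_ ^+ _)) E mul0mx mxE.
have itE m (v : 'cV_(mdim V)) :
    iter m (mulmx (V Z)) v = (V Z : 'M[C]_(mdim V)) ^+ m *m v.
  by elim: m => [|m IH] /=; rewrite ?expr0 ?mul1mx // IH exprS -mulmxE mulmxA.
apply/matrixP => k l.
have := weight_nilpotent wbV c0 cZ (basis_weight wbV l).
rewrite itE -col_mulmx => /colP /(_ k).
by rewrite [LHS]mxE [RHS]mxE => ->; rewrite mxE.
Qed.

(* The element exp(X) exp(-Y) exp(X) of SL_2 represents the reflection in b. *)
Lemma reflection_operator b : is_root b -> exists2 th : 'M[C]_(mdim V),
  th \in unitmx & forall nu v, weight_vector (V := V) nu v ->
    weight_vector (V := V) (reflection b nu) (th *m v).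
Proof.
move=> rb; have fb := root_form_neq0 rb; case: (rb) => /eqP b0 [X /eqP X0 bX].
have [Y bY XY] := opp_root_vector X0 bX.
pose k := 2%:R / form b b; pose T := k *: sharp h b.
pose Z : 'M[C]_(mdim V) := - (k *: V Y); pose A := V X; pose HT := V (vsval T).
have An : A ^+ mdim V = 0 by exact: root_vector_nilpotent bX.
have Zn : Z ^+ mdim V = 0.
  have -> : Z = - V (k *: Y) by rewrite linearZ.
  rewrite exprNn.
  rewrite (@root_vector_nilpotent (- b)) ?mulr0 ?oppr_eq0 //.
  exact: root_vectorZ.
have HX (K : subvs_of h) : V (vsval K) * A - A * V (vsval K) = b K *: A.
  by rewrite -!mulmxE -mact_bracket bX linearZ.
have HY (K : subvs_of h) : V (vsval K) * Z - Z * V (vsval K) = (- b K) *: Z.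
  rewrite /Z mulrN mulNr mulscal_l mulscal_r -opprD -scalerN -scalerDr.
  rewrite -!mulmxE -mact_bracket bY opp_lfunE.
  have VZ (p : C) (W : g) : V (p *: W) = p *: V W by rewrite linearZ.
  by rewrite VZ !scaleNr !scalerN !opprK !scalerA mulrC.
have cT c : c T = k * form c b by rewrite /T linearZ /= -formE.
have bT : b T = 2%:R by rewrite cT /k divfK.
have ZA : Z * A - A * Z = HT.
  rewrite /Z mulNr mulrN opprK addrC mulscal_l mulscal_r -scalerBr.
  by rewrite -!mulmxE -mact_bracket (bracket_opp bX bY) XY scale1r -linearZ.
clearbody Z; exists (nil_exp A * nil_exp Z * nil_exp A).
  by rewrite -mulmxE !unitmx_mul !nil_exp_unit.
move=> nu v nuv K; pose K' := K - b K *: T.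
suff E : V (vsval K) * (nil_exp A * nil_exp Z * nil_exp A) =
    nil_exp A * nil_exp Z * nil_exp A * V (vsval K').
  set th := nil_exp A * nil_exp Z * nil_exp A in E *.
  have {}E : V (vsval K) *m th = th *m V (vsval K') by exact: E.
  rewrite mulmxA E -mulmxA nuv -scalemxAr; congr (_ *: _).
  rewrite /K' /reflection linearB linearZ /= !add_lfunE opp_lfunE scale_lfunE.
  rewrite cT /k /GRing.scale /=; congr (_ - _).
  by field.
(* The element K is moved through the three exponentials: it becomes K + b(K) X, then K' + b(K) X,
   and finally K'. *)
rewrite mulrA mulrA (nil_exp_derivl An (HX K)) -!mulrA; congr (_ * _).
have HTZ : HT * Z - Z * HT = (2%:R * (-1)) *: Z.
  by rewrite HY bT mulrN mulr1.
have AE : A * nil_exp Z = nil_exp Z * A - nil_exp Z * HT + nil_exp Z * Z.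
  rewrite (nil_exp_derivr Zn ZA HTZ) scaleN1r nil_exp_comm.
  by rewrite addrAC subrK addrK.
have VK' : V (vsval K') = V (vsval K) - b K *: HT.
  by rewrite /K' vsvalB linearB linearZ.
have -> : (V (vsval K) + b K *: A) * (nil_exp Z * nil_exp A) =
    nil_exp Z * ((V (vsval K') + b K *: A) * nil_exp A).
  rewrite !mulrA; congr (_ * _); rewrite mulrDl (nil_exp_derivl Zn (HY K)).
  rewrite mulscal_l AE VK' !mulrDr !mulrN !mulscal_r scalerDr scalerBr scaleNr.
  rewrite -!addrA; congr (_ + _); rewrite addrC -!addrA.
  by rewrite subrr addr0 addrC.
congr (_ * _).
have HXK' : V (vsval K') * A - A * V (vsval K') = (- b K) *: A.
  rewrite HX; congr (_ *: _); rewrite /K' linearB linearZ /= bT.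
  by rewrite /GRing.scale /=; ring.
rewrite mulrDl (nil_exp_derivl An HXK') mulrDr -addrA mulscal_l mulscal_r.
by rewrite nil_exp_comm -scalerDl addNr scale0r addr0.
Qed.

(** Some term of the Leibniz expansion of the determinant is nonzero. For a change of basis between
    two bases of weight vectors, the permutation matches their weights. *)
Lemma unitmx_perm_neq0 n (M : 'M[C]_n) : M \in unitmx ->
  exists s : 'S_n, forall i, M i (s i) != 0.
Proof.
rewrite unitmxE unitfE => dM; have : [exists s : 'S_n, \prod_i M i (s i) != 0].
  apply: contraNT dM; rewrite negb_exists => /forallP Ms.
  rewrite /determinant big1 // => s _; have := Ms s; rewrite negbK => /eqP ->.
  by rewrite mulr0.
move=> /existsP[s Ms]; exists s.
by move=> i; move/prodf_neq0: Ms => /(_ i isT).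
Qed.

Lemma weights_reflection b : is_root b ->
  exists s : 'S_(mdim V), forall i, mu (s i) = reflection b (mu i).
Proof.
move=> rb; have [th thu thP] := reflection_operator rb.
have [|s sP] := @unitmx_perm_neq0 _ (invmx Q *m th *m Q)^T.
  by rewrite unitmx_tr !unitmx_mul unitmx_inv (basis_unit wbV) thu.
exists s => i; apply: (weight_coord wbV (thP _ _ (basis_weight wbV i))).
by have := sP i; rewrite mxE -!mulmxA -col_mulmx -col_mulmx [X in _ -> X != 0]mxE.
Qed.

End Reflections.

Section HighestWeightModules.
Variables (V : lieModule g) (nu : dual h).
Hypothesis V_hw : irreducible_hw al V nu.

Lemma positive_or_negative b : is_root b -> positive_root al b \/ positive_root al (- b).
Proof.
move=> rb; case: al_simple => _ _ /(_ b rb) [pb|nb]; [left | right] => //.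
by split=> //; exact: is_rootN.
Qed.

(** The vectors Y_1 ... Y_k v with negative root vectors Y_i. The order of the factors is free,
    which makes stability under lowering immediate. *)
Fixpoint lowering_monomial (v : 'cV[C]_(mdim V)) k (w : 'cV[C]_(mdim V)) : Prop :=
  if k is k'.+1 then exists b (Y : g) (u : 'cV[C]_(mdim V)),
    [/\ positive_root al b, root_vector (- b) Y, lowering_monomial v k' u
      & w = V Y *m u]
  else w = v.

Lemma nat_combD b c : nat_comb al b -> nat_comb al c -> nat_comb al (b + c).
Proof.
move=> [m ->] [n ->]; exists (fun a => m a + n a)%N.
by rewrite -big_split /=; apply: eq_bigr => a _; rewrite natrD scalerDl.
Qed.

Lemma nat_comb_add_eq0 b c : nat_comb al b -> nat_comb al c -> b + c = 0 -> b = 0.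
Proof.
have [H0 H01] := height_functional.
move=> /(nat_comb_height H01)[m bm m0] /(nat_comb_height H01)[n cn _].
move/(congr1 (fun d : dual h => d H0)); rewrite add_lfunE lfunE /= bm cn -natrD.
by move/eqP; rewrite pnatr_eq0 addn_eq0 => /andP[/eqP /m0].
Qed.

Lemma lowering_monomial_weight v k w : weight_vector nu v ->
  lowering_monomial v k w ->
  exists b, [/\ nat_comb al b, weight_vector (V := V) (nu - b) w &
    (0 < k)%N -> b != 0].
Proof.
move=> nuv; elim: k w => [|k IH] w /=.
  move=> ->; exists 0; split; rewrite ?subr0 //.
  by exists (fun=> 0%N); rewrite big1 // => a _; rewrite scale0r.
case=> b [Y [u [[rb pb] bY /IH[c [pc cw _]] ->]]].
exists (c + b); split; [exact: nat_combD | | ].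
  by rewrite opprD addrA; exact: weight_vectorD.
move=> _; apply/eqP; rewrite addrC => /(nat_comb_add_eq0 pb pc).
by case: rb.
Qed.

(** The span of the lowering monomials is stable under g: by induction on the length, a positive
    root vector is moved to the right until it kills v. By irreducibility the span is everything,
    and monomials of positive length have weights strictly below nu, so nu occurs once. *)
Lemma highest_weight_basis :
  exists (Q : 'M[C]_(mdim V)) (mu : 'I_(mdim V) -> dual h),
    [/\ weight_basis Q mu, forall i, nat_comb al (nu - mu i) &
      exists i0, forall i, (mu i == nu) = (i == i0)].
Proof.
case: V_hw => [[n0 irr] [v [v0 nuv Xv]]].
pose M w := exists k, lowering_monomial v k w.
have [fam [fs sM Ms]] := free_span_of M.
have Mw w : M w -> exists b, weight_vector (V := V) (nu - b) w.
  by case=> k /(lowering_monomial_weight nuv)[b [_ bw _]]; exists b.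
have vs : v \in <<fam>>%VS by apply: Ms; exists 0%N.
have sY b Y w : positive_root al b -> root_vector (- b) Y -> w \in <<fam>>%VS ->
    V Y *m w \in <<fam>>%VS.
  move=> pb bY; apply: mulmx_span_sub => x /sM[k kx].
  by apply: Ms; exists k.+1; exists b, Y, x.
have sH (H : subvs_of h) w : M w -> V (vsval H) *m w \in <<fam>>%VS.
  by move=> mw; have [b ->] := Mw _ mw; apply/memvZ/Ms.
have sX k : forall w b X, lowering_monomial v k w -> positive_root al b ->
    root_vector b X -> V X *m w \in <<fam>>%VS.
  elim: k => [|k IH] w b X /=.
    by move=> -> pb bX; rewrite (Xv b) ?mem0v.
  case=> c [Y [u [pc cY ku ->]]] pb bX.
  have -> : V X *m (V Y *m u) = V Y *m (V X *m u) + V ⟦X, Y⟧ *m u.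
    by rewrite mact_bracket mulmxBl !mulmxA addrC subrK.
  apply: memvD; first by apply: sY pc cY _; exact: IH pb bX.
  have bcXY := root_vectorD bX cY.
  have [->|XY0] := eqVneq ⟦X, Y⟧ 0; first by rewrite linear0 mul0mx mem0v.
  have [bc0|bc0] := eqVneq (b - c) 0.
    rewrite bc0 in bcXY; have hXY := root_vector0_h bcXY.
    by apply: (sH (Subvs hXY)); exists k.
  have rbc : is_root (b - c) by split; [exact/eqP | exists ⟦X, Y⟧ => //; exact/eqP].
  case: (positive_or_negative rbc) => [pbc|nbc]; first exact: IH pbc bcXY.
  apply: sY nbc _ _; first by rewrite opprK.
  by apply: Ms; exists k.
have full : <<fam>>%VS = fullv.
  case: (irr <<fam>>%VS) => // [x w ws|s0]; last first.
    by case: v0; apply/eqP; rewrite -memv0 -s0.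
  apply: mulmx_span_sub ws => y /sM[k ky]; rewrite [x]adjoint_decomp.
  rewrite linear_sum mulmx_suml; apply: memv_suml => i _.
  rewrite linearZ -scalemxAl; apply: memvZ => /=; have ei := adjoint_basis_root i.
  case: (adjoint_weight_root i) => [b0|rb].
    rewrite b0 in ei; have eh := root_vector0_h ei.
    by apply: (sH (Subvs eh)); exists k.
  case: (positive_or_negative rb) => [pb|nb]; first exact: sX ky pb ei.
  apply: sY nb _ _; first by rewrite opprK.
  by apply: Ms; exists k.
have sz : size fam == mdim V.
  have := eqP fs; rewrite full dimvf /dim /= => <-.
  by rewrite muln1.
pose t := Tuple sz; pose Q : 'M[C]_(mdim V) := \matrix_(i, j) (tnth t j) i 0.
have colQ j : col j Q = tnth t j by apply/colP => i; rewrite !mxE.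
have Qu : Q \in unitmx.
  pose c j := coord t j; pose W : 'M[C]_(mdim V) := \matrix_(j, k) c j (delta_mx k 0).
  suff /mulmx1_unit[] : Q *m W = 1%:M by [].
  apply/matrixP => i k.
  have dk : (delta_mx k 0 : 'cV[C]_(mdim V)) \in <<t>>%VS by rewrite full memvf.
  have /colP /(_ i) := coord_span dk; rewrite summxE mxE andbT => E.
  rewrite [RHS]mxE E mxE; apply: eq_bigr => j _.
  by rewrite !mxE (tnth_nth 0) mulrC.
have tM j : exists kb : nat * dual h, [/\ lowering_monomial v kb.1 (tnth t j),
    nat_comb al kb.2, weight_vector (V := V) (nu - kb.2) (tnth t j) &
    (0 < kb.1)%N -> kb.2 != 0].
  have [k kt] := sM _ (mem_tnth j t).
  have [b [pb bt b0]] := lowering_monomial_weight nuv kt.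
  by exists (k, b).
have [kb kbP] := choice tM.
have wbV : weight_basis Q (fun j => nu - (kb j).2).
  by split=> // j H; rewrite colQ; case: (kbP j) => _ _ ->.
exists Q, (fun j => nu - (kb j).2); split=> // [j|].
  by rewrite opprB addrC subrK; case: (kbP j).
have [i0 i0P] : exists i, nu - (kb i).2 = nu.
  by apply: (weight_in_basis wbV nuv); exact/eqP.
have tv j : nu - (kb j).2 = nu -> tnth t j = v.
  case: (kbP j) => + _ _; case: (kb j).1 => [//|k] _ /(_ isT) b0.
  by move/eqP; rewrite -subr_eq0 addrAC subrr add0r oppr_eq0 (negPf b0).
exists i0 => i; apply/eqP/eqP => [iP|->//].
apply/eqP; rewrite -(inj_eq val_inj) -(nth_uniq 0 _ _ (free_uniq fs)); last 2 first.
- by rewrite (eqP sz) ltn_ord.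
- by rewrite (eqP sz) ltn_ord.
by have := tv _ iP; rewrite -(tv _ i0P) !(tnth_nth 0) /= => ->.
Qed.

End HighestWeightModules.

(** * Dual bases and the Casimir element *)

Section DualBasis.

Lemma adjoint_basis_free (u : 'I_(\dim {:g}) -> C) :
  \sum_i u i *: e i = 0 -> forall i, u i = 0.
Proof.
move=> u0 i; pose w : 'cV[C]_(\dim {:g}) := \col_i u i.
have Pw : P *m w = 0.
  rewrite -[P *m w]vcolK; apply/eqP; rewrite -[0](linear0 colv); apply/eqP.
  congr colv; rewrite -[RHS]u0 -[P *m w]trmxK.
  have -> : P *m w = \sum_i u i *: col i P.
    by apply/colP => k; rewrite !mxE summxE; apply: eq_bigr => j _;
       rewrite !mxE mulrC.
  by rewrite trmxK linear_sum; apply: eq_bigr => j _; rewrite linearZ.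
have : w = 0 by rewrite -(mulKmx (basis_unit wb) w) Pw mulmx0.
by move/colP/(_ i); rewrite !mxE.
Qed.

(** The Gram matrix of the weight basis is invertible by nondegeneracy, and its inverse gives the
    dual basis. *)
Lemma dual_basis_exists : exists f : 'I_(\dim {:g}) -> g,
  (forall i, root_vector (- be i) (f i)) /\
  (forall i j, killing (e i) (f j) = (i == j)%:R).
Proof.
pose G : 'M[C]_(\dim {:g}) := \matrix_(i, j) killing (e i) (e j).
have Gu : G \in unitmx.
  rewrite -row_free_unit -kermx_eq0; apply/rowV0P => u /sub_kermxP uG.
  apply/rowP => i; rewrite mxE; apply: (adjoint_basis_free (u := fun i => u 0 i)).
  apply: killing_nondeg => Y; rewrite [Y]adjoint_decomp killing_sumr big1 // => j _.
  rewrite killingZr killingC killing_sumr.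
  have /rowP /(_ j) := uG; rewrite [LHS]mxE [RHS]mxE => Ej.
  suff -> : \sum_k killing (e j) (u 0 k *: e k) = 0 by rewrite mulr0.
  rewrite -[RHS]Ej; apply: eq_bigr => k _.
  by rewrite killingZr [G _ _]mxE killingC.
pose f j := \sum_k (invmx G) k j *: e k.
have fd i j : killing (e i) (f j) = (i == j)%:R.
  have /matrixP /(_ i j) := mulmxV Gu; rewrite [RHS]mxE => <-.
  rewrite killing_sumr mxE; apply: eq_bigr => k _.
  by rewrite killingZr mulrC [G _ _]mxE.
exists f; split=> // j H; apply/subr0_eq/killing_nondeg => Y.
rewrite killingC [Y]adjoint_decomp killingC killing_sumr big1 // => i _.
rewrite killingZr killingC killingDr -scaleNr killingZr fd.
rewrite -killing_inv lieC (adjoint_basis_root i H) -scaleNr killingZl fd.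
rewrite opp_lfunE; case: eqVneq => [->|_]; last by rewrite !mulr0 addr0 mulr0.
by rewrite opprK !mulr1 addNr mulr0.
Qed.

Variable f : 'I_(\dim {:g}) -> g.
Hypothesis f_root : forall i, root_vector (- be i) (f i).
Hypothesis f_dual : forall i j, killing (e i) (f j) = (i == j)%:R.

Lemma expand_adjoint_basis Y : Y = \sum_j killing Y (f j) *: e j.
Proof.
rewrite [LHS]adjoint_decomp; apply: eq_bigr => j _; congr (_ *: _).
rewrite [in RHS](adjoint_decomp Y) killingC killing_sumr (bigD1 j) //=.
rewrite killingZr killingC f_dual eqxx mulr1 big1 ?addr0 // => i ij.
by rewrite killingZr killingC f_dual (negPf ij) mulr0.
Qed.

Lemma expand_dual_basis Y : Y = \sum_j killing Y (e j) *: f j.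
Proof.
apply/subr0_eq/killing_nondeg => Z; rewrite [Z]adjoint_decomp killing_sumr.
rewrite big1 // => i _; rewrite killingZr killingC killingDr -scaleN1r killingZr.
rewrite killing_sumr (bigD1 i) //= killingZr f_dual eqxx mulr1 big1 => [|j ji].
  by rewrite addr0 mulN1r (killingC (e i)) subrr mulr0.
by rewrite killingZr f_dual eq_sym (negPf ji) mulr0.
Qed.

Lemma adjoint_basis_inj i j : is_root (be i) -> be i = be j -> i = j.
Proof.
move=> ri ij; have [Y YP] := root_space_dim1 ri.
have [x ex] := YP _ (adjoint_basis_root i).
have [y ey] : exists y, e j = y *: Y.
  by apply: YP; rewrite ij; exact: adjoint_basis_root.
apply/eqP; apply: contraT => nij.
have /(_ i) : forall k, y * (k == i)%:R - x * (k == j)%:R = 0.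
  apply: adjoint_basis_free.
  under eq_bigr do rewrite scalerBl -!scalerA; rewrite sumrB -!scaler_sumr.
  have S k : \sum_l (l == k)%:R *: e l = e k.
    by rewrite (bigD1 k) //= eqxx scale1r big1 ?addr0 // => l /negPf ->; rewrite scale0r.
  by rewrite !S ex ey !scalerA mulrC subrr.
rewrite eqxx (negPf nij) mulr0 subr0 mulr1 => y0.
by have := adjoint_basis_neq0 j; rewrite ey y0 scale0r eqxx.
Qed.

Section Casimir.
Variables (V : lieModule g) (Q : 'M[C]_(mdim V)) (mu : 'I_(mdim V) -> dual h).
Hypothesis wbV : weight_basis Q mu.

Definition casimir : 'M[C]_(mdim V) := \sum_i V (e i) *m V (f i).

(** Invariance makes the matrices of ad x in the two dual bases opposite transposes of each other,
    so the two double sums cancel. *)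
Lemma casimir_comm (x : g) : V x *m casimir = casimir *m V x.
Proof.
apply/subr0_eq; rewrite /casimir mulmx_sumr mulmx_suml -sumrB.
pose k i j := killing ⟦x, e i⟧ (f j).
transitivity (\sum_i \sum_j k i j *: (V (e j) *m V (f i))
              - \sum_i \sum_j k j i *: (V (e i) *m V (f j))); last first.
  by rewrite [X in _ - X]exchange_big /= subrr.
rewrite -sumrB; apply: eq_bigr => i _.
have xe : V ⟦x, e i⟧ = \sum_j k i j *: V (e j).
  rewrite [X in V X]expand_adjoint_basis linear_sum.
  by apply: eq_bigr => j _; rewrite linearZ.
have xf : V ⟦x, f i⟧ = - \sum_j k j i *: V (f j).
  rewrite [X in V X]expand_dual_basis linear_sum -sumrN.
  apply: eq_bigr => j _; rewrite linearZ /= -scaleNr; congr (_ *: _).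
  by rewrite /k killingC -killing_inv lieC -scaleN1r killingZl mulN1r.
have -> : \sum_j k i j *: (V (e j) *m V (f i)) = V ⟦x, e i⟧ *m V (f i).
  by rewrite xe mulmx_suml; apply: eq_bigr => j _; rewrite scalemxAl.
have -> : \sum_j k j i *: (V (e i) *m V (f j)) = - (V (e i) *m V ⟦x, f i⟧).
  rewrite xf mulmxN opprK mulmx_sumr; apply: eq_bigr => j _.
  by rewrite scalemxAr.
rewrite opprK !mact_bracket mulmxBl mulmxBr !mulmxA addrA.
by rewrite subrK.
Qed.

(** Schur's lemma: the weight space of nu is a line preserved by the Casimir element, which provides
    an eigenvalue c; the kernel of the difference with c is then a nonzero submodule. *)
Lemma casimir_scalar nu i0 : irreducible V ->
  (forall i, (mu i == nu) = (i == i0)) -> exists c : C, casimir = c%:M.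
Proof.
move=> [_ irr] mu_i0; have mi0 : mu i0 = nu by apply/eqP; rewrite mu_i0.
pose v := col i0 Q; have nuv : weight_vector nu v.
  by rewrite -mi0; exact: (basis_weight wbV).
have nuOv : weight_vector (V := V) nu (casimir *m v).
  by move=> H; rewrite mulmxA casimir_comm -mulmxA nuv scalemxAr.
have [c cv] : exists c : C, casimir *m v = c *: v.
  exists ((invmx Q *m (casimir *m v)) i0 0).
  rewrite [LHS](basis_decomp wbV) (bigD1 i0) //= big1 ?addr0 // => i ii0.
  apply/eqP; rewrite scaler_eq0; apply/orP; left.
  by apply: contraNT ii0 => /(weight_coord wbV nuOv) /eqP; rewrite mu_i0.
exists c; pose D := casimir - c%:M.
pose L : 'Hom('cV[C]_(mdim V), 'cV[C]_(mdim V)) := linfun (mulmx D).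
have LE w : L w = D *m w by rewrite lfunE.
have kerT : lker L = fullv.
  case: (irr (lker L)) => // [x w|k0].
    rewrite !memv_ker !LE => /eqP Dw; apply/eqP; rewrite mulmxA.
    have -> : D *m V x = V x *m D.
      by rewrite /D mulmxBl mulmxBr casimir_comm scalar_mxC.
    by rewrite -mulmxA Dw mulmx0.
  have : v \in lker L by rewrite memv_ker LE mulmxBl cv mul_scalar_mx subrr.
  by rewrite k0 memv0 (negPf (basis_col_neq0 wbV i0)).
apply/subr0_eq; rewrite -/D; apply/matrixP => i j; rewrite [in RHS]mxE.
have : delta_mx j 0 \in lker L by rewrite kerT memvf.
by rewrite memv_ker LE -colE => /eqP /colP /(_ i); rewrite !mxE.
Qed.

Variable Dp : seq (dual h).
Hypothesis Dp_uniq : uniq Dp.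
Hypothesis DpP : forall b : dual h, b \in Dp <-> positive_root al b.
Local Notation B := (in_basis (V := V) Q).

Definition weight_mult nu : C := #|[pred i | mu i == nu]|%:R.

(** The trace of e_b f_b on the weight space of nu. When b is a root, exactly one index k
    contributes. *)
Definition root_trace b nu : C :=
  \sum_(k | be k == b) \sum_(i | mu i == nu) (B (e k) *m B (f k)) i i.

Lemma weight_multE nu : weight_mult nu = \sum_(i | mu i == nu) 1.
Proof. by rewrite /weight_mult -sum1_card natr_sum. Qed.

(** Cyclicity of the trace, for X from the weight space of nu to that of nu + b and Y in the
    opposite direction. *)
Lemma trace_shift b X Y nu : root_vector b X -> root_vector (- b) Y ->
  \sum_(i | mu i == nu) (B Y *m B X) i i =
  \sum_(i | mu i == nu + b) (B X *m B Y) i i.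
Proof.
move=> bX bY.
transitivity (\sum_(i | mu i == nu) \sum_(j | mu j == nu + b) B Y i j * B X j i).
  apply: eq_bigr => i /eqP iP; rewrite mxE (bigID (fun j => mu j == nu + b)) /=.
  rewrite [X in _ + X]big1 ?addr0 // => j jP.
  suff -> : B X j i = 0 by rewrite mulr0.
  by apply: contraNeq jP => /(in_basis_root wbV bX) ->; rewrite iP.
rewrite exchange_big /=; apply: eq_bigr => j /eqP jP.
rewrite mxE [RHS](bigID (fun i => mu i == nu)) /= [X in _ = _ + X]big1 ?addr0.
  by apply: eq_bigr => i _; rewrite mulrC.
move=> i iP; suff -> : B Y i j = 0 by rewrite mulr0.
by apply: contraNeq iP => /(in_basis_root wbV bY) ->; rewrite jP addrK.
Qed.

Lemma trace_bracket b X Y nu : root_vector b X -> root_vector (- b) Y ->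
  \sum_(i | mu i == nu) (B X *m B Y) i i - \sum_(i | mu i == nu) (B Y *m B X) i i
  = killing X Y * form nu b * weight_mult nu.
Proof.
move=> bX bY; rewrite weight_multE mulr_sumr -sumrB; apply: eq_bigr => i /eqP <-.
have := in_basis_bracket wbV X Y; rewrite (bracket_opp bX bY) linearZ /=.
rewrite (in_basis_h wbV) => /matrixP /(_ i i); rewrite !mxE eqxx mulr1n => <-.
by rewrite mulr1 formE.
Qed.

Lemma root_trace_single k nu : is_root (be k) ->
  root_trace (be k) nu = \sum_(i | mu i == nu) (B (e k) *m B (f k)) i i.
Proof.
move=> rk; rewrite /root_trace (big_pred1 k) // => j /=.
apply/eqP/eqP => [jk|-> //]; apply/esym/adjoint_basis_inj => //.
Qed.

Lemma root_trace_diff b nu : is_root b ->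
  root_trace b nu - root_trace b (nu + b) = form nu b * weight_mult nu.
Proof.
move=> rb; have [k kb] := root_adjoint_weight rb; rewrite -kb in rb *.
have ek := adjoint_basis_root k; have fk := f_root k.
rewrite !root_trace_single // -(trace_shift nu ek fk) (trace_bracket nu ek fk).
by rewrite f_dual eqxx mul1r.
Qed.

(** Root spaces are lines, so by the dual normalization the pair for -b is the pair for b with its
    factors exchanged. *)
Lemma root_traceN b nu : is_root b -> root_trace (- b) nu = root_trace b (nu + b).
Proof.
move=> rb; have [k kb] := root_adjoint_weight rb.
have [l lb] := root_adjoint_weight (is_rootN rb); rewrite -lb -{1}kb.
have rl : is_root (be l) by rewrite lb; exact: is_rootN.
have rk : is_root (be k) by rewrite kb.
rewrite !root_trace_single //.
have [Y YP] := root_space_dim1 rl; have [Y' YP'] := root_space_dim1 rk.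
have fl : root_vector (be k) (f l) by rewrite kb -[b]opprK -lb; exact: f_root.
have fk : root_vector (be l) (f k) by rewrite lb -kb; exact: f_root.
have [x ex] := YP _ (adjoint_basis_root l); have [y ey] := YP _ fk.
have [x' ex'] := YP' _ fl; have [y' ey'] := YP' _ (adjoint_basis_root k).
have kl := f_dual l l; have kk := f_dual k k.
rewrite eqxx ex ex' killingZl killingZr in kl.
rewrite eqxx ey ey' killingZl killingZr killingC in kk.
have -> : B (e l) *m B (f l) = B (f k) *m B (e k).
  have BZ (p : C) (Z : g) : B (p *: Z) = p *: B Z by rewrite linearZ.
  rewrite ex ex' ey ey' !BZ -!scalemxAl -!scalemxAr !scalerA.
  have K0 : killing Y Y' != 0.
    by apply: contra_eq_neq kl => ->; rewrite !mulr0 eq_sym oner_eq0.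
  congr (_ *: _); apply: (mulIf K0).
  by rewrite -mulrA kl (mulrC y) -mulrA kk.
by rewrite (trace_shift nu (adjoint_basis_root k) (f_root k)) kb.
Qed.

Lemma cartan_trace nu : form nu nu * weight_mult nu =
  \sum_(k | be k == 0) \sum_(i | mu i == nu) (B (e k) *m B (f k)) i i.
Proof.
have -> : form nu nu = \sum_(k | be k == 0)
    killing (vsval (sharp h nu)) (f k) * killing (vsval (sharp h nu)) (e k).
  rewrite /Defs.form {2}[vsval _]expand_adjoint_basis killing_sumr.
  rewrite (bigID (fun k => be k == 0)) /= [X in _ + X]big1 ?addr0 => [|k k0].
    by apply: eq_bigr => k _; rewrite killingZr.
  rewrite killingZr (killing_orth (h_root_vector0 _) (f_root k)) ?mul0r //.
  by rewrite add0r oppr_eq0.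
rewrite mulr_suml; apply: eq_bigr => k /eqP k0.
have ek := adjoint_basis_root k; have fk := f_root k.
rewrite k0 in ek; rewrite k0 oppr0 in fk.
have eh := root_vector0_h ek; have fh := root_vector0_h fk.
rewrite weight_multE mulr_sumr; apply: eq_bigr => i /eqP <-.
have := in_basis_h wbV (Subvs eh); rewrite /= => ->.
have := in_basis_h wbV (Subvs fh); rewrite /= => ->.
rewrite mul_diag_mx !mxE eqxx mulr1n mulr1 -!killing_sharp /= mulrC.
by [].
Qed.

(** The Casimir element is split into its Cartan part and the pairs b, -b. Together with
    [root_trace_diff] this is the system behind Freudenthal's formula; here the root traces are
    eliminated by multiplication with the denominator. *)
Lemma casimir_trace (c : C) nu : casimir = c%:M ->
  c * weight_mult nu = form nu nu * weight_mult nu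
    + \sum_(b <- Dp) (root_trace b nu + root_trace b (nu + b)).
Proof.
move=> Oc; pose W k := \sum_(i | mu i == nu) (B (e k) *m B (f k)) i i.
have -> : c * weight_mult nu = \sum_k W k.
  rewrite exchange_big /= weight_multE mulr_sumr; apply: eq_bigr => i _.
  rewrite mulr1; transitivity ((invmx Q *m casimir *m Q) i i).
    by rewrite Oc -mulmxA mul_scalar_mx -scalemxAr mulVmx ?(basis_unit wbV) // !mxE eqxx mulr1.
  rewrite /casimir mulmx_sumr mulmx_suml summxE.
  by apply: eq_bigr => k _; rewrite (in_basisM wbV).
have Dpr b : b \in Dp -> is_root b by move=> /DpP [].
rewrite cartan_trace; transitivity (\sum_(k | be k == 0) W k
    + \sum_(b <- Dp) (root_trace b nu + root_trace (- b) nu)); last first.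
  congr (_ + _); rewrite big_seq [RHS]big_seq; apply: eq_bigr => b /Dpr rb.
  by rewrite root_traceN.
have RT d : root_trace d nu = \sum_k (if be k == d then W k else 0).
  by rewrite /root_trace big_mkcond.
have -> : \sum_(b <- Dp) (root_trace b nu + root_trace (- b) nu) =
    \sum_k \sum_(b <- Dp) ((if be k == b then W k else 0)
                            + (if be k == - b then W k else 0)).
  rewrite exchange_big /=; apply: eq_bigr => b _.
  by rewrite !RT big_split.
rewrite [X in X + _]big_mkcond -big_split /=; apply: eq_bigr => k _.
rewrite big_split /= -!big_mkcond /=.
have Dp0 : 0 \notin Dp by apply/negP => /Dpr [].
have single d : \sum_(b <- Dp | d == b) W k = if d \in Dp then W k else 0.
  case: ifP => dD; last first.
    by rewrite big_seq_cond big1 // => b /andP[bD /eqP E]; rewrite E bD in dD.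
  rewrite big_mkcond (bigD1_seq d) //= eqxx big1 ?addr0 // => b /negPf bd.
  by rewrite eq_sym bd.
have singleN : \sum_(b <- Dp | be k == - b) W k = if - be k \in Dp then W k else 0.
  by rewrite -single; apply: eq_bigl => b; rewrite eqr_oppLR.
rewrite single singleN; case: (adjoint_weight_root k) => [->|rk].
  by rewrite eqxx oppr0 (negPf Dp0) !addr0.
have -> : (be k == 0) = false by apply/eqP; case: rk.
have excl : be k \in Dp -> - be k \in Dp -> False.
  move=> /DpP[_ p1] /DpP[_ p2]; have := nat_comb_add_eq0 p1 p2.
  by rewrite subrr => /(_ erefl); case: rk.
rewrite add0r; case: (positive_or_negative rk) => [/DpP pk|/DpP nk].
  rewrite pk; case: ifP => nk; last by rewrite addr0.
  by case: (excl pk nk).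
rewrite nk; case: ifP => pk; last by rewrite add0r.
by case: (excl pk nk).
Qed.

End Casimir.
End DualBasis.

(** * Multiplication by the Weyl denominator *)

Section AlternatingSums.

(* The monomials of \prod_(b in s) (e^{-b/2} - e^{b/2}), as pairs (coefficient, exponent). *)
Fixpoint denominator_terms (s : seq (dual h)) : seq (C * dual h) :=
  if s is b :: s' then
    [seq (p.1, p.2 - 2%:R^-1 *: b) | p <- denominator_terms s'] ++
    [seq (- p.1, p.2 + 2%:R^-1 *: b) | p <- denominator_terms s']
  else [:: (1, 0)].

(** The exponents in [denominator_terms] are opposite to those of \prod (e^{b/2} - e^{-b/2}). Hence
    for [F x = m (lam + x)] this is the coefficient of e^lam in the product of the denominator with
    the sum of the m(mu) e^mu. *)
Definition term_sum s (F : dual h -> C) : C :=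
  \sum_(p <- denominator_terms s) p.1 * F p.2.

Lemma term_sum_nil F : term_sum [::] F = F 0.
Proof. by rewrite /term_sum big_seq1 mul1r. Qed.

Lemma term_sum_cons b s F : term_sum (b :: s) F =
  term_sum s (fun x => F (x - 2%:R^-1 *: b)) - term_sum s (fun x => F (x + 2%:R^-1 *: b)).
Proof.
rewrite /term_sum /= big_cat !big_map /=; congr (_ + _).
by rewrite -sumrN; apply: eq_bigr => p _; rewrite mulNr.
Qed.

Lemma eq_term_sum s F G : F =1 G -> term_sum s F = term_sum s G.
Proof. by move=> FG; apply: eq_bigr => p _; rewrite FG. Qed.

Lemma term_sumD s F G :
  term_sum s (fun x => F x + G x) = term_sum s F + term_sum s G.
Proof. by rewrite -big_split; apply: eq_bigr => p _; rewrite mulrDr. Qed.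

Lemma term_sumZ s k F : term_sum s (fun x => k * F x) = k * term_sum s F.
Proof. by rewrite mulr_sumr; apply: eq_bigr => p _; rewrite mulrCA. Qed.

Lemma term_sumB s F G :
  term_sum s (fun x => F x - G x) = term_sum s F - term_sum s G.
Proof. by rewrite -sumrB; apply: eq_bigr => p _; rewrite mulrBr. Qed.

Lemma term_sum_rem b s : b \in s -> forall F, term_sum s F = term_sum (b :: rem b s) F.
Proof.
elim: s => // c s IH; rewrite inE /= eq_sym.
case: eqVneq => [-> // | cb] /= bs F.
pose hc := 2%:R^-1 *: c.
transitivity (term_sum (b :: rem b s) (fun x => F (x - hc))
              - term_sum (b :: rem b s) (fun x => F (x + hc))).
  by rewrite [LHS]term_sum_cons; congr (_ - _); exact: IH.
rewrite !term_sum_cons !opprD !opprK !addrA.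
rewrite (addrAC _ (- _) (- _)); congr (_ - _ - _ + _);
  by apply: eq_term_sum => x; rewrite addrAC.
Qed.

Lemma perm_term_sum s1 s2 F : perm_eq s1 s2 -> term_sum s1 F = term_sum s2 F.
Proof.
elim: s1 s2 F => [|b s1 IH] s2 F; first by move/perm_size; case: s2.
move=> p12; have b2 : b \in s2 by rewrite -(perm_mem p12) mem_head.
rewrite (term_sum_rem b2) !term_sum_cons.
have p : perm_eq s1 (rem b s2).
  by rewrite -(perm_cons b); apply: (perm_trans p12); exact: perm_to_rem.
by rewrite !(IH _ _ p).
Qed.

Lemma term_sumN b s F : term_sum (- b :: s) F = - term_sum (b :: s) F.
Proof.
rewrite !term_sum_cons opprB; congr (_ - _); apply: eq_term_sum => x.
  by rewrite scalerN opprK.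
by rewrite scalerN.
Qed.

Lemma term_sum_map (t : {linear dual h -> dual h}) s F :
  term_sum (map t s) F = term_sum s (F \o t).
Proof.
elim: s F => [|b s IH] F; first by rewrite !term_sum_nil /= linear0.
rewrite /= !term_sum_cons !IH; congr (_ - _); apply: eq_term_sum => x /=.
  by congr F; rewrite linearB; congr (_ - _); rewrite linearZ.
by congr F; rewrite linearD; congr (_ + _); rewrite linearZ.
Qed.

(* The product rule for the derivations Phi b, when Phi b = A b - A b (. + b). *)
Lemma term_sum_leibniz (s : seq (dual h)) (Phi A : dual h -> dual h -> C) :
  (forall b c x, Phi (b + c) x = Phi b x + Phi c x) ->
  (forall k b x, Phi (k *: b) x = k * Phi b x) ->
  (forall b x, b \in s -> Phi b x = A b x - A b (x + b)) ->
  forall k, - (2%:R * term_sum s (fun x => Phi x (k + x))) =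
    term_sum s (fun x => \sum_(b <- s) (A b (k + x) + A b (k + x + b))).
Proof.
move=> PhiD PhiZ; elim: s => [|b s IH] PhiA k.
  rewrite !term_sum_nil big_nil -[X in Phi X](scale0r (0 : dual h)) PhiZ mul0r.
  by rewrite mulr0 oppr0.
have {}IH := IH (fun c x cs => PhiA c x (mem_behead (s := b :: s) cs)).
have PhiN c x : Phi (- c) x = - Phi c x by rewrite -scaleN1r PhiZ mulN1r.
pose hb := 2%:R^-1 *: b; have hbb : hb + hb = b.
  by rewrite -scalerDl -[RHS]scale1r; congr (_ *: _); field.
rewrite !term_sum_cons -/hb.
have E1 : term_sum s (fun x => Phi (x - hb) (k + (x - hb))) =
    term_sum s (fun x => Phi x (k - hb + x)) - 2%:R^-1 * term_sum s (fun x => Phi b (k + x - hb)).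
  rewrite -term_sumZ -term_sumB; apply: eq_term_sum => x.
  by rewrite PhiD PhiN PhiZ addrA (addrAC k (- hb)).
have E2 : term_sum s (fun x => Phi (x + hb) (k + (x + hb))) =
    term_sum s (fun x => Phi x (k + hb + x)) + 2%:R^-1 * term_sum s (fun x => Phi b (k + x + hb)).
  rewrite -term_sumZ -term_sumD; apply: eq_term_sum => x.
  by rewrite PhiD PhiZ addrA (addrAC k hb).
rewrite E1 E2; have I1 := IH (k - hb); have I2 := IH (k + hb).
have -> (x y z w : C) : - (2%:R * (x - 2%:R^-1 * y - (z + 2%:R^-1 * w))) =
    - (2%:R * x) + 2%:R * z + (y + w) by field.
rewrite I1 -[2%:R * _]opprK I2 -!term_sumD -!term_sumB -term_sumD.
apply: eq_term_sum => x; rewrite !big_cons !(PhiA b) ?mem_head //.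
have -> : k - hb + x = k + (x - hb) by rewrite addrA addrAC.
have -> : k + hb + x = k + (x + hb) by rewrite addrA addrAC.
rewrite -(addrA k x) -(addrA k x hb) -(addrA k (x - hb) b) -(addrA k (x + hb) b).
have -> : x - hb + b = x + hb by rewrite -hbb addrA subrK.
ring.
Qed.

End AlternatingSums.

(** * Symmetries and support of the Weyl denominator *)

Section WeylDenominator.
Variable Dp : seq (dual h).
Hypothesis Dp_uniq : uniq Dp.
Hypothesis DpP : forall b : dual h, b \in Dp <-> positive_root al b.
Definition half_sum : dual h := 2%:R^-1 *: \sum_(b <- Dp) b.
Local Notation rho := half_sum.

Lemma reflection_linear b : linear (reflection b).
Proof.
move=> k x y; rewrite /reflection formDl formZl scalerBr -[in RHS]addrA.
rewrite (addrCA (- (k *: _))) -opprD addrA; congr (_ - _).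
rewrite scalerA -scalerDl; congr (_ *: _); ring.
Qed.

HB.instance Definition _ b := GRing.isSemilinear.Build C _ _ _ (reflection b)
  (GRing.semilinear_linear (reflection_linear b)).

Lemma reflection_self b : is_root b -> reflection b b = - b.
Proof.
move=> rb; rewrite /reflection mulfK ?root_form_neq0 //.
by rewrite scaler_nat mulr2n opprD addrA subrr add0r.
Qed.

Lemma form_reflection b c : is_root b -> form (reflection b c) b = - form c b.
Proof.
move=> rb; rewrite /reflection formDl formNl formZl divfK ?root_form_neq0 //.
ring.
Qed.

Lemma reflectionK b : is_root b -> involutive (reflection b).
Proof.
move=> rb c; rewrite {1}/reflection form_reflection // {1}/reflection.
by rewrite mulrN mulNr scaleNr opprK subrK.
Qed.

Lemma form_reflection2 b c d : is_root b ->
  form (reflection b c) (reflection b d) = form c d.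
Proof.
move=> rb; rewrite {2}/reflection formDr formNr formZr form_reflection //.
rewrite /reflection formDl formNl formZl (formC b d).
have := root_form_neq0 rb => fb; field.
exact: fb.
Qed.

Lemma reflection_root b c : is_root b -> is_root c -> is_root (reflection b c).
Proof.
move=> rb rc; have [i ic] := root_adjoint_weight rc.
have [s sP] := weights_reflection (V := adjoint_module) wb rb.
case: (adjoint_weight_root (s i)); rewrite sP ic // => c0.
case: rc => + _; case; apply: (can_inj (reflectionK rb)).
by rewrite c0 linear0.
Qed.

Lemma form_pos b : (forall i, be i (sharp h b) \is Num.real) ->
  0 <= form b b ?= iff (b == 0).
Proof.
move=> br; have ge0 : 0 <= form b b.
  by rewrite form_trace; apply: sumr_ge0 => i _; rewrite -expr2 real_exprn_even_ge0.
split=> //; apply/eqP/eqP => [b0|->]; last by rewrite form0l.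
have bi i : be i (sharp h b) = 0.
  apply/eqP; move: (esym b0); rewrite form_trace => /eqP; rewrite psumr_eq0.
    by move/allP => /(_ i (mem_index_enum i)); rewrite /= mulf_eq0 orbb.
  by move=> j _; rewrite -expr2 real_exprn_even_ge0.
apply/lfunP => H; rewrite lfunE /= -[H]flatK -formE form_trace big1 // => i _.
by rewrite bi mul0r.
Qed.

Lemma al_root a : is_root (tnth al a).
Proof. by case: al_simple => _ rs _; exact: rs. Qed.

Lemma al_coef_inj (m n : 'I_r -> C) :
  \sum_a m a *: tnth al a = \sum_a n a *: tnth al a -> m =1 n.
Proof.
case: al_simple => bal _ _ E a.
have [H HP] := basis_functional (fun x => (x == a)%:R : C) bal.
have K (c : 'I_r -> C) : (\sum_x c x *: tnth al x : dual h) H = c a.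
  rewrite sum_lfunE (bigD1 a) //= big1 => [|x xa].
    by rewrite scale_lfunE HP eqxx addr0 /GRing.scale /= mulr1.
  by rewrite scale_lfunE HP (negPf xa) scaler0.
by rewrite -(K m) -(K n) E.
Qed.

Lemma nat_comb_al a : nat_comb al (tnth al a).
Proof.
exists (fun x => (x == a) : nat); rewrite (bigD1 a) //= eqxx scale1r.
by rewrite big1 ?addr0 // => x /negPf ->; rewrite scale0r.
Qed.

Lemma al_positive a : tnth al a \in Dp.
Proof. by apply/DpP; split; [exact: al_root | exact: nat_comb_al]. Qed.

(** A positive root other than the simple root involves a second simple root, since proper multiples
    of a root are not roots. The reflection leaves this coefficient unchanged, and one positive
    coefficient determines the sign of a root. *)
Lemma reflection_positive a b : b \in Dp -> b != tnth al a ->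
  reflection (tnth al a) b \in Dp /\ reflection (tnth al a) b != tnth al a.
Proof.
move=> /DpP[rb [m bm]] ba; have ra := al_root a.
have [x xa mx] : exists2 x, x != a & (0 < m x)%N.
  apply: contrapT => nx; have m0 x : x != a -> m x = 0%N.
    by move=> xa; apply/eqP; rewrite -leqn0 leqNgt; apply/negP => mx; apply: nx; exists x.
  have bma : b = (m a)%:R *: tnth al a.
    by rewrite bm (bigD1 a) //= big1 ?addr0 // => x /m0 ->; rewrite scale0r.
  have m1 : (1 < m a)%N.
    case: (m a) bma => [|[|//]]; rewrite ?scale0r ?scale1r => E.
      by case: rb => b0; rewrite E in b0.
    by rewrite E eqxx in ba.
  by apply: (root_multiple ra m1); rewrite -bma.
have rs := reflection_root ra rb; set k := 2%:R * form b (tnth al a) / form (tnth al a) (tnth al a).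
have sE : reflection (tnth al a) b = \sum_y ((m y)%:R - k * (y == a)%:R) *: tnth al y.
  rewrite /reflection -/k {1}bm; under [RHS]eq_bigr do rewrite scalerBl.
  rewrite sumrB; congr (_ - _); rewrite (bigD1 a) //= eqxx mulr1 big1 ?addr0 //.
  by move=> y /negPf ->; rewrite mulr0 scale0r.
split; last first.
  apply/eqP => E; have [n nE] := nat_comb_al a; move: (E); rewrite sE.
  have -> : tnth al a = \sum_y ((y == a)%:R : C) *: tnth al y.
    rewrite (bigD1 a) //= eqxx scale1r big1 ?addr0 // => y /negPf ->.
    by rewrite scale0r.
  move/al_coef_inj/(_ x); rewrite (negPf xa) mulr0 subr0 => /eqP.
  by rewrite pnatr_eq0 eqn0Ngt mx.
apply/DpP; split=> //; case: al_simple => _ _ /(_ _ rs) [//|[n nE]].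
have : \sum_y ((m y)%:R - k * (y == a)%:R) *: tnth al y = \sum_y (- (n y)%:R) *: tnth al y.
  by rewrite -sE -[LHS]opprK nE -sumrN; apply: eq_bigr => y _; rewrite scaleNr.
move/al_coef_inj/(_ x); rewrite (negPf xa) mulr0 subr0 => /eqP.
by rewrite -addr_eq0 -natrD pnatr_eq0 addn_eq0 eqn0Ngt mx.
Qed.

Lemma reflection_perm a : perm_eq (map (reflection (tnth al a)) Dp)
  (- tnth al a :: rem (tnth al a) Dp).
Proof.
have ra := al_root a; have sK := reflectionK ra.
have Nal : - tnth al a \notin Dp.
  apply/negP => /DpP[_ n1]; have := nat_comb_add_eq0 (nat_comb_al a) n1.
  by rewrite subrr => /(_ erefl); case: ra.
apply: uniq_perm.
- by rewrite map_inj_uniq //; exact: can_inj sK.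
- rewrite /= rem_uniq // andbT; apply: contra Nal; exact: mem_rem.
move=> c; rewrite inE (mem_rem_uniq _ Dp_uniq) inE.
apply/mapP/idP => [[b bD ->]|/orP[/eqP ->|/andP[ca cD]]].
- have [->|ba] := eqVneq b (tnth al a); first by rewrite reflection_self // eqxx.
  by have [-> ->] := reflection_positive bD ba; rewrite orbT.
- by exists (tnth al a); [exact: al_positive | rewrite reflection_self].
- exists (reflection (tnth al a) c); last by rewrite sK.
  by case: (reflection_positive cD ca).
Qed.

Lemma term_sum_antisym a F :
  term_sum Dp (F \o reflection (tnth al a)) = - term_sum Dp F.
Proof.
rewrite -(term_sum_map (reflection (tnth al a))).
rewrite (perm_term_sum _ (reflection_perm a)) term_sumN.
by rewrite (term_sum_rem (al_positive a)).
Qed.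

Lemma reflection_rho a : reflection (tnth al a) rho = rho - tnth al a.
Proof.
rewrite /half_sum linearZ linear_sum /= -(big_map _ predT id) /=.
rewrite (perm_big _ (reflection_perm a)) big_cons /=.
rewrite (perm_big _ (perm_to_rem (al_positive a))) /= [in RHS]big_cons.
rewrite !scalerDr scalerN; set x := 2%:R^-1 *: tnth al a.
have -> : tnth al a = x + x.
  by rewrite /x -scalerDl -[LHS]scale1r; congr (_ *: _); field.
by rewrite opprD addrA (addrAC x) subrr add0r addrC.
Qed.

Lemma form_rho a : 2%:R * form rho (tnth al a) = form (tnth al a) (tnth al a).
Proof.
have ra := al_root a; have fa := root_form_neq0 ra.
have /(congr1 (fun d => form d (tnth al a))) := reflection_rho a.
rewrite form_reflection // formDl formNl => E.
by rewrite mulrDl !mul1r -[X in _ + X]opprK E opprB addrC subrK.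
Qed.

Lemma denominator_terms_height s p : (forall b, b \in s -> nat_comb al b) ->
  p \in denominator_terms s -> nat_comb al (2%:R^-1 *: (\sum_(b <- s) b) - p.2) /\
    nat_comb al (2%:R^-1 *: (\sum_(b <- s) b) + p.2).
Proof.
have nat0 : nat_comb al (0 : dual h).
  by exists (fun=> 0%N); rewrite big1 // => a _; rewrite scale0r.
elim: s p => [|b s IH] p sP /=.
  by rewrite inE big_nil scaler0 => /eqP ->; rewrite subr0 addr0.
have pb := sP b (mem_head _ _).
have {}IH := IH ^~ (fun c cs => sP c (mem_behead (s := b :: s) cs)).
rewrite mem_cat big_cons scalerDr; set x := 2%:R^-1 *: b.
set y := 2%:R^-1 *: _; have bx : b = x + x.
  by rewrite /x -scalerDl -[LHS]scale1r; congr (_ *: _); field.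
case/orP => /mapP[q qs ->] /=; have [h1 h2] := IH q qs.
  split; last by rewrite (addrC x y) -!addrA (addrCA x) subrr addr0.
  by rewrite opprB addrACA -bx; exact: nat_combD.
split; first by rewrite opprD (addrC x y) -!addrA (addrCA x) subrr addr0.
by rewrite (addrC q.2) addrACA -bx; exact: nat_combD.
Qed.

(** The exponent -rho arises only by the choice of - b / 2 in every factor: a choice of + b / 2
    raises the height, and the other factors cannot compensate for this. *)
Lemma lowest_term s : (forall b, b \in s -> nat_comb al b /\ b != 0) ->
  term_sum s (fun x => (x == - (2%:R^-1 *: \sum_(b <- s) b))%:R) = 1.
Proof.
elim: s => [|b s IH] sP.
  by rewrite term_sum_nil big_nil scaler0 oppr0 eqxx.
have [pb b0] := sP b (mem_head _ _).
have {}sP c : c \in s -> nat_comb al c /\ c != 0.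
  by move=> cs; apply: sP; rewrite inE cs orbT.
rewrite term_sum_cons big_cons scalerDr; set y := 2%:R^-1 *: _ in IH *.
set x := 2%:R^-1 *: b; have bx : b = x + x.
  by rewrite /x -scalerDl -[LHS]scale1r; congr (_ *: _); field.
rewrite [X in X - _](_ : _ = 1) => [|]; last first.
  rewrite -[RHS](IH sP); apply: eq_term_sum => z.
  by rewrite opprD addrC (inj_eq (addrI _)).
rewrite [X in _ - X](_ : _ = 0) ?subr0 // /term_sum big_seq big1 // => p ps.
case: eqP => [E|_]; last by rewrite mulr0.
have [_] := denominator_terms_height (fun c cs => (sP c cs).1) ps.
rewrite -/y => py; have : y + p.2 + b = 0.
  rewrite bx addrA -(addrA y) E opprD addrCA addrA addrK.
  by rewrite addrC subrr.
rewrite addrC => /(nat_comb_add_eq0 pb py) b0'.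
by rewrite b0' eqxx in b0.
Qed.

Definition integral_weight x := forall a, exists z : int,
  2%:R * form x (tnth al a) = z%:~R * form (tnth al a) (tnth al a).

Lemma integral_weightB x y : integral_weight x -> integral_weight y ->
  integral_weight (x - y).
Proof.
move=> xi yi a; have [m mE] := xi a; have [n nE] := yi a; exists (m - n).
by rewrite formDl formNl mulrBr mE nE intrB mulrBl.
Qed.

Lemma integral_al a : integral_weight (tnth al a).
Proof.
move=> b; have [i <-] := root_adjoint_weight (al_root a).
exact: root_form_integral (al_root b).
Qed.

Lemma integral_nat_comb x : nat_comb al x -> integral_weight x.
Proof.
case=> m -> b; have [z zP] := choice (fun a => integral_al a b).
exists (\sum_a (m a)%:Z * z a).
rewrite form_suml mulr_sumr raddf_sum mulr_suml; apply: eq_bigr => a _.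
by rewrite formZl mulrCA zP /= intrM mulrA.
Qed.

Lemma integral_rho : integral_weight rho.
Proof. by move=> a; exists 1; rewrite mul1r form_rho. Qed.

Lemma root_form_real b x : is_root b -> (exists c : 'I_r -> C, (forall a, c a \is Num.real) /\
  x = \sum_a c a *: tnth al a) -> form b x \is Num.real.
Proof.
move=> rb [c [cr ->]]; rewrite formC form_suml; apply: rpred_sum => a _.
rewrite formZl rpredM // formC; have [i ib] := root_adjoint_weight rb.
have [z zP] := root_form_integral i (al_root a); rewrite -ib.
have -> : form (be i) (tnth al a) = z%:~R * form (tnth al a) (tnth al a) / 2%:R.
  by rewrite -zP mulrC mulKf // pnatr_eq0.
by rewrite !rpredM ?rpredV ?realz ?realn // gtr0_real // root_form_gt0 //; exact: al_root.
Qed.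

Lemma form_pos_comb (c : 'I_r -> C) : (forall a, c a \is Num.real) ->
  let x := \sum_a c a *: tnth al a in 0 <= form x x ?= iff (x == 0).
Proof.
move=> cr x; apply: form_pos => i; rewrite -formE.
case: (adjoint_weight_root i) => [->|ri]; first by rewrite form0l real0.
by apply: root_form_real ri _; exists c.
Qed.

Lemma nat_comb_form_ge0 x y : nat_comb al x ->
  (forall a, 0 <= form y (tnth al a)) -> 0 <= form x y.
Proof.
case=> c -> yP; rewrite form_suml; apply: sumr_ge0 => a _.
by rewrite formZl mulr_ge0 // formC.
Qed.

Lemma nat_comb_form_eq0 x y : nat_comb al x ->
  (forall a, 0 < form y (tnth al a)) -> form x y = 0 -> x = 0.
Proof.
case=> c -> yP; rewrite form_suml => /eqP; rewrite psumr_eq0 => [/allP c0|a _].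
  rewrite big1 // => a _; have := c0 a (mem_index_enum a).
  rewrite formZl mulf_eq0 formC (negPf (lt0r_neq0 (yP a))) orbF => /eqP ->.
  by rewrite scale0r.
by rewrite formZl mulr_ge0 // formC ltW.
Qed.

(* Weyl's argument: a dominant element of the support of the denominator is
   rho, because it is antisymmetric, and the support is W-invariant. *)
Lemma denominator_support x : term_sum Dp (fun y => (y == x)%:R) != 0 ->
  form x x = form rho rho.
Proof.
have [H0 H01] := height_functional.
pose d x := term_sum Dp (fun y => (y == x)%:R).
have Dpn b : b \in Dp -> nat_comb al b by move=> /DpP[].
have dn z : d z != 0 -> nat_comb al (rho - z).
  move=> dz; have [p pD pz] : exists2 p, p \in denominator_terms Dp & p.2 = z.
    apply: contrapT => np; move/eqP: dz; apply; rewrite /d /term_sum.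
    rewrite big_seq big1 // => p pD; case: eqP => [pz|_]; last by rewrite mulr0.
    by case: np; exists p.
  by rewrite -pz; case: (denominator_terms_height Dpn pD).
have ds a z : d (reflection (tnth al a) z) = - d z.
  rewrite /d -(term_sum_antisym a); apply: eq_term_sum => y /=.
  by rewrite (can2_eq (reflectionK (al_root a)) (reflectionK (al_root a))).
suff K n : forall z, d z != 0 -> (rho - z) H0 = n%:R -> form z z = form rho rho.
  move=> dx; have [n nE _] := nat_comb_height H01 (dn _ dx).
  exact: K nE.
elim/ltn_ind: n => n IH z dz zn.
have zi : integral_weight z.
  have := integral_weightB integral_rho (integral_nat_comb (dn _ dz)).
  by rewrite subKr.
have [k kE] := choice zi.
have sz a : reflection (tnth al a) z = z - (k a)%:~R *: tnth al a.
  rewrite /reflection kE mulfK //; exact: root_form_neq0 (al_root a).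
(* A reflection with k a < 0 brings z closer to rho, and k a = 0 would make d z its own opposite. *)
case: (pselect (exists a, k a <= 0)) => [[a ka]|kpos].
  have [k0|k0] := eqVneq (k a) 0.
    have := ds a z; rewrite sz k0 scale0r subr0 => /eqP.
    by rewrite -addr_eq0 -mulr2n mulrn_eq0 /= (negPf dz).
  have dsz : d (reflection (tnth al a) z) != 0 by rewrite ds oppr_eq0.
  rewrite -(form_reflection2 z z (al_root a)).
  have [l lE _] := nat_comb_height H01 (dn _ dsz).
  apply: (IH l) => //; rewrite -(ltr_nat C) -lE -zn sz.
  have -> : rho - (z - (k a)%:~R *: tnth al a) = rho - z + (k a)%:~R *: tnth al a.
    by rewrite opprB addrA addrAC.
  rewrite [X in X < _]add_lfunE scale_lfunE H01.
  by rewrite -[X in _ < X]addr0 ltrD2l /GRing.scale /= mulr1 ltrz0 lt_neqAle k0.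
(* Now every k a is at least 1, its value for rho. So z - rho is dominant, while rho - z is a
   nonnegative combination of simple roots, whence (rho - z, rho - z) <= 0. *)
have kp a : 0 < k a by rewrite ltNge; apply/negP => ka; apply: kpos; exists a.
have pz := dn _ dz; have [c cE] := pz.
have fz a : 0 <= form (z - rho) (tnth al a).
  rewrite -(pmulr_rge0 _ (ltr0Sn C 1)) formDl formNl mulrBr kE form_rho.
  rewrite -[X in _ - X]mul1r -mulrBl mulr_ge0 //; last first.
    exact: ltW (root_form_gt0 (al_root a)).
  by rewrite subr_ge0 ler1z -gtz0_ge1.
have : form (rho - z) (rho - z) <= 0.
  rewrite -{2}[rho - z]opprK formNr opprB oppr_le0.
  exact: nat_comb_form_ge0.
have := form_pos_comb (fun a => @realn C (c a)); rewrite -cE => -[ge0 eq0] le0.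
have : form (rho - z) (rho - z) == 0 by rewrite eq_le le0 ge0.
by rewrite eq_sym eq0 subr_eq0 => /eqP <-.
Qed.

(** * Coefficients of the denominator times an irreducible character *)

Section AlternatingMultiplicity.
Variables (V : lieModule g) (nu : dual h).
Hypothesis V_hw : irreducible_hw al V nu.
Variables (Q : 'M[C]_(mdim V)) (mu : 'I_(mdim V) -> dual h).
Hypothesis wbV : weight_basis Q mu.
Hypothesis mu_le : forall i, nat_comb al (nu - mu i).
Hypothesis mu_nu : exists i0, forall i, (mu i == nu) = (i == i0).
Local Notation m := (weight_mult mu).

Lemma highest_weight_dominant : (forall a, 0 <= form nu (tnth al a)) /\
  forall b, is_root b -> exists z : int, 2%:R * form nu b = z%:~R * form b b.
Proof.
have [i0 i0P] := mu_nu; have mi0 : mu i0 = nu by apply/eqP; rewrite i0P.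
split; last first.
  move=> b rb; apply: (string_integral wbV rb (basis_col_neq0 wbV i0)).
  by rewrite -mi0; exact: (basis_weight wbV).
move=> a; have [_ [v [v0 nuv Xv]]] := V_hw.
have [/eqP a0 [X /eqP X0 aX]] := al_root a.
have [Y aY XY] := opp_root_vector X0 aX.
have pa : positive_root al (tnth al a) by apply/DpP; exact: al_positive.
have v0' : v != 0 by apply/eqP.
have [n nE] := string_highest wbV a0 aX aY XY v0' nuv (Xv _ _ pa aX).
rewrite -(pmulr_rge0 _ (ltr0Sn C 1)) nE mulr_ge0 // ltW //.
exact: root_form_gt0 (al_root a).
Qed.

Lemma weight_mult_neq0 x : m x != 0 -> nat_comb al (nu - x).
Proof.
rewrite /weight_mult pnatr_eq0 -lt0n => /card_gt0P[i /=].
by rewrite inE => /eqP <-.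
Qed.

Lemma weight_mult_highest : m nu = 1.
Proof.
have [i0 i0P] := mu_nu; have i1 : #|[pred i | mu i == nu]| = 1%N.
  by rewrite -(card1 i0); apply: eq_card => i; rewrite !inE i0P.
by rewrite /weight_mult i1.
Qed.

(** Every exponent is -rho plus a nonnegative combination of simple roots, and no weight of V lies
    above nu; so only the exponent -rho contributes. *)
Lemma alternating_highest :
  term_sum Dp (fun x => m (nu + rho + x)) = 1.
Proof.
have DpQ b : b \in Dp -> nat_comb al b /\ b != 0.
  by move=> /DpP[[/eqP b0 _] nb].
rewrite -[RHS](lowest_term DpQ) /term_sum big_seq [RHS]big_seq.
apply: eq_bigr => p pD; congr (_ * _).
have [_] := denominator_terms_height (fun b bD => (DpQ b bD).1) pD.
rewrite -/half_sum => np; rewrite -addr_eq0 [p.2 + _]addrC -addrA.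
case: eqVneq => [->|np0]; first by rewrite addr0 weight_mult_highest.
apply/eqP; apply: contraT => /weight_mult_neq0.
rewrite opprD addrA subrr sub0r => nn; move: np0.
have := nat_comb_add_eq0 np nn; rewrite subrr => /(_ erefl) ->.
by rewrite eqxx.
Qed.

(** Let T z be the alternating sum. The Casimir traces and [term_sum_leibniz] express c T z as the
    signed sum of ((z + y, z + y) - 2 (y, z + y)) m(z + y) over the terms y of the denominator. The
    bracket is (z, z) - (y, y), and after cancellation only y with (y, y) = (rho, rho) remain. So T
    is supported where (z, z) = c + (rho, rho); the point nu + rho, where T is 1, determines c. *)
Lemma alternating_eigenvalue x : term_sum Dp (fun y => m (x + y)) != 0 ->
  form x x = form (nu + rho) (nu + rho).
Proof.
have [f [f_root f_dual]] := dual_basis_exists.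
have [i0 i0P] := mu_nu; have [irr _] := V_hw.
have [c Oc] := casimir_scalar f_dual wbV irr i0P.
suff K z : (c + form rho rho) * term_sum Dp (fun y => m (z + y)) =
    form z z * term_sum Dp (fun y => m (z + y)).
  move=> x0; have K1 := mulIf x0 (K x).
  have h0 : term_sum Dp (fun y => m (nu + rho + y)) != 0.
    by rewrite alternating_highest oner_eq0.
  by have K2 := mulIf h0 (K (nu + rho)); rewrite -K1 -K2.
pose Phi b y := form y b * m y; pose A := root_trace f Q mu.
have L := @term_sum_leibniz Dp Phi A.
have PhiD b d y : Phi (b + d) y = Phi b y + Phi d y by rewrite /Phi formDr mulrDl.
have PhiZ k b y : Phi (k *: b) y = k * Phi b y by rewrite /Phi formZr mulrA.
have PhiA b y : b \in Dp -> Phi b y = A b y - A b (y + b).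
  move=> /DpP[rb _]; rewrite /A /Phi.
  by rewrite (root_trace_diff f_root f_dual wbV).
have {}L := L PhiD PhiZ PhiA z.
have rr : term_sum Dp (fun y => form y y * m (z + y)) =
    form rho rho * term_sum Dp (fun y => m (z + y)).
  pose s := undup [seq p.2 | p <- denominator_terms Dp].
  have S (F : dual h -> C) : term_sum Dp F =
      \sum_(y <- s) term_sum Dp (fun w => (w == y)%:R) * F y.
    under eq_bigr do rewrite mulr_suml; rewrite exchange_big /=.
    rewrite /term_sum big_seq [RHS]big_seq; apply: eq_bigr => p pD.
    have ps : p.2 \in s by rewrite mem_undup map_f.
    rewrite (bigD1_seq p.2) ?undup_uniq //= eqxx mulr1 big1 ?addr0 // => y.
    by rewrite eq_sym => /negPf ->; rewrite mulr0 mul0r.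
  rewrite !S mulr_sumr; apply: eq_bigr => y _.
  have [->|dy] := eqVneq (term_sum Dp (fun w => (w == y)%:R)) 0.
    by rewrite !mul0r mulr0.
  by rewrite (denominator_support dy) mulrCA.
rewrite mulrDl -rr -!term_sumZ; apply/eqP; rewrite eq_sym -subr_eq; apply/eqP.
rewrite -term_sumB.
have -> : term_sum Dp (fun y => form z z * m (z + y) - form y y * m (z + y)) =
    term_sum Dp (fun y => form (z + y) (z + y) * m (z + y))
    - (2%:R * term_sum Dp (fun y => Phi y (z + y))).
  rewrite -term_sumZ -term_sumB; apply: eq_term_sum => y.
  by rewrite /Phi !formDl !formDr (formC y z); ring.
rewrite L -term_sumD; apply: eq_term_sum => y.
by rewrite (casimir_trace f_root f_dual wbV Dp_uniq DpP _ Oc).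
Qed.

(** If the sum is nonzero, then nu - lam is a nonnegative combination of simple roots, and lam + rho
    and nu + rho have the same length. Hence nu - lam is orthogonal to nu + lam + 2 rho, which is
    strictly dominant. *)
Lemma alternating_multiplicity lam : (forall a, 0 <= form lam (tnth al a)) ->
  term_sum Dp (fun x => m (lam + rho + x)) = (lam == nu)%:R.
Proof.
move=> lam0; have [->|ln] := eqVneq lam nu; first exact: alternating_highest.
apply/eqP; apply: contraT => T0; have E := alternating_eigenvalue T0.
have [p pD mp] : exists2 p, p \in denominator_terms Dp & m (lam + rho + p.2) != 0.
  apply: contrapT => np; move/eqP: T0; apply; rewrite /term_sum big_seq big1 // => p pD.
  apply/eqP; rewrite mulf_eq0; apply/orP; right.
  by apply: contraT => mp; case: np; exists p.
have Dpn b : b \in Dp -> nat_comb al b by move=> /DpP[].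
have [_] := denominator_terms_height Dpn pD; rewrite -/half_sum => np.
have nb : nat_comb al (nu - lam).
  have := nat_combD (weight_mult_neq0 mp) np.
  by rewrite -[lam + rho + p.2]addrA opprD (addrA nu) subrK.
have [nu0 _] := highest_weight_dominant.
have rho0 a : 0 < form rho (tnth al a).
  rewrite -(pmulr_rgt0 _ (ltr0Sn C 1)) form_rho; exact: root_form_gt0 (al_root a).
have : nu - lam = 0.
  apply: (nat_comb_form_eq0 (y := (nu + rho) + (lam + rho)) nb) => [a|].
    by rewrite !formDl addr_gt0 // ltr_wpDl.
  have -> : nu - lam = (nu + rho) - (lam + rho) by rewrite opprD addrACA subrr addr0.
  have K (u w : dual h) : form w w = form u u -> form (u - w) (u + w) = 0.
    by move=> uw; rewrite formDl formNl !formDr (formC w u) uw; ring.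
  exact: K E.
by move/subr0_eq/eqP; rewrite eq_sym (negPf ln).
Qed.

End AlternatingMultiplicity.

End WeylDenominator.

End RootSystem.

(** * Weights of tensor products *)

Section WeightLists.
Context {C : numFieldType} {g : lieAlgebra C} {h : {vspace g}}.
Implicit Types (V W : lieModule g) (s t : seq (dual h)).

Definition has_weights V s := exists (P : 'M[C]_(mdim V)) (mu : 'I_(mdim V) -> dual h),
  weight_basis P mu /\ perm_eq s [seq mu i | i <- enum 'I_(mdim V)].

Lemma weight_basisI V (P : 'M[C]_(mdim V)) (mu : 'I_(mdim V) -> dual h) :
  P \in unitmx ->
  (forall H : subvs_of h, V (vsval H) *m P = P *m diag_mx (\row_i mu i H)) ->
  weight_basis P mu.
Proof.
move=> Pu VP; split=> // i H; rewrite -col_mulmx VP col_mulmx.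
apply/colP => j; rewrite !mxE (bigD1 i) //= !mxE eqxx mulr1n big1 ?addr0.
  by rewrite mulrC.
by move=> k ki; rewrite !mxE (negPf ki) mulr0n mulr0.
Qed.

Lemma weight_basisE V (P : 'M[C]_(mdim V)) (mu : 'I_(mdim V) -> dual h) :
  weight_basis P mu ->
  forall H : subvs_of h, V (vsval H) *m P = P *m diag_mx (\row_i mu i H).
Proof.
move=> wb H; rewrite -(in_basis_h wb) /in_basis !mulmxA mulmxV ?mul1mx //.
exact: basis_unit wb.
Qed.

Lemma perm_map_perm (T : eqType) n (f : 'I_n -> T) (p : {perm 'I_n}) :
  perm_eq [seq f (p i) | i <- enum 'I_n] [seq f i | i <- enum 'I_n].
Proof.
rewrite (map_comp f p); apply: perm_map; apply: uniq_perm.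
- by rewrite map_inj_uniq ?enum_uniq //; exact: perm_inj.
- exact: enum_uniq.
by move=> i; rewrite mem_enum; apply/mapP; exists (p^-1%g i); rewrite ?mem_enum ?permKV.
Qed.

(** The matrix M that compares the two diagonalizations intertwines the diagonal matrices, so its
    nonzero entries join equal weights; being invertible, it has nonzero entries along a
    permutation. *)
Lemma conjugate_eigenvalues n n' (A : subvs_of h -> 'M[C]_n) (B : subvs_of h -> 'M[C]_n')
    (P : 'M[C]_(n', n)) (Q : 'M[C]_(n, n')) (R : 'M[C]_n) (R' : 'M[C]_n')
    (mu : 'I_n -> dual h) (mu' : 'I_n' -> dual h) :
  P *m Q = 1%:M -> Q *m P = 1%:M -> (forall H, P *m A H = B H *m P) ->
  R \in unitmx -> (forall H, A H *m R = R *m diag_mx (\row_i mu i H)) ->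
  R' \in unitmx -> (forall H, B H *m R' = R' *m diag_mx (\row_i mu' i H)) ->
  perm_eq [seq mu i | i <- enum 'I_n] [seq mu' i | i <- enum 'I_n'].
Proof.
move=> PQ QP; have e : n = n'.
  by apply/eqP; rewrite eqn_leq (mulmx1_min QP) (mulmx1_min PQ).
case: n' / e B P Q R' mu' PQ QP => B P Q R' mu' PQ _ PA Ru AR R'u BR.
pose M := invmx R' *m P *m R.
have Mu : M \in unitmx.
  by rewrite !unitmx_mul unitmx_inv R'u Ru; case: (mulmx1_unit PQ) => ->.
have MD H : M *m diag_mx (\row_i mu i H) = diag_mx (\row_i mu' i H) *m M.
  have BE : B H = R' *m diag_mx (\row_i mu' i H) *m invmx R' by rewrite -BR mulmxK.
  rewrite /M -mulmxA -AR mulmxA -(mulmxA _ P) PA BE !mulmxA.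
  by rewrite mulVmx // mul1mx.
have [p pP] := unitmx_perm_neq0 Mu.
have -> : [seq mu' i | i <- enum 'I_n] = [seq mu (p i) | i <- enum 'I_n].
  apply: eq_map => i; apply/lfunP => H; apply: (mulIf (pP i)).
  have /matrixP /(_ i (p i)) := MD H.
  rewrite mul_diag_mx mul_mx_diag !mxE => <-.
  by rewrite mulrC.
by rewrite perm_sym; exact: perm_map_perm.
Qed.

Lemma iso_weights V W s t : module_iso V W -> has_weights V s -> has_weights W t ->
  perm_eq s t.
Proof.
move=> [P [Q [PQ QP PV]]] [R [mu [wb ps]]] [R' [mu' [wb' pt]]].
rewrite (permPl ps) perm_sym (permPl pt) perm_sym.
apply: (conjugate_eigenvalues PQ QP (fun H => PV (vsval H))).
- exact: basis_unit wb.
- exact: weight_basisE wb.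
- exact: basis_unit wb'.
exact: weight_basisE wb'.
Qed.

Definition pair_sums s t := [seq a + b | a <- s, b <- t].

Lemma perm_big_eq (T : eqType) (s t : seq T) :
  (forall F : T -> nat, (\sum_(x <- s) F x = \sum_(x <- t) F x)%N) -> perm_eq s t.
Proof.
move=> st; apply/seq.permP => a; rewrite -!sum1_count big_mkcond [RHS]big_mkcond.
exact: st.
Qed.

Lemma sumn_enum n (F : 'I_n -> nat) :
  (\sum_(i <- enum 'I_n) F i = \sum_i F i)%N.
Proof. by rewrite big_enum. Qed.

Lemma tens_weights V W s t : has_weights V s -> has_weights W t ->
  has_weights (tens_module V W) (pair_sums s t).
Proof.
move=> [P [mu [wb ps]]] [Q [nu [wbQ pt]]].
pose ix (k : 'I_(mdim V * mdim W)) := mxtens_unindex k.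
exists (P *t Q), (fun k => mu (ix k).1 + nu (ix k).2); split.
  apply: weight_basisI => [|H].
    have : (P *t Q) *m (invmx P *t invmx Q) = 1%:M.
      rewrite tensmx_mul !mulmxV ?(basis_unit wb) ?(basis_unit wbQ) //.
      apply/matrixP => i j; case: (mxtens_indexP i) => i1 i2.
      case: (mxtens_indexP j) => j1 j2; rewrite tensmxE !mxE.
      rewrite (can_eq (@mxtens_indexK _ _)) xpair_eqE -natrM mulnb.
      by [].
    by case/mulmx1_unit.
  have DE (A : 'M[C]_(mdim V * mdim W)) d i j : (A *m diag_mx d) i j = A i j * d 0 j.
    by rewrite mul_mx_diag mxE.
  have -> : tens_module V W (vsval H) = tens_act V W (vsval H) by [].
  rewrite /tens_act mulmxDl !tensmx_mul !mul1mx (weight_basisE wb) (weight_basisE wbQ).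
  apply/matrixP => i j; case: (mxtens_indexP i) => i1 i2.
  case: (mxtens_indexP j) => j1 j2; rewrite DE [LHS]mxE !tensmxE !mul_mx_diag.
  rewrite !mxE /ix mxtens_indexK /= add_lfunE; ring.
rewrite perm_sym; apply: perm_big_eq => F.
rewrite big_map sumn_enum (reindex (@mxtens_index (mdim V) (mdim W))); last first.
  by exists (@mxtens_unindex _ _) => ? _; [exact: mxtens_indexK | exact: mxtens_unindexK].
have E p : F (mu (ix (mxtens_index p)).1 + nu (ix (mxtens_index p)).2) =
    F (mu p.1 + nu p.2) by rewrite /ix mxtens_indexK.
rewrite (eq_bigr _ (fun p _ => E p)).
rewrite -(pair_bigA _ (fun i j => F (mu i + nu j))) big_allpairs_dep.
rewrite (perm_big _ ps) big_map sumn_enum; apply: eq_bigr => i _.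
by rewrite (perm_big _ pt) big_map sumn_enum.
Qed.

Lemma sum_weights V W s t : has_weights V s -> has_weights W t ->
  has_weights (sum_module V W) (s ++ t).
Proof.
move=> [P [mu [wb ps]]] [Q [nu [wbQ pt]]].
pose ix (k : 'I_(mdim V + mdim W)) : dual h :=
  match fintype.split k with inl i => mu i | inr j => nu j end.
exists (block_mx P 0 0 Q), ix; split.
  apply: weight_basisI => [|H].
    by rewrite unitmxE det_ublock unitrM -!unitmxE (basis_unit wb) (basis_unit wbQ).
  have -> : \row_i ix i H = row_mx (\row_i mu i H) (\row_i nu i H).
    by apply/rowP => k; rewrite !mxE /ix; case: fintype.split => i; rewrite mxE.
  rewrite diag_mx_row /= /sum_act !mulmx_block !mulmx0 !mul0mx !addr0 !add0r.
  by rewrite (weight_basisE wb) (weight_basisE wbQ).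
rewrite perm_sym; apply: perm_big_eq => F.
rewrite big_map sumn_enum big_split_ord big_cat.
congr (_ + _)%N; rewrite ?(perm_big _ ps) ?(perm_big _ pt) big_map sumn_enum;
  apply: eq_bigr => i _; rewrite /ix.
  by rewrite (unsplitK (inl _ i)).
by rewrite (unsplitK (inr _ i)).
Qed.

Lemma trivial1_weights : has_weights (trivial_module 1) [:: 0].
Proof.
exists 1%:M, (fun=> 0); split; last first.
  apply: perm_big_eq => F; rewrite big_seq1 big_map sumn_enum /=.
  by rewrite big_ord1.
apply: weight_basisI => [|H]; first exact: unitmx1.
rewrite /= /zero_act mul0mx mul1mx; apply/matrixP => i j.
by rewrite !mxE lfunE mul0rn.
Qed.

Lemma trivial0_weights : has_weights (trivial_module 0) [::].
Proof.
exists 1%:M, (fun=> 0); split; last first.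
  by apply: perm_big_eq => F; rewrite big_nil big_map sumn_enum big_ord0.
apply: weight_basisI => [|H]; first exact: unitmx1.
by apply/matrixP => -[].
Qed.

Lemma big_tens_weights (I : Type) (Vs : I -> lieModule g) (w : I -> seq (dual h)) l :
  (forall i, has_weights (Vs i) (w i)) ->
  has_weights (big_tens (map Vs l)) (foldr pair_sums [:: 0] (map w l)).
Proof.
move=> Vw; elim: l => [|i l IH]; first exact: trivial1_weights.
exact: tens_weights.
Qed.

Lemma big_sum_weights (I : eqType) (Vs : I -> lieModule g) (w : I -> seq (dual h)) l :
  {in l, forall i, has_weights (Vs i) (w i)} ->
  has_weights (big_sum (map Vs l)) (flatten (map w l)).
Proof.
elim: l => [|i l IH] Vw; first exact: trivial0_weights.
apply: sum_weights; first by apply: Vw; rewrite mem_head.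
by apply: IH => j jl; apply: Vw; rewrite inE jl orbT.
Qed.

End WeightLists.

(** * Real weights and characters *)

Section RealCoordinates.
Context {R : realType} {g : lieAlgebra R[i]} {h : {vspace g}}.
Context {r : nat} {al : r.-tuple (dual h)}.
Hypothesis g_simple : simple_lie g.
Hypothesis h_cartan : cartan_subalgebra h.
Hypothesis al_simple : simple_roots al.
Variables (P : 'M[R[i]]_(\dim {:g})) (be : 'I_(\dim {:g}) -> dual h).
Hypothesis wb : weight_basis (V := adjoint_module) P be.
Local Notation B := (Bmx al).
Local Notation comb := (comb al).
Implicit Types (v w : 'rV[R]_r).

Let fDl := formDl g_simple h_cartan al_simple wb.
Let fZl := formZl g_simple h_cartan al_simple wb.
Let fS := form_suml g_simple h_cartan al_simple wb.

Lemma comb_linear k v w : comb (k *: v + w) = k%:C *: comb v + comb w.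
Proof.
rewrite /Defs.comb scaler_sumr -big_split; apply: eq_bigr => a _ /=.
by rewrite !mxE rmorphD rmorphM /= scalerDl scalerA.
Qed.

Lemma comb0 : comb 0 = 0.
Proof. by rewrite /Defs.comb big1 // => a _; rewrite mxE rmorph0 scale0r. Qed.

Lemma combZ k v : comb (k *: v) = k%:C *: comb v.
Proof. by rewrite -[X in comb X]addr0 comb_linear comb0 addr0. Qed.

Lemma combD v w : comb (v + w) = comb v + comb w.
Proof. by rewrite -[X in comb (X + _)]scale1r comb_linear rmorph1 scale1r. Qed.

Lemma combN v : comb (- v) = - comb v.
Proof. by rewrite -scaleN1r combZ rmorphN rmorph1 scaleN1r. Qed.

Lemma combB v w : comb (v - w) = comb v - comb w.
Proof. by rewrite combD combN. Qed.

Lemma comb_delta a : comb (delta_mx 0 a) = tnth al a.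
Proof.
rewrite /Defs.comb (bigD1 a) //= mxE !eqxx rmorph1 scale1r big1 ?addr0 // => b ba.
by rewrite mxE (negPf ba) andbF rmorph0 scale0r.
Qed.

Lemma comb_inj : injective comb.
Proof.
move=> v w vw; apply/rowP => a.
have := al_coef_inj al_simple vw a; exact: complexI.
Qed.

Lemma form_al_real a b : form (tnth al a) (tnth al b) = (B a b)%:C.
Proof.
rewrite mxE /rform RRe_real //.
have [z zE] := integral_al g_simple h_cartan al_simple wb a b.
have r0 := root_form_gt0 g_simple h_cartan al_simple wb (al_root al_simple b).
have -> : form (tnth al a) (tnth al b) = z%:~R * form (tnth al b) (tnth al b) / 2%:R.
  by rewrite -zE mulrC mulKf // pnatr_eq0.
by rewrite !rpredM ?rpredV ?realz ?realn ?gtr0_real.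
Qed.

Lemma form_comb v w : form (comb v) (comb w) = ((v *m B *m w^T) 0 0)%:C.
Proof.
rewrite /Defs.comb fS mxE rmorph_sum /=.
transitivity (\sum_a \sum_b ((v 0 a * B a b * w 0 b)%:C : R[i])).
  apply: eq_bigr => a _; rewrite fZl formC fS mulr_sumr.
  apply: eq_bigr => b _; rewrite fZl formC form_al_real !rmorphM /=.
  by rewrite mulrA mulrAC.
rewrite exchange_big /=; apply: eq_bigr => b _; rewrite !mxE mulr_suml rmorph_sum /=.
by apply: eq_bigr => a _.
Qed.

Lemma Bmx_sym : B^T = B.
Proof. by apply/matrixP => a b; rewrite !mxE /rform formC. Qed.

Lemma Bmx_pos (x : 'rV[R]_r) : x != 0 -> 0 < (x *m B *m x^T) 0 0.
Proof.
move=> x0; have xr a : ((x 0 a)%:C : R[i]) \is Num.real by rewrite complex_real.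
have := form_pos_comb g_simple h_cartan al_simple wb xr.
rewrite -[\sum_a _]/(comb x) => -[ge0 eq0].
rewrite -ltcR -form_comb rmorph0 lt_neqAle ge0 andbT eq0 -comb0.
by rewrite (inj_eq comb_inj).
Qed.

Lemma Bmx_diag_gt0 a : 0 < B a a.
Proof.
pose d : 'rV[R]_r := delta_mx 0 a; have := Bmx_pos (x := d).
have -> : (d *m B *m d^T) 0 0 = B a a.
  by rewrite /d -rowE trmx_delta -colE !mxE.
apply; apply/eqP => /rowP /(_ a); rewrite !mxE !eqxx => /eqP.
by rewrite oner_eq0.
Qed.

(* An element of h^* whose products with the simple roots are real is a real
   combination of them: its imaginary part is orthogonal to itself. *)
Lemma real_weight_comb (mu : dual h) :
  (forall a, form mu (tnth al a) \is Num.real) -> exists v, mu = comb v.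
Proof.
move=> mur; case: al_simple => bal _ _.
have muE : mu = \sum_a (coord al a mu) *: tnth al a.
  rewrite {1}(coord_basis bal (memvf mu)); apply: eq_bigr => a _.
  by rewrite (tnth_nth 0).
pose v : 'rV[R]_r := \row_a complex.Re (coord al a mu).
pose w : 'rV[R]_r := \row_a complex.Im (coord al a mu).
have muvw : mu = comb v + 'i%C *: comb w.
  rewrite muE /Defs.comb scaler_sumr -big_split; apply: eq_bigr => a _ /=.
  rewrite scalerA -scalerDl; congr (_ *: _); rewrite !mxE.
  by rewrite [LHS]complexE.
suff w0 : w = 0 by exists v; rewrite muvw w0 comb0 scaler0 addr0.
apply/eqP; apply: contraT => /Bmx_pos.
have -> : (w *m B *m w^T) 0 0 = 0; last by rewrite ltxx.
have wB a : (w *m B) 0 a = 0.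
  have := mur a; rewrite muvw fDl fZl -comb_delta !form_comb trmx_delta.
  rewrite -colE [col _ _ _ _]mxE -colE [col _ _ _ _]mxE.
  move=> /Creal_ImP; rewrite -complexIm; case.
  by rewrite /= ?(mul0r, mulr0, mul1r, add0r, addr0).
by rewrite mxE big1 // => a _; rewrite wB mul0r.
Qed.

Definition simple_reflection a v : 'rV[R]_r :=
  v - (2%:R * (v *m B) 0 a / B a a) *: delta_mx 0 a.

Lemma comb_reflect a v : reflection (tnth al a) (comb v) = comb (simple_reflection a v).
Proof.
have E : 2%:R * form (comb v) (tnth al a) / form (tnth al a) (tnth al a) =
    (2%:R * (v *m B) 0 a / B a a)%:C.
  rewrite form_al_real -(comb_delta a) form_comb trmx_delta -colE [col _ _ _ _]mxE.
  by rewrite fmorph_div rmorphM rmorph_nat.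
by rewrite /reflection E /simple_reflection combB combZ comb_delta.
Qed.

Section RealWeights.
Variables (Dp : seq (dual h)).
Hypothesis Dp_uniq : uniq Dp.
Hypothesis DpP : forall b : dual h, b \in Dp <-> positive_root al b.

Lemma root_comb (b : dual h) : b \in Dp ->
  exists n : 'I_r -> nat, b = comb (\row_a (n a)%:R) /\ exists a, (0 < n a)%N.
Proof.
move=> /DpP[[b0 _] [n nE]]; exists n; split.
  by rewrite nE; apply: eq_bigr => a _; rewrite mxE rmorph_nat.
apply: contrapT => n0; apply: b0; rewrite nE big1 // => a _.
case: (posnP (n a)) => [->|na]; first by rewrite scale0r.
by case: n0; exists a.
Qed.

Lemma sum_weight_mult (V : lieModule g) (mu : 'I_(mdim V) -> dual h) (x : dual h)
    (s : seq (dual h)) : perm_eq s [seq mu i | i <- enum 'I_(mdim V)] ->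
  weight_mult mu x = \sum_(y <- s) (y == x)%:R.
Proof.
move=> ps; rewrite (perm_big _ ps) big_map big_enum /= weight_multE big_mkcond.
by apply: eq_bigr => i _; case: eqP.
Qed.

(** This collects what the analysis uses about an irreducible module. The alternative comes from the
    kernel of V, an ideal of the simple algebra: if it is everything, all weights are 0; if it is 0,
    a root vector of each simple root has a nonzero matrix entry, and the two weights joined by this
    entry differ by the root. *)
Lemma irreducible_weights (V : lieModule g) (nu : dual h) : irreducible_hw al V nu ->
  exists2 c : seq 'rV[R]_r, has_weights V (map comb c) &
  [/\ exists2 n, n \in c & comb n = nu /\
        forall v, v \in c -> exists k : 'I_r -> nat, n - v = \row_a (k a)%:R,
      forall a, perm_eq (map (simple_reflection a) c) c,
      (forall v, v \in c -> v = 0) \/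
        (forall a, exists v w, [/\ v \in c, w \in c & v - w = delta_mx 0 a]) &
      forall lam : dual h, (forall a, 0 <= form lam (tnth al a)) ->
        \sum_(v <- c) term_sum Dp (fun y => (comb v == lam + half_sum Dp + y)%:R)
          = (lam == nu)%:R :> R[i] ].
Proof.
move=> Vhw; have [Q [mu [wbV mu_le mu_nu]]] :=
  highest_weight_basis g_simple h_cartan al_simple wb Vhw.
have muR i : exists v, mu i = comb v.
  apply: real_weight_comb => a; have ra := al_root al_simple a.
  have [z zE] := string_integral g_simple h_cartan al_simple wb wbV ra
    (basis_col_neq0 wbV i) (basis_weight wbV i).
  have -> : form (mu i) (tnth al a) = z%:~R * form (tnth al a) (tnth al a) / 2%:R.
    by rewrite -zE mulrC mulKf // pnatr_eq0.
  have r0 := root_form_gt0 g_simple h_cartan al_simple wb ra.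
  by rewrite !rpredM ?rpredV ?realz ?realn ?gtr0_real.
have [f fE] := choice muR.
pose c := [seq f i | i <- enum 'I_(mdim V)].
have cE : map comb c = [seq mu i | i <- enum 'I_(mdim V)].
  by rewrite -map_comp; apply: eq_map => i /=; rewrite fE.
have cP v : v \in c -> exists i, v = f i by move=> /mapP[i _ ->]; exists i.
have fc i : f i \in c by rewrite map_f ?mem_enum.
exists c; first by exists Q, mu; rewrite cE.
have [i0 i0P] := mu_nu; split.
- exists (f i0) => //; split; first by rewrite -fE; apply/eqP; rewrite i0P.
  move=> v /cP[i ->]; have [k kE] := mu_le i; exists k.
  apply: comb_inj; rewrite combB -!fE.
  have -> : mu i0 = nu by apply/eqP; rewrite i0P.
  by rewrite kE; apply: eq_bigr => a _; rewrite mxE rmorph_nat.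
- move=> a; have [s sP] := weights_reflection g_simple h_cartan al_simple wb wbV (al_root al_simple a).
  rewrite -map_comp.
  have -> : [seq (simple_reflection a \o f) i | i <- enum 'I_(mdim V)] =
      [seq f (s i) | i <- enum 'I_(mdim V)].
    apply: eq_map => i /=; apply: comb_inj; rewrite -comb_reflect -!fE.
    by rewrite sP.
  exact: perm_map_perm.
- pose K : {vspace g} := lker (linfun (mact V)).
  have KP x : (x \in K) = (V x == 0) by rewrite memv_ker lfunE.
  case: g_simple => _ /(_ K) [|K0|KT].
  + move=> x y; rewrite !KP => /eqP y0; apply/eqP.
    by rewrite mact_bracket y0 mulmx0 mul0mx subrr.
  + right=> a; have [_ [X X0 aX]] := al_root al_simple a.
    have VX : in_basis Q X != 0.
      apply/eqP => BX; apply: X0; apply/eqP; rewrite -memv0 -K0 KP.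
      have Qu := basis_unit wbV.
      by rewrite -[V X](mulKVmx Qu) -[invmx Q *m _](mulmxK Qu) -/(in_basis Q X) BX mul0mx mulmx0.
    have [i [j Xij]] : exists i j, in_basis Q X i j != 0.
      apply: contrapT => nx; move/eqP: VX; apply; apply/matrixP => i j.
      rewrite [RHS]mxE; apply/eqP; apply: contraT => nij; case: nx.
      by exists i, j.
    exists (f i), (f j); split=> //; apply: comb_inj; rewrite combB -!fE.
    by rewrite (in_basis_root wbV aX Xij) addrAC subrr add0r comb_delta.
  + left=> v /cP[i ->]; apply: comb_inj; rewrite -fE comb0.
    apply: (weight_vector_uniq (basis_weight wbV i) _ (basis_col_neq0 wbV i)) => H.
    have /eqP -> : V (vsval H) == 0 by rewrite -KP KT memvf.
    by rewrite mul0mx lfunE /= scale0r.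
move=> lam lam0.
have := alternating_multiplicity g_simple h_cartan al_simple wb Dp_uniq DpP Vhw
  wbV mu_le mu_nu lam0.
move=> <-; rewrite /term_sum exchange_big /=; apply: eq_bigr => p _.
rewrite -mulr_sumr -(big_map comb predT (fun y => (y == lam + half_sum Dp + p.2)%:R)).
congr (_ * _); rewrite (@sum_weight_mult V mu _ (map comb c)) //.
by rewrite cE.
Qed.

Section TensorPower.
Variables (m : nat) (V : 'I_m -> lieModule g) (c : 'I_m -> seq 'rV[R]_r).
Hypothesis cV : forall k, has_weights (V k) (map comb (c k)).
Variable N : 'I_m -> nat.

Definition tensor_exponents : seq 'rV[R]_r :=
  foldr (fun s t => [seq a + b | a <- s, b <- t]) [:: 0]
    [seq c k | k <- flatten [seq nseq (N k) k | k <- enum 'I_m]].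

Lemma tensor_powers_weights :
  has_weights (tensor_powers V N) (map comb tensor_exponents).
Proof.
have := big_tens_weights (flatten [seq nseq (N k) k | k <- enum 'I_m]) cV.
have -> : map V (flatten [seq nseq (N k) k | k <- enum 'I_m])
    = flatten [seq nseq (N k) (V k) | k <- enum 'I_m].
  by rewrite map_flatten -map_comp; congr flatten; apply: eq_map => k /=; rewrite map_nseq.
congr (has_weights _ _); rewrite /tensor_exponents.
elim: (flatten _) => [|k l IH] /=; first by rewrite comb0.
rewrite IH /pair_sums; elim: (c k) => //= v s IHs; rewrite map_cat IHs.
by congr (_ ++ _); rewrite -!map_comp; apply: eq_map => w /=; rewrite combD.
Qed.

(** The left-hand side depends only on the multiset of weights and is additive over direct sums; on
    an irreducible summand of highest weight mu it is 1 or 0 according to whether mu is lam. *)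
Lemma multiplicity_exponents (lam : dual h) (n : nat) :
  (forall a, 0 <= form lam (tnth al a)) ->
  multiplicity al (tensor_powers V N) lam n ->
  \sum_(v <- tensor_exponents)
     term_sum Dp (fun y => (comb v == lam + half_sum Dp + y)%:R) = n%:R :> R[i].
Proof.
move=> lam0 [wts [W [mt [wu Whw Tiso ->]]]].
pose F (v : dual h) : R[i] := term_sum Dp (fun y => (v == lam + half_sum Dp + y)%:R).
have cW mu : exists c : seq 'rV[R]_r, mu \in wts -> has_weights (W mu) (map comb c) /\
    \sum_(v <- c) F (comb v) = (lam == mu)%:R.
  case: (boolP (mu \in wts)) => mw; last by exists [::].
  have [d dW [_ _ _ dF]] := irreducible_weights (Whw _ mw).
  by exists d => _; split=> //; exact: dF.
have [d dP] := choice cW.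
pose l := flatten [seq nseq (mt mu) mu | mu <- wts].
have lw mu : mu \in l -> mu \in wts.
  by move=> /flattenP[s /mapP[nu nw ->] /nseqP[-> _]].
have sw := big_sum_weights (Vs := W) (w := fun mu => map comb (d mu)) (l := l)
  (fun mu ml => (dP _ (lw _ ml)).1).
have El : map W l = flatten [seq nseq (mt mu) (W mu) | mu <- wts].
  by rewrite map_flatten -map_comp; congr flatten; apply: eq_map => k /=; rewrite map_nseq.
rewrite El in sw; have pe := iso_weights Tiso tensor_powers_weights sw.
rewrite -(big_map comb predT F) (perm_big _ pe) big_flatten big_map.
rewrite /l big_flatten big_map; transitivity (\sum_(mu <- wts) (mt mu)%:R * (lam == mu)%:R : R[i]).
  rewrite big_seq [RHS]big_seq; apply: eq_bigr => mu mw.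
  rewrite big_nseq big_map (dP _ mw).2; elim: (mt mu) => [|k IH] /=.
    by rewrite mul0r.
  by rewrite IH -[k.+1%:R]natr1 mulrDl mul1r addrC.
case: ifP => lw'; last first.
  rewrite big_seq big1 // => mu mw; case: eqP => [E|_]; last by rewrite mulr0.
  by rewrite E mw in lw'.
rewrite (bigD1_seq lam) //= eqxx mulr1 big1 ?addr0 // => mu ml.
by rewrite eq_sym (negPf ml) mulr0.
Qed.

End TensorPower.
End RealWeights.

End RealCoordinates.

(** * Exponentials of diagonalizable matrices, and characters *)

Section ExponentialTrace.
Context {R : realType}.

Lemma cvg_real_complex (u : R^nat) (l : R) :
  u @ \oo --> l ->
  (fun n => (u n)%:C : Num.NumField.sort R[i]) @ \oo --> (l%:C : Num.NumField.sort R[i]).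
Proof.
move=> ul; apply/cvgrPdist_lt => e e0.
have er : (complex.Re e)%:C = e by apply: RRe_real; exact: gtr0_real.
have e0' : 0 < complex.Re e by rewrite -ltcR er rmorph0.
move/cvgrPdist_lt : ul => /(_ _ e0'); apply: filterS => n un.
by rewrite -rmorphB normc_def /= expr0n /= addr0 sqrtr_sqr -er ltcR.
Qed.

Lemma cvg_mx_entries (K : numFieldType) m n (u : nat -> 'M[K]_(m, n)) (l : 'M[K]_(m, n)) :
  (forall i j, (fun k => u k i j) @ \oo --> l i j) -> u @ \oo --> l.
Proof.
move=> ul; apply/cvg_ballP => e e0.
have : \forall k \near \oo, forall i : 'I_m, forall j : 'I_n, ball (l i j) e (u k i j).
  apply: filter_forall => i; apply: filter_forall => j.
  by move/cvg_ballP : (ul i j) => /(_ _ e0).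
by apply: filterS => k uk; split.
Qed.

Lemma cvg_sumr (K : numFieldType) (I : Type) (s : seq I) (u : I -> nat -> K) (l : I -> K) :
  (forall i, u i @ \oo --> l i) ->
  (fun n => \sum_(i <- s) u i n) @ \oo --> \sum_(i <- s) l i.
Proof.
move=> ul; elim: s => [|i s IH].
  by rewrite big_nil; under eq_fun do rewrite big_nil; exact: cvg_cst.
rewrite big_cons; under eq_fun do rewrite big_cons.
by apply: cvgD; [exact: ul | exact: IH].
Qed.

(** [expmx] is a limit, so its value can be used only once convergence is known: diagonalization
    reduces it, entry by entry, to the scalar exponential series. *)
Lemma trace_expmx n (M P : 'M[R[i]]_n) (d : 'I_n -> R) : P \in unitmx ->
  M *m P = P *m diag_mx (\row_i (d i)%:C) ->
  \tr (expmx M) = (\sum_i expR (d i))%:C.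
Proof.
move=> Pu MP; pose D (z : 'I_n -> R) : 'M[R[i]]_n := diag_mx (\row_i (z i)%:C).
have ME : M = P *m D d *m invmx P by rewrite -MP mulmxK.
have Mk k : M ^+ k = P *m D (fun i => d i ^+ k) *m invmx P.
  elim: k => [|k IH].
    rewrite expr0 (_ : D _ = 1%:M) ?mulmx1 ?mulmxV //.
    by apply/matrixP => i j; rewrite !mxE expr0.
  rewrite exprS -mulmxE IH ME -!mulmxA (mulKmx Pu); congr (_ *m _).
  rewrite !mulmxA; congr (_ *m _); apply/matrixP => i j.
  rewrite mul_diag_mx !mxE; case: eqVneq => [->|_]; last by rewrite !mulr0n mulr0.
  by rewrite !mulr1n -rmorphM exprS.
pose s N i := \sum_(k < N) (k`!%:R)^-1 * d i ^+ k.
have SN N : \sum_(k < N) (k`!%:R)^-1 *: M ^+ k = P *m D (s N) *m invmx P.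
  have -> : D (s N) = \sum_(k < N) (k`!%:R)^-1 *: D (fun i => d i ^+ k).
    apply/matrixP => i j; rewrite summxE !mxE rmorph_sum -sumrMnl.
    apply: eq_bigr => k _; rewrite !mxE rmorphM fmorphV rmorph_nat.
    by rewrite mulrnAr.
  rewrite mulmx_sumr mulmx_suml; apply: eq_bigr => k _.
  by rewrite Mk -scalemxAr -scalemxAl.
have sE i : (fun N => s N i) @ \oo --> expR (d i).
  have -> : (fun N => s N i) = series (exp_coeff (d i)).
    apply/funext => N; rewrite /series /= big_mkord; apply: eq_bigr => k _.
    by rewrite /exp_coeff /= mulrC.
  exact: is_cvg_series_exp_coeff.
have -> : expmx M = P *m D (fun i => expR (d i)) *m invmx P.
  pose K : numFieldType := R[i].
  rewrite /expmx; apply: (@cvg_lim 'M[K]_n); first exact: (@norm_hausdorff K 'M[K]_n).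
  have -> : (fun N => \sum_(k < N) (k`!%:R)^-1 *: M ^+ k) =
      (fun N => P *m D (s N) *m invmx P) by apply/funext => N; exact: SN.
  apply: cvg_mx_entries => i j.
  have E z : (P *m D z *m invmx P) i j = \sum_k P i k * (z k)%:C * invmx P k j.
    by rewrite mxE; apply: eq_bigr => k _; rewrite mul_mx_diag !mxE.
  under eq_fun do rewrite E; rewrite E.
  apply: (@cvg_sumr K) => k; apply: cvgM; last exact: cvg_cst.
  by apply: cvgM; [exact: cvg_cst | exact: cvg_real_complex].
rewrite mxtrace_mulC mulmxA mulVmx // mul1mx /mxtrace rmorph_sum.
by apply: eq_bigr => i _; rewrite !mxE eqxx mulr1n.
Qed.

End ExponentialTrace.

Section Characters.
Context {R : realType} {g : lieAlgebra R[i]} {h : {vspace g}}.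
Context {r : nat} {al : r.-tuple (dual h)}.
Hypothesis g_simple : simple_lie g.
Hypothesis h_cartan : cartan_subalgebra h.
Hypothesis al_simple : simple_roots al.
Variables (P : 'M[R[i]]_(\dim {:g})) (be : 'I_(\dim {:g}) -> dual h).
Hypothesis wb : weight_basis (V := adjoint_module) P be.
Local Notation comb := (comb al).

Lemma chi_weights (V : lieModule g) (c : seq 'rV[R]_r) (y : 'rV[R]_r) :
  has_weights V (map comb c) ->
  chi al V y = \sum_(v <- c) expR ((v *m Bmx al *m y^T) 0 0).
Proof.
move=> [Q [mu [wbV pc]]]; pose d i := complex.Re (mu i (sharp h (comb y))).
have muE i : mu i (sharp h (comb y)) = (d i)%:C /\
    exists v, mu i = comb v /\ d i = (v *m Bmx al *m y^T) 0 0.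
  have : mu i \in map comb c by rewrite (perm_mem pc) map_f ?mem_enum.
  case/mapP => v _ muv; rewrite /d muv -(formE g_simple h_cartan al_simple wb).
  rewrite (form_comb g_simple h_cartan al_simple wb); split=> //.
  by exists v.
rewrite /chi (trace_expmx (basis_unit wbV) (d := d)); last first.
  rewrite (weight_basisE wbV); congr (_ *m diag_mx _); apply/rowP => i.
  by rewrite !mxE (muE i).1.
rewrite /= ; pose F (nu : dual h) := expR (complex.Re (nu (sharp h (comb y)))).
rewrite -[LHS](big_enum _ _ _ (fun i => F (mu i))) -(big_map mu predT F).
rewrite -(perm_big _ pc) big_map; apply: eq_bigr => v _; rewrite /F.
by rewrite -(formE g_simple h_cartan al_simple wb) (form_comb g_simple h_cartan al_simple wb).
Qed.

End Characters.

(** * Gaussian integrals *)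

Section OneDimensionalIntegrals.
Context {R : realType}.
Local Notation leb := (@lebesgue_measure R).

(** Completing the square gives a multiple of the normal density with mean - b / a and variance 1 /
    a. The linear term is present because this is the inner integral of an iterated Gaussian
    integral. *)
Lemma gauss_integral_quadratic (a b c : R) : 0 < a ->
  (\int[leb]_x (expR (- (a * x ^+ 2 + 2%:R * b * x + c) / 2%:R))%:E =
   (Num.sqrt (2%:R * pi / a) * expR (- (c - b ^+ 2 / a) / 2%:R))%:E)%E.
Proof.
move=> a0; have a0' := lt0r_neq0 a0.
pose s := (Num.sqrt a)^-1; have sa0 : 0 < Num.sqrt a by rewrite sqrtr_gt0.
have s0 : s != 0 by rewrite invr_neq0 // lt0r_neq0.
have s2 : s ^+ 2 = a^-1 by rewrite exprVn sqr_sqrtr // ltW.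
pose m := - b / a; have N := integral_normal_pdf m s.
have pk : normal_peak s = (Num.sqrt (2%:R * pi / a))^-1.
  by rewrite /normal_peak s2 -mulr_natl; congr (Num.sqrt _)^-1; ring.
have K0 : 0 < Num.sqrt (2%:R * pi / a).
  by rewrite sqrtr_gt0 divr_gt0 // mulr_gt0 // pi_gt0.
pose k := Num.sqrt (2%:R * pi / a) * expR (- (c - b ^+ 2 / a) / 2%:R).
have E x : expR (- (a * x ^+ 2 + 2%:R * b * x + c) / 2%:R) = k * normal_pdf m s x.
  rewrite normal_pdfE // pk /k /normal_fun s2 /m.
  rewrite [RHS]mulrACA mulrV ?unitfE ?lt0r_neq0 // mul1r -expRD; congr expR.
  rewrite -mulr_natr; field.
  exact: a0'.
under eq_integral do rewrite E EFinM.
rewrite ge0_integralZl ?N ?mule1 //.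
- by apply/measurable_EFinP; exact: measurable_normal_pdf.
- by move=> x _; rewrite lee_fin normal_pdf_ge0.
by rewrite lee_fin mulr_ge0 ?expR_ge0 ?sqrtr_ge0.
Qed.

Lemma sin_int_pi (k : int) (t : R) :
  sin (k%:~R * pi + t) = sin (- (k%:~R * pi) + t).
Proof.
have per (n : nat) (u : R) : sin (n%:R * pi + u) = sin (- (n%:R * pi) + u).
  elim: n u => [|n IH] u; first by rewrite !mul0r oppr0.
  have -> : n.+1%:R * pi + u = n%:R * pi + (pi + u) by rewrite -natr1; ring.
  rewrite IH; have -> : - (n%:R * pi) + (pi + u) = (- (n.+1%:R * pi) + u) + pi *+ 2.
    by rewrite -natr1 -mulr_natl; ring.
  by rewrite sinD2pi.
case: k => n; first exact: per.
by rewrite NegzE mulrNz mulNr opprK; exact: esym (per n.+1 t).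
Qed.

(** The summand 1 keeps the integrand nonnegative, so that iterated integrals fall under Tonelli's
    theorem. *)
Lemma cube_integral_1d (k : int) (psi : R) :
  (\int[leb]_x ((1 + cos (k%:~R * x + psi)) * \1_(`[- pi, pi]%classic : set R) x)%:E =
   (2%:R * pi * (1 + (k == 0)%:R * cos psi))%:E)%E.
Proof.
have pp : - pi < pi :> R by rewrite gtrN // pi_gt0.
pose f x := 1 + cos (k%:~R * x + psi).
pose F x := if k == 0 then (1 + cos psi) * x else x + (k%:~R)^-1 * sin (k%:~R * x + psi).
have dF (x : R) : is_derive x (1 : R) F (f x).
  rewrite /F /f; case: eqP => [->|/eqP k0].
    have -> : 1 + cos (0%:~R * x + psi) = (1 + cos psi) *: 1.
      by rewrite mulr0z mul0r add0r /GRing.scale /= mulr1.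
    exact: is_deriveZ.
  have k0' : k%:~R != 0 :> R by rewrite intr_eq0.
  apply: is_derive_eq; rewrite /GRing.scale /=; field.
  exact: k0'.
transitivity (\int[leb]_(x in `[(- pi)%R, pi%R]) (f x)%:E)%E.
  by rewrite [RHS]integral_mkcond; apply: eq_integral => x _;
     rewrite /patch indicE /f; case: ifP => _; rewrite ?mulr1 ?mulr0.
have cF : continuous F.
  by move=> x; apply: differentiable_continuous; apply/derivable1_diffP; case: (dF x).
rewrite (@continuous_FTC2 _ f F) //.
- rewrite -EFinB; congr (_%:E); rewrite /F; case: eqP => [_|k0].
    by rewrite mul1r; ring.
  rewrite mul0r addr0 mulr1 mulrN -sin_int_pi; ring.
- apply: continuous_subspaceT => x; rewrite /f.
  apply: cvgD; first exact: cvg_cst.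
  apply: continuous_comp; last exact: continuous_cos.
  by apply: cvgD; [apply: cvgM; [exact: cvg_cst|exact: cvg_id] | exact: cvg_cst].
- split=> [x _||]; first by case: (dF x).
    exact: cvg_at_right_filter (cF _).
  exact: cvg_at_left_filter (cF _).
by move=> x _; rewrite derive1E; case: (dF x).
Qed.

End OneDimensionalIntegrals.

Definition dot {R : pzRingType} {r : nat} (v w : 'rV[R]_r) : R := (v *m w^T) 0 0.

Definition posdef {R : numDomainType} {r : nat} (Q : 'M[R]_r) :=
  Q^T = Q /\ forall x : 'rV[R]_r, x != 0 -> 0 < dot (x *m Q) x.

Section Dot.
Context {R : comPzRingType} {r : nat}.
Implicit Types v w : 'rV[R]_r.

Lemma dotE v w : dot v w = \sum_a v 0 a * w 0 a.
Proof. by rewrite /dot mxE; apply: eq_bigr => a _; rewrite mxE. Qed.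

Lemma dotC v w : dot v w = dot w v.
Proof. by rewrite !dotE; apply: eq_bigr => a _; rewrite mulrC. Qed.

Lemma dotDl v w x : dot (v + w) x = dot v x + dot w x.
Proof. by rewrite /dot mulmxDl mxE. Qed.

Lemma dotZl k v x : dot (k *: v) x = k * dot v x.
Proof. by rewrite /dot -scalemxAl mxE. Qed.

Lemma dotDr v w x : dot x (v + w) = dot x v + dot x w.
Proof. by rewrite !(dotC x) dotDl. Qed.

Lemma dotZr k v x : dot x (k *: v) = k * dot x v.
Proof. by rewrite !(dotC x) dotZl. Qed.

Lemma dot0l x : dot (0 : 'rV[R]_r) x = 0.
Proof. by rewrite /dot mul0mx mxE. Qed.

Lemma dot0r x : dot x (0 : 'rV[R]_r) = 0.
Proof. by rewrite dotC dot0l. Qed.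

Lemma dotMr (Q : 'M[R]_r) v w : dot v (w *m Q) = dot (v *m Q^T) w.
Proof. by rewrite /dot trmx_mul mulmxA. Qed.

Lemma dot_delta v a : dot v (delta_mx 0 a) = v 0 a.
Proof.
rewrite dotE (bigD1 a) //= mxE !eqxx mulr1 big1 ?addr0 // => b /negPf ba.
by rewrite mxE ba andbF mulr0.
Qed.

Lemma dot_suml I (s : seq I) (f : I -> 'rV[R]_r) v :
  dot (\sum_(i <- s) f i) v = \sum_(i <- s) dot (f i) v.
Proof. by rewrite /dot mulmx_suml summxE. Qed.

End Dot.

Lemma dotNl (R : comPzRingType) r (v w : 'rV[R]_r) : dot (- v) w = - dot v w.
Proof. by rewrite -scaleN1r dotZl mulN1r. Qed.

Lemma dotNr (R : comPzRingType) r (v w : 'rV[R]_r) : dot v (- w) = - dot v w.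
Proof. by rewrite dotC dotNl dotC. Qed.

Section SchurComplement.
Context {R : realType} {r : nat}.
Variable Q : 'M[R]_(1 + r).
Hypothesis Qpos : posdef Q.
Let A : 'M[R]_r := drsubmx Q.
Let b : 'cV[R]_r := dlsubmx Q.
Let a : R := (ulsubmx Q) 0 0.

(** The Schur complement of the first coordinate: the quadratic form that is left when the first
    variable is integrated out of the Gaussian. *)
Definition schur : 'M[R]_r := A - a^-1 *: (b *m b^T).

Lemma schur_blocks : Q = block_mx a%:M b^T b A.
Proof.
rewrite -[LHS]submxK; congr block_mx; first by rewrite [LHS]mx11_scalar.
by rewrite /b trmx_dlsub Qpos.1.
Qed.

Lemma schur_quad (v : 'rV[R]_r) (x : R) :
  dot ((row_mx x%:M v : 'rV_(1 + r)) *m Q) (row_mx x%:M v) =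
  a * x ^+ 2 + 2%:R * (v *m b) 0 0 * x + dot (v *m A) v.
Proof.
have bv : b^T *m v^T = (v *m b)^T by rewrite trmx_mul.
rewrite {1}schur_blocks /dot mul_row_block tr_row_mx mul_row_col mulmxDl mulmxDl.
rewrite tr_scalar_mx -[_ *m b^T *m v^T]mulmxA bv !mul_scalar_mx.
have E := mx11_scalar (v *m b).
rewrite {1 2}E tr_scalar_mx !mul_mx_scalar !scale_scalar_mx !mxE !eqxx !mulr1n; ring.
Qed.

Lemma schur_a_gt0 : 0 < a.
Proof.
have [_ /(_ (row_mx 1%:M 0))] := Qpos; rewrite schur_quad !mul0mx !mxE dot0l.
rewrite expr1n !mulr1 mulr0 !addr0; apply.
apply/eqP => /rowP /(_ (lshift r 0)); rewrite row_mxEl !mxE => /eqP.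
by rewrite oner_eq0.
Qed.

Lemma schur_quadE v : dot (v *m schur) v = dot (v *m A) v - ((v *m b) 0 0) ^+ 2 / a.
Proof.
have bv : b^T *m v^T = (v *m b)^T by rewrite trmx_mul.
rewrite /schur mulmxBr -scalemxAr dotDl dotNl dotZl; congr (_ - _).
rewrite mulrC; congr (_ / _); rewrite /dot mulmxA -[_ *m b^T *m _]mulmxA bv.
by rewrite [in LHS](mx11_scalar (v *m b)) tr_scalar_mx -scalar_mxM mxE eqxx mulr1n expr2.
Qed.

Lemma schur_posdef : posdef schur.
Proof.
have a0 := schur_a_gt0; split.
  rewrite /schur linearB linearZ /= trmx_mul trmxK; congr (_ - _).
  by rewrite /A trmx_drsub Qpos.1.
move=> v v0; rewrite schur_quadE.
(* The first coordinate is chosen where the quadratic polynomial in it has its minimum. *)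
have nz : row_mx (- (v *m b) 0 0 / a)%:M v != 0 :> 'rV_(1 + r).
  apply: contraNneq v0 => E; have := congr1 rsubmx E; rewrite row_mxKr => ->.
  by apply/eqP/rowP => i; rewrite !mxE.
have [_ /(_ _ nz)] := Qpos; rewrite schur_quad.
suff -> : a * (- (v *m b) 0 0 / a) ^+ 2
    + 2%:R * (v *m b) 0 0 * (- (v *m b) 0 0 / a) + dot (v *m A) v
  = dot (v *m A) v - (v *m b) 0 0 ^+ 2 / a by [].
by move: ((v *m b) 0 0) (dot _ _) a0 => p q a0; field; exact: lt0r_neq0.
Qed.

Lemma schur_det : \det Q = a * \det schur.
Proof.
have a0 := lt0r_neq0 schur_a_gt0.
pose L : 'M[R]_(1 + r) := block_mx 1%:M 0 (- a^-1 *: b) 1%:M.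
have LQ : L *m Q = block_mx a%:M b^T 0 schur.
  rewrite {1}schur_blocks mulmx_block !mul1mx !mul0mx !addr0.
  congr block_mx; last by rewrite /schur -scalemxAl scaleNr addrC.
  by rewrite mul_mx_scalar scalerA mulrN mulfV // scaleN1r addNr.
have := congr1 determinant LQ; rewrite det_mulmx det_ublock det_lblock !det1 !mul1r.
by rewrite det_scalar1.
Qed.

End SchurComplement.

Definition cube_indicator {R : realType} r (v : 'rV[R]_r) : R :=
  \prod_a \1_(`[- pi, pi]%classic : set R) (v 0 a).

Section ProductMeasure.
Context d1 d2 (T1 : measurableType d1) (T2 : measurableType d2) (R : realType).
Variable m1 : {sigma_finite_measure set T1 -> \bar R}.
Variable m2 : {sigma_finite_measure set T2 -> \bar R}.

(** A named copy of the product measure, to which a sigma-finite instance is attached so that the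
    product can be iterated. *)
Definition sigma_product : set (T1 * T2) -> \bar R := (m1 \x m2)%E.

HB.instance Definition _ := Measure.copy sigma_product (m1 \x m2)%E.

Lemma sigma_product_finite : sigma_finite setT sigma_product.
Proof.
have /sigma_finiteP[F [TF ndF Foo]] := sigma_finiteT m1.
have /sigma_finiteP[G [TG ndG Goo]] := sigma_finiteT m2.
exists (fun n => F n `*` G n).
  apply/seteqP; split=> // -[x y] _.
  have [i _ Fx] : (\bigcup_i F i) x by rewrite -TF.
  have [j _ Gy] : (\bigcup_i G i) y by rewrite -TG.
  exists (maxn i j) => //; split => /=.
    by have /subsetPset := ndF _ _ (leq_maxl i j); apply.
  by have /subsetPset := ndG _ _ (leq_maxr i j); apply.
move=> k; have [mF Fk] := Foo k; have [mG Gk] := Goo k.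
split; first exact: measurableX.
by rewrite /sigma_product /= product_measure1E // lte_mul_pinfty // ge0_fin_numE.
Qed.

HB.instance Definition _ :=
  Measure_isSigmaFinite.Build _ _ _ sigma_product sigma_product_finite.

Lemma sigma_product_integral (f : T1 * T2 -> \bar R) :
  measurable_fun setT f -> (forall z, (0 <= f z)%E) ->
  (\int[sigma_product]_z f z = \int[m1]_x \int[m2]_y f (x, y))%E.
Proof. by move=> mf f0; rewrite /sigma_product fubini_tonelli1. Qed.

End ProductMeasure.

Section EuclideanSpace.
Context {R : realType}.
Local Notation leb := (@lebesgue_measure R).

Lemma cube_indicator_ge0 r (v : 'rV[R]_r) : 0 <= cube_indicator v.
Proof. by apply: prodr_ge0 => a _; rewrite indicE. Qed.

Lemma cube_indicator_cases r (v : 'rV[R]_r) :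
  cube_indicator v = 1 /\ (forall a, `|v 0 a| <= pi) \/
  cube_indicator v = 0 /\ (exists a, pi < `|v 0 a|).
Proof.
have ind (x : R) : \1_(`[- pi, pi]%classic : set R) x = (`|x| <= pi)%R%:R.
  by rewrite indicE; congr (nat_of_bool _)%:R; rewrite ler_norml;
     apply/idP/idP; rewrite ?inE /= in_itv.
case: (boolP [forall a, `|v 0 a| <= pi]) => [/forallP D|].
  by left; split=> //; rewrite /cube_indicator big1 // => a _; rewrite ind D.
rewrite negb_forall => /existsP[a]; rewrite -ltNge => va; right; split; last by exists a.
by rewrite /cube_indicator (bigD1 a) //= ind leNgt va mul0r.
Qed.

Section Measurability.
Context d (T : measurableType d) (r : nat) (X : T -> 'rV[R]_r).
Hypothesis mX : forall a, measurable_fun setT (fun t => X t 0 a).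

Lemma measurable_gauss (Q : 'M[R]_r) :
  measurable_fun setT (fun t => (expR (- dot (X t *m Q) (X t) / 2%:R))%:E).
Proof.
apply/measurable_EFinP; apply: (measurableT_comp (@measurable_expR R)).
apply: measurable_funM; last exact: measurable_cst.
apply: (measurableT_comp (@oppr_measurable R _)).
under eq_fun do rewrite dotE; apply: measurable_sum => a.
apply: measurable_funM; last exact: mX.
under eq_fun do rewrite mxE; apply: measurable_sum => b.
by apply: measurable_funM; [exact: mX | exact: measurable_cst].
Qed.

Lemma measurable_cube : measurable_fun setT (fun t => cube_indicator (X t)).
Proof.
apply: measurable_prod => a _.
exact: (measurableT_comp (measurable_indic (measurable_itv _)) (mX a)).
Qed.

Lemma measurable_cube_wave (k : 'I_r -> R) (phi : R) :
  measurable_fun setT (fun t => ((1 + cos (\sum_a k a * X t 0 a + phi)) *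
    cube_indicator (X t))%:E).
Proof.
apply/measurable_EFinP; apply: measurable_funM; last exact: measurable_cube.
apply: measurable_funD; first exact: measurable_cst.
apply: (measurableT_comp (continuous_measurable_fun (@continuous_cos R))).
apply: measurable_funD; last exact: measurable_cst.
apply: measurable_sum => a; apply: measurable_funM; last exact: mX.
exact: measurable_cst.
Qed.

End Measurability.

Lemma cos_add1_ge0 (t : R) : 0 <= 1 + cos t.
Proof. by rewrite addrC -[1]opprK subr_ge0 cos_geN1. Qed.

(** Lebesgue measure on R^r as an iterated product, presented as an abstract measure space with a
    coordinate map X. Measurability of the coordinates and the two families of integrals are all
    that is used of it. *)
Lemma euclidean_space r : exists (d : measure_display) (T : measurableType d)
    (mu : {sigma_finite_measure set T -> \bar R}) (X : T -> 'rV[R]_r),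
  [/\ forall a, measurable_fun setT (fun t => X t 0 a),
      forall Q, posdef Q ->
        (\int[mu]_t (expR (- dot (X t *m Q) (X t) / 2%:R))%:E =
         (Num.sqrt ((2%:R * pi) ^+ r / \det Q))%:E)%E &
      forall (k : 'rV[int]_r) (phi : R),
        (\int[mu]_t ((1 + cos (\sum_a (k 0 a)%:~R * X t 0 a + phi)) *
           cube_indicator (X t))%:E =
         ((2%:R * pi) ^+ r * (1 + (k == 0)%:R * cos phi))%:E)%E].
Proof.
elim: r => [|r [d [T [mu [X [mX gX kX]]]]]].
  exists _, unit, (dirac tt), (fun _ => 0); split=> [[]//|Q _|k phi].
    rewrite integral_dirac // ?diracT ?mul1e.
    by rewrite dot0r oppr0 mul0r expR0 det_mx00 expr0 divr1 sqrtr1.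
  rewrite integral_dirac // ?diracT ?mul1e.
  rewrite big_ord0 add0r /cube_indicator big_ord0 expr0 mulr1 mul1r.
  by rewrite [k]thinmx0 eqxx mul1r.
pose X' (z : T * measurableTypeR R) : 'rV[R]_(1 + r) := row_mx (z.2)%:M (X z.1).
have mX' a : measurable_fun setT (fun z => X' z 0 a).
  case: (split_ordP a) => j ->.
    under eq_fun do rewrite row_mxEl ord1 mxE eqxx mulr1n.
    exact: measurable_snd.
  under eq_fun do rewrite row_mxEr.
  exact: (measurableT_comp (mX j) measurable_fst).
have gX' (Q : 'M[R]_(1 + r)) : posdef Q ->
  (\int[sigma_product mu leb]_t (expR (- dot (X' t *m Q) (X' t) / 2%:R))%:E =
    (Num.sqrt ((2%:R * pi) ^+ r.+1 / \det Q))%:E)%E.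
  move=> Qpos; rewrite (sigma_product_integral mu leb (measurable_gauss mX' Q)); last first.
    by move=> z; rewrite lee_fin expR_ge0.
  have a0 := schur_a_gt0 Qpos.
  set a := (ulsubmx (Q : 'M[R]_(1 + r))) 0 0 in a0.
  have Sp := schur_posdef Qpos.
  have inner t : (\int[leb]_y (expR (- dot (X' (t, y) *m Q) (X' (t, y)) / 2%:R))%:E =
      (Num.sqrt (2%:R * pi / a))%:E *
      (expR (- dot (X t *m schur Q) (X t) / 2%:R))%:E)%E.
    rewrite -EFinM schur_quadE -gauss_integral_quadratic //.
    congr integral; apply/funext => y.
    have q : dot (X' (t, y) *m Q) (X' (t, y)) =
        a * y ^+ 2 + 2%:R * (X t *m dlsubmx Q) 0 0 * y + dot (X t *m drsubmx Q) (X t).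
      by rewrite schur_quad.
    by rewrite q.
  under eq_integral do rewrite inner.
  rewrite ge0_integralZl ?lee_fin ?sqrtr_ge0 //; last exact: measurable_gauss.
  rewrite gX // -EFinM -sqrtrM; last by rewrite divr_ge0 // ?ltW // mulr_gt0 // pi_gt0.
  congr (Num.sqrt _)%:E; rewrite (schur_det Qpos) -/a exprS invfM; ring.
have kX' (k : 'rV[int]_(1 + r)) (phi : R) :
  (\int[sigma_product mu leb]_t ((1 + cos (\sum_a (k 0 a)%:~R * X' t 0 a + phi)) *
           cube_indicator (X' t))%:E =
         ((2%:R * pi) ^+ r.+1 * (1 + (k == 0)%:R * cos phi))%:E)%E.
  pose k0 := lsubmx k 0 0; pose k1 := rsubmx k.
  rewrite (sigma_product_integral mu leb (measurable_cube_wave mX' (fun a => (k 0 a)%:~R) phi)); last first.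
    by move=> z; rewrite lee_fin mulr_ge0 ?cos_add1_ge0 ?cube_indicator_ge0.
  pose psi t := \sum_a (k1 0 a)%:~R * X t 0 a + phi.
  have sumE t x : \sum_a (k 0 a)%:~R * X' (t, x) 0 a + phi = k0%:~R * x + psi t.
    rewrite (@big_split_ord _ _ _ 1 r) /= big_ord1 row_mxEl mxE eqxx mulr1n -addrA.
    rewrite /k0 /psi mxE; congr (_ * _ + (_ + _)).
    by apply: eq_bigr => a _; rewrite row_mxEr mxE.
  have cubeE t x : cube_indicator (X' (t, x)) =
      \1_(`[- pi, pi]%classic : set R) x * cube_indicator (X t).
    rewrite /cube_indicator (@big_split_ord _ _ _ 1 r) /= big_ord1 row_mxEl mxE eqxx mulr1n.
    by congr (_ * _); apply: eq_bigr => a _; rewrite row_mxEr.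
  have inner t : (\int[leb]_x ((1 + cos (\sum_a (k 0 a)%:~R * X' (t, x) 0 a + phi)) *
      cube_indicator (X' (t, x)))%:E =
      ((2%:R * pi)%:E * ((1 + (k0 == 0)%:R * cos (psi t)) * cube_indicator (X t))%:E))%E.
    under eq_integral do rewrite sumE cubeE mulrA EFinM.
    have mf : measurable_fun setT (fun x : measurableTypeR R =>
        ((1 + cos (k0%:~R * x + psi t)) * \1_(`[- pi, pi]%classic : set R) x)%:E).
      apply/measurable_EFinP; apply: measurable_funM; last exact: measurable_indic.
      apply: measurable_funD; first exact: measurable_cst.
      apply: (measurableT_comp (continuous_measurable_fun (@continuous_cos R))).
      by apply: measurable_funD => //; apply: measurable_funM.
    rewrite (ge0_integralZr _ measurableT mf) ?lee_fin ?cube_indicator_ge0 //; try by move=> x _; rewrite lee_fin mulr_ge0 ?cos_add1_ge0 // indicE.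
    etransitivity; first exact:
      (congr1 (fun z => (z * (cube_indicator (X t))%:E)%E) (cube_integral_1d k0 (psi t))).
    by rewrite /= -!EFinM mulrA.
  under eq_integral do rewrite inner.
  have kE : (k == 0) = (k0 == 0) && (k1 == 0).
    apply/eqP/andP => [k0'|[/eqP e0 /eqP e1]].
      by rewrite /k0 /k1 k0' !mxE eqxx; split=> //; apply/eqP/rowP => j; rewrite !mxE.
    rewrite -[k](@hsubmxK _ 1 1 r) -/k1 e1; apply/rowP => j.
    case: (split_ordP j) => i ->; rewrite ?row_mxEl ?row_mxEr !mxE // ord1.
    by move: e0; rewrite /k0 mxE.
  have E : (\int[mu]_t ((1 + (k0 == 0)%:R * cos (psi t)) * cube_indicator (X t))%:E =
      ((2%:R * pi) ^+ r * (1 + (k == 0)%:R * cos phi))%:E)%E.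
    rewrite kE; case: (k0 == 0) => /=.
      by under eq_integral do rewrite mul1r; rewrite /psi kX.
    (* The phase pi / 2 removes the cosine and leaves the volume of the cube. *)
    have := kX 0 (pi / 2%:R); rewrite cos_pihalf !mulr0 mul0r => <-.
    apply: eq_integral => t _; rewrite mul0r big1 ?add0r ?cos_pihalf // => a _.
    by rewrite mxE mul0r.
  have mf : measurable_fun setT (fun t => ((1 + (k0 == 0)%:R * cos (psi t)) *
      cube_indicator (X t))%:E).
    case: (k0 == 0) => /=.
      have := measurable_cube_wave mX (fun a => (k1 0 a)%:~R) phi.
      by under [in X in _ -> X]eq_fun do rewrite mul1r.
    under eq_fun do rewrite mul0r addr0 mul1r.
    by apply/measurable_EFinP; exact: measurable_cube.
  rewrite (ge0_integralZl _ measurableT mf) ?lee_fin ?mulr_ge0 ?pi_ge0 //; try by move=> t _; rewrite lee_fin mulr_ge0 ?cube_indicator_ge0 //;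
    case: (k0 == 0); rewrite ?mul0r ?addr0 // mul1r cos_add1_ge0.
  by rewrite E -EFinM mulrA -exprS.
by exists _, (T * measurableTypeR R)%type, (sigma_product mu leb), X'; split.
Qed.

End EuclideanSpace.

Section FourierGaussian.
Context {R : realType} {r : nat}.

Definition wave (k : 'rV[int]_r) (t : 'rV[R]_r) : R := cos (\sum_a (k 0 a)%:~R * t 0 a).

(* The constant term of a real Laurent polynomial, (2 pi)^-r times its integral over the cube, is
   compared with a Gaussian integral. *)
Lemma fourier_gaussian (s : seq (R * 'rV[int]_r)) (Q : 'M[R]_r) (G E c : R) :
  posdef Q -> 0 < c ->
  (forall t : 'rV[R]_r,
    `|cube_indicator t * (\sum_(p <- s) p.1 * wave p.2 t)
      - G * expR (- dot (t *m Q) t / 2%:R)| <= E * expR (- (c * dot t t) / 2%:R)) ->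
  `|(2%:R * pi) ^+ r * (\sum_(p <- s) p.1 * (p.2 == 0)%:R)
    - G * Num.sqrt ((2%:R * pi) ^+ r / \det Q)| <= E * Num.sqrt ((2%:R * pi) ^+ r / c ^+ r).
Proof.
move=> Qpos c0 bound; have [d [T [mu [X [mX gX kX]]]]] := @euclidean_space R r.
pose I (f : T -> R) v := mu.-integrable setT (EFin \o f) /\ Rintegral mu setT f = v.
have ID f g v w : I f v -> I g w -> I (fun t => f t + g t) (v + w).
  move=> [f1 f2] [g1 g2]; split; first by have := integrableD measurableT f1 g1.
  by rewrite RintegralD // f2 g2.
have IZ k f v : I f v -> I (fun t => k * f t) (k * v).
  move=> [f1 f2]; split; first by have := integrableZl measurableT k f1.
  by rewrite RintegralZl // f2.
have IB f g v w : I f v -> I g w -> I (fun t => f t - g t) (v - w).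
  move=> If /(IZ (-1)) Ig; have := ID _ _ _ _ If Ig.
  by rewrite mulN1r; under eq_fun do rewrite mulN1r.
have Ipos f v : measurable_fun setT (EFin \o f) -> (forall t, 0 <= f t) ->
    (\int[mu]_t (f t)%:E = v%:E)%E -> I f v.
  move=> mf f0 fv; split; last by rewrite /Rintegral fv.
  apply/integrableP; split=> //; under eq_integral do rewrite /= ger0_norm //.
  by rewrite fv ltry.
have Igauss P : posdef P -> I (fun t => expR (- dot (X t *m P) (X t) / 2%:R))
    (Num.sqrt ((2%:R * pi) ^+ r / \det P)).
  move=> Ppos; apply: Ipos; [exact: measurable_gauss | by move=> t; exact: expR_ge0|].
  exact: gX.
have Icube : I (fun t => cube_indicator (X t)) ((2%:R * pi) ^+ r).
  apply: Ipos; [|by move=> t; exact: cube_indicator_ge0|].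
    by apply/measurable_EFinP; exact: measurable_cube.
  have := kX 0 (pi / 2%:R); rewrite cos_pihalf !mulr0 addr0 mulr1 => <-.
  apply: eq_integral => t _; rewrite big1 ?add0r ?cos_pihalf ?addr0 ?mul1r // => a _.
  by rewrite mxE mul0r.
have Iwave k : I (fun t => cube_indicator (X t) * wave k (X t)) ((2%:R * pi) ^+ r * (k == 0)%:R).
  (* The wave is integrated as a difference of two nonnegative functions. *)
  have I1 : I (fun t => (1 + wave k (X t)) * cube_indicator (X t))
      ((2%:R * pi) ^+ r * (1 + (k == 0)%:R)).
    apply: Ipos; [|by move=> t; rewrite mulr_ge0 ?cube_indicator_ge0 ?cos_add1_ge0|].
      have := measurable_cube_wave mX (fun a => (k 0 a)%:~R) 0.
      by under [in X in X -> _]eq_fun do rewrite addr0.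
    by have := kX k 0; under eq_integral do rewrite addr0; rewrite cos0 mulr1.
  have := IB _ _ _ _ I1 Icube.
  have -> : (2%:R * pi) ^+ r * (1 + (k == 0)%:R) - (2%:R * pi) ^+ r
    = (2%:R * pi) ^+ r * (k == 0)%:R :> R by rewrite mulrDr mulr1 addrC addKr.
  by under [in X in X -> _]eq_fun do rewrite mulrDl mul1r addrC addKr mulrC.
have Ipoly : I (fun t => cube_indicator (X t) * (\sum_(p <- s) p.1 * wave p.2 (X t)))
    ((2%:R * pi) ^+ r * (\sum_(p <- s) p.1 * (p.2 == 0)%:R)).
  elim: s {bound} => [|p s IH].
    have := IZ 0 _ _ Icube; rewrite mul0r; rewrite big_nil mulr0.
    by under [in X in X -> _]eq_fun do rewrite mul0r;
       under [in X in _ -> X]eq_fun do rewrite big_nil mulr0.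
  have := ID _ _ _ _ (IZ p.1 _ _ (Iwave p.2)) IH.
  rewrite [in X in _ -> X]big_cons (mulrDr ((2%:R * pi) ^+ r)) [p.1 * (_ * _)]mulrCA.
  by under [in X in _ -> X]eq_fun do rewrite big_cons mulrDr [cube_indicator _ * (p.1 * _)]mulrCA.
have cpos : posdef (c%:M : 'M[R]_r).
  split=> [|x x0]; first exact: tr_scalar_mx.
  rewrite mul_mx_scalar dotZl mulr_gt0 // dotE.
  have [a xa] : exists a, x 0 a != 0.
    apply/existsP; apply: contraNT x0; rewrite negb_exists => /forallP H.
    by apply/eqP/rowP => a; rewrite mxE; apply/eqP; rewrite -[_ == _]negbK.
  rewrite (bigD1 a) //= ltr_wpDr //; last by rewrite -expr2 exprn_even_gt0.
  by apply: sumr_ge0 => b _; rewrite -expr2 sqr_ge0.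
have [D1 D2] := IB _ _ _ _ Ipoly (IZ G _ _ (Igauss _ Qpos)).
have [H1 H2] := IZ E _ _ (Igauss _ cpos).
rewrite -D2 -[X in _ <= _ * Num.sqrt (_ / X)](det_scalar r c) -H2.
apply: (le_trans (le_normr_Rintegral measurableT D1)).
apply: le_Rintegral => //.
  have := integrable_abse D1; rewrite /comp; by [].
move=> t _; apply: (le_trans (bound (X t))).
by rewrite mul_mx_scalar dotZl.
Qed.

End FourierGaussian.

(** * Characteristic functions *)

Section ElementaryBounds.
Context {R : realType}.
Implicit Types x t s T b : R.

(** The one-sided Taylor inequalities below are deduced in this way from inequalities of lower
    order. *)
Lemma ge0_of_derive (f f' : R -> R) b :
  (forall x, is_derive x 1 f (f' x)) -> f 0 = 0 ->
  (forall x, 0 <= x <= b -> 0 <= f' x) -> 0 <= b -> 0 <= f b.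
Proof.
move=> df f0 f'0 b0.
have cf : {within `[0, b], continuous f}.
  apply: continuous_subspaceT => x; apply: differentiable_continuous.
  by apply/derivable1_diffP; case: (df x).
have [c /itvP cI] := MVT_segment b0 (fun x _ => df x) cf.
by rewrite f0 !subr0 => ->; rewrite mulr_ge0 // f'0 // !cI.
Qed.

Lemma sin_le x : 0 <= x -> sin x <= x.
Proof.
move=> x0; rewrite -subr_ge0.
apply: (@ge0_of_derive (fun x => x - sin x) (fun x => 1 - cos x)) x0.
  by rewrite sin0 subr0.
by move=> y _; rewrite subr_ge0 cos_le1.
Qed.

Lemma cos_ge x : 1 - x ^+ 2 / 2%:R <= cos x.
Proof.
wlog x0 : x / 0 <= x.
  by move=> H; have [/H//|/ltW x0] := leP 0 x; have := H (- x); rewrite cosN sqrrN oppr_ge0 => ->.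
suff : 0 <= cos x - 1 + x ^+ 2 / 2%:R by lra.
apply: (@ge0_of_derive (fun x => cos x - 1 + x ^+ 2 / 2%:R) (fun x => x - sin x)) x0.
- by move=> y; apply: is_derive_eq; rewrite /GRing.scale /=; field.
- by rewrite cos0 expr0n /= mul0r addr0 subrr.
by move=> y /andP[y0 _]; rewrite subr_ge0 sin_le.
Qed.

Lemma sin_ge x : 0 <= x -> x - x ^+ 3 / 6%:R <= sin x.
Proof.
move=> x0; suff : 0 <= sin x - x + x ^+ 3 / 6%:R by lra.
apply: (@ge0_of_derive (fun x => sin x - x + x ^+ 3 / 6%:R)
  (fun x => cos x - 1 + x ^+ 2 / 2%:R)) x0.
- by move=> y; apply: is_derive_eq; rewrite /GRing.scale /=; field.
- by rewrite sin0 expr0n /= mul0r addr0 subrr.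
by move=> y _; have := cos_ge y; lra.
Qed.

Lemma cos_le x : cos x <= 1 - x ^+ 2 / 2%:R + x ^+ 4 / 24%:R.
Proof.
wlog x0 : x / 0 <= x.
  move=> H; have [/H//|/ltW x0] := leP 0 x; have := H (- x).
  have -> : (- x) ^+ 4 = x ^+ 4 by ring.
  by rewrite cosN sqrrN oppr_ge0; apply.
suff : 0 <= 1 - x ^+ 2 / 2%:R + x ^+ 4 / 24%:R - cos x by lra.
apply: (@ge0_of_derive (fun x => 1 - x ^+ 2 / 2%:R + x ^+ 4 / 24%:R - cos x)
  (fun x => sin x - x + x ^+ 3 / 6%:R)) x0.
- by move=> y; apply: is_derive_eq; rewrite /GRing.scale /=; field.
- by rewrite cos0 !expr0n /= !mul0r; ring.
by move=> y /andP[y0 _]; have := sin_ge y0; lra.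
Qed.

Lemma sin_le_quad x : 0 <= x -> x - x ^+ 2 / 2%:R <= sin x.
Proof.
move=> x0; suff : 0 <= sin x - x + x ^+ 2 / 2%:R by lra.
have cos1 (y : R) : 0 <= y -> 0 <= cos y - 1 + y.
  move=> y0; apply: (@ge0_of_derive (fun x => cos x - 1 + x) (fun x => 1 - sin x)) y0.
  - by move=> z; apply: is_derive_eq; rewrite /GRing.scale /=; ring.
  - by rewrite cos0; ring.
  by move=> z _; rewrite subr_ge0 sin_le1.
apply: (@ge0_of_derive (fun x => sin x - x + x ^+ 2 / 2%:R) (fun x => cos x - 1 + x)) x0.
- by move=> y; apply: is_derive_eq; rewrite /GRing.scale /=; field.
- by rewrite sin0 expr0n /= mul0r addr0 subrr.
by move=> y /andP[y0 _]; exact: cos1.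
Qed.

Lemma sin_le_quart x : 0 <= x -> sin x <= x - x ^+ 3 / 6%:R + x ^+ 4 / 24%:R.
Proof.
move=> x0; suff : 0 <= x - x ^+ 3 / 6%:R + x ^+ 4 / 24%:R - sin x by lra.
have c3 (y : R) : 0 <= y -> 0 <= 1 - y ^+ 2 / 2%:R + y ^+ 3 / 6%:R - cos y.
  move=> y0; apply: (@ge0_of_derive (fun y => 1 - y ^+ 2 / 2%:R + y ^+ 3 / 6%:R - cos y)
    (fun x => sin x - x + x ^+ 2 / 2%:R)) y0.
  - by move=> z; apply: is_derive_eq; rewrite /GRing.scale /=; field.
  - by rewrite cos0 !expr0n /= !mul0r; ring.
  by move=> z /andP[z0 _]; have := sin_le_quad z0; lra.
apply: (@ge0_of_derive (fun x => x - x ^+ 3 / 6%:R + x ^+ 4 / 24%:R - sin x)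
  (fun y => 1 - y ^+ 2 / 2%:R + y ^+ 3 / 6%:R - cos y)) x0.
- by move=> y; apply: is_derive_eq; rewrite /GRing.scale /=; field.
- by rewrite sin0 !expr0n /= !mul0r; ring.
by move=> y /andP[y0 _]; exact: c3.
Qed.

Lemma sin_taylor1 x : `|sin x| <= `|x|.
Proof.
wlog x0 : x / 0 <= x.
  by move=> H; have [/H//|/ltW x0] := leP 0 x; rewrite -normrN -(normrN x) -sinN H // oppr_ge0.
rewrite (ger0_norm x0) ler_norml sin_le // andbT.
have [x2|/ltW x2] := leP x 2%:R; last by have := sin_geN1 x; lra.
have := sin_le_quad x0; nra.
Qed.

Lemma sin_taylor2 x : `|sin x - x| <= x ^+ 2 / 2%:R.
Proof.
wlog x0 : x / 0 <= x.
  move=> H; have [/H//|/ltW x0] := leP 0 x; have := H (- x).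
  by rewrite oppr_ge0 sqrrN sinN -opprD normrN => ->.
rewrite ler_norml; have := sin_le_quad x0; have := sin_le x0.
by have := sqr_ge0 x; move=> *; apply/andP; split; lra.
Qed.

Lemma sin_taylor3 x : `|sin x - (x - x ^+ 3 / 6%:R)| <= x ^+ 4 / 24%:R.
Proof.
wlog x0 : x / 0 <= x.
  move=> H; have [/H//|/ltW x0] := leP 0 x; have := H (- x).
  have -> : (- x) ^+ 4 = x ^+ 4 by ring.
  rewrite oppr_ge0 sinN -normrN; have -> : - (- sin x - (- x - (- x) ^+ 3 / 6%:R))
    = sin x - (x - x ^+ 3 / 6%:R) by field.
  by apply.
rewrite ler_norml; have := sin_le_quart x0; have := sin_ge x0.
have : 0 <= x ^+ 4 by exact: exprn_ge0.
by move=> *; apply/andP; split; lra.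
Qed.

Lemma cos_taylor3 x : `|cos x - (1 - x ^+ 2 / 2%:R)| <= x ^+ 4 / 24%:R.
Proof.
rewrite ler_norml; have := cos_ge x; have := cos_le x.
have : 0 <= x ^+ 4 by rewrite exprn_even_ge0.
by move=> *; apply/andP; split; lra.
Qed.

Lemma cos_taylor1 x : `|cos x - 1| <= x ^+ 2 / 2%:R.
Proof.
rewrite ler_norml; have := cos_ge x; have := cos_le1 x; have := sqr_ge0 x.
by move=> *; apply/andP; split; lra.
Qed.

(** Up to pi / 2, which is at most 2, the Taylor polynomial of degree 4 suffices; beyond, cos t <= 0
    and t <= 4, whence the constant 16. *)
Lemma one_sub_cos_ge t : `|t| <= pi -> t ^+ 2 / 16%:R <= 1 - cos t.
Proof.
wlog t0 : t / 0 <= t.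
  move=> H; have [/H//|/ltW t0] := leP 0 t; have := H (- t).
  by rewrite cosN sqrrN normrN oppr_ge0; exact.
rewrite ger0_norm // => tpi; have [_ p2] := andP (@pihalf_02 R).
have [tp|/ltW tp] := leP t (pi / 2%:R).
  have t2 : t <= 2%:R by lra.
  have := cos_le t; have : t ^+ 2 <= 4%:R by nra.
  have -> : t ^+ 4 = t ^+ 2 * t ^+ 2 by ring.
  have := sqr_ge0 t; nra.
have : cos t <= 0.
  have -> : t = (t - pi / 2%:R) + pi / 2%:R by ring.
  rewrite cosDpihalf oppr_le0; apply: sin_ge0_pi; apply/andP; split; lra.
have t4 : t <= 4%:R by lra.
have : t ^+ 2 <= 16%:R by nra.
lra.
Qed.

Lemma expRN_taylor1 s : 0 <= s -> `|expR (- s) - (1 - s)| <= s ^+ 2 / 2%:R.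
Proof.
move=> s0; rewrite ler_norml; have := expR_ge1Dx (- s); have := sqr_ge0 s.
have : 0 <= 1 - s + s ^+ 2 / 2%:R - expR (- s).
  apply: (@ge0_of_derive (fun s => 1 - s + s ^+ 2 / 2%:R - expR (- s))
    (fun s => expR (- s) - 1 + s)) s0.
  - by move=> z; apply: is_derive_eq; rewrite /GRing.scale /=; field.
  - by rewrite oppr0 expR0 expr0n /= mul0r; ring.
  by move=> z _; have := expR_ge1Dx (- z); lra.
by move=> *; apply/andP; split; lra.
Qed.

Lemma expR_quad_lb T t : `|t| <= T -> 1 + t + expR (- T) / 2%:R * t ^+ 2 <= expR t.
Proof.
have eT : expR (- T) <= 1 -> forall u, expR (- T) / 2%:R * u ^+ 2 <= u ^+ 2 / 2%:R.
  by move=> e1 u; rewrite mulrAC ler_wpM2r // -[leRHS]mul1r ler_wpM2r // sqr_ge0.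
have [t0|/ltW t0] := leP 0 t; move=> tT.
  have T0 : 0 <= T by exact: le_trans (normr_ge0 _) tT.
  have := eT _ t; rewrite expR_le1 oppr_le0 => /(_ T0).
  have : 0 <= expR t - (1 + t + t ^+ 2 / 2%:R).
    apply: (@ge0_of_derive (fun t => expR t - (1 + t + t ^+ 2 / 2%:R))
      (fun t => expR t - (1 + t))) t0.
    - by move=> z; apply: is_derive_eq; rewrite /GRing.scale /=; field.
    - by rewrite expR0 expr0n /= mul0r; ring.
    by move=> z _; have := expR_ge1Dx z; lra.
  lra.
pose s := - t; have ts : t = - s by rewrite opprK.
have s0 : 0 <= s by rewrite oppr_ge0.
move: tT; rewrite ts normrN ger0_norm // => sT.
rewrite sqrrN -subr_ge0.
apply: (@ge0_of_derive (fun s => expR (- s) - (1 - s + expR (- T) / 2%:R * s ^+ 2))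
  (fun s => 1 - expR (- s) - expR (- T) * s)) s0.
- by move=> z; apply: is_derive_eq; rewrite /GRing.scale /=; field.
- by rewrite oppr0 expR0 expr0n /= mulr0; ring.
move=> z /andP[z0 zs]; have e1 := expR_ge1Dx z.
have e2 : expR (- T) <= expR (- z) by rewrite ler_expR; lra.
have e3 := expRxMexpNx_1 z; have e4 := expR_ge0 (- z).
have : 0 <= expR (- z) * (expR z - 1 - z) by rewrite mulr_ge0 //; lra.
have : 0 <= (expR (- z) - expR (- T)) * z by rewrite mulr_ge0 //; lra.
lra.
Qed.

Lemma expR_quad_ub T t : `|t| <= T -> expR t <= 1 + t + expR T / 2%:R * t ^+ 2.
Proof.
move=> tT; have T0 : 0 <= T by exact: le_trans (normr_ge0 _) tT.
have [t0|/ltW t0] := leP 0 t.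
  move: tT; rewrite ger0_norm // => tT.
  suff : 0 <= 1 + t + expR T / 2%:R * t ^+ 2 - expR t by lra.
  apply: (@ge0_of_derive (fun t => 1 + t + expR T / 2%:R * t ^+ 2 - expR t)
    (fun t => 1 + expR T * t - expR t)) t0.
  - by move=> z; apply: is_derive_eq; rewrite /GRing.scale /=; field.
  - by rewrite expR0 expr0n /= mulr0; ring.
  move=> z /andP[z0 zs]; have e1 := expR_ge1Dx (- z).
  have e2 : expR z <= expR T by rewrite ler_expR; lra.
  have e3 := expRxMexpNx_1 z; have e4 := expR_ge0 z.
  have : 0 <= expR z * (expR (- z) - (1 - z)) by rewrite mulr_ge0 //; lra.
  have : 0 <= (expR T - expR z) * z by rewrite mulr_ge0 //; lra.
  lra.
have := @expRN_taylor1 (- t); rewrite oppr_ge0 opprK sqrrN => /(_ t0).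
rewrite ler_norml => /andP[_ H].
have : 1 <= expR T by rewrite -expR0 ler_expR.
have := sqr_ge0 t; nra.
Qed.

End ElementaryBounds.

Section Cis.
Context {R : realType}.
Local Notation normc := Normc.normc.
Local Notation Re := complex.Re.
Local Notation Im := complex.Im.
Implicit Types (s t : R) (z w : R[i]).

Definition cis t : R[i] := (cos t +i* sin t)%C.

Lemma cis0 : cis 0 = 1.
Proof. by rewrite /cis cos0 sin0. Qed.

Lemma cisD s t : cis (s + t) = cis s * cis t.
Proof.
by rewrite /cis cosD sinD; apply/eqP; rewrite eq_complex /= eqxx /= addrC [sin s * _]mulrC.
Qed.

Lemma cis_sum I (s : seq I) (f : I -> R) : cis (\sum_(i <- s) f i) = \prod_(i <- s) cis (f i).
Proof. by rewrite (big_morph cis cisD cis0). Qed.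

Lemma cisMn n t : cis (n%:R * t) = cis t ^+ n.
Proof.
by elim: n => [|n IH]; rewrite ?mul0r ?cis0 ?expr0 // -natr1 mulrDl mul1r cisD IH exprSr.
Qed.

Lemma normc_cis t : normc (cis t) = 1.
Proof. by rewrite /= cos2Dsin2 sqrtr1. Qed.

Lemma normc_sqr z : normc z ^+ 2 = Re z ^+ 2 + Im z ^+ 2.
Proof. by case: z => a b /=; rewrite sqr_sqrtr // addr_ge0 ?sqr_ge0. Qed.

Lemma normc_ge0 z : 0 <= normc z.
Proof. by case: z => a b; exact: sqrtr_ge0. Qed.

Lemma normc_real (x : R) : normc x%:C = `|x|.
Proof. by rewrite /= expr0n /= addr0 sqrtr_sqr. Qed.

Lemma normc_add z w : normc (z + w) <= normc z + normc w.
Proof. exact: (@le_normcD R z w). Qed.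

Lemma normc_le z : normc z <= `|Re z| + `|Im z|.
Proof.
rewrite -(@ler_pXn2r _ 2) ?nnegrE ?normc_ge0 ?addr_ge0 // normc_sqr sqrrD !real_normK ?num_real //.
by rewrite lerD2r lerDl mulrn_wge0 // mulr_ge0.
Qed.

Lemma Re_le_normc z : `|Re z| <= normc z.
Proof.
rewrite -(@ler_pXn2r _ 2) ?nnegrE ?normc_ge0 // normc_sqr real_normK ?num_real //.
by rewrite lerDl sqr_ge0.
Qed.

Lemma normc_sum I (s : seq I) (f : I -> R[i]) :
  normc (\sum_(i <- s) f i) <= \sum_(i <- s) normc (f i).
Proof.
elim: s => [|i s IH]; first by rewrite !big_nil Normc.normc0.
by rewrite !big_cons; apply: (le_trans (normc_add _ _)); rewrite lerD2l.
Qed.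

Lemma normc_prod I (s : seq I) (f : I -> R[i]) :
  normc (\prod_(i <- s) f i) = \prod_(i <- s) normc (f i).
Proof. by rewrite (big_morph (@Normc.normc R) (@Normc.normcM R) (@Normc.normc1 R)). Qed.

Lemma normc_exp z n : normc (z ^+ n) = normc z ^+ n.
Proof.
by elim: n => [|n IH]; rewrite ?expr0 ?Normc.normc1 // !exprS Normc.normcM IH.
Qed.

(** The difference telescopes. The error of factor i is measured relative to the common bound m i,
    and relative errors add up. *)
Lemma normc_prod_sub I (s : seq I) (a b : I -> R[i]) (m d : I -> R) :
  (forall i, [/\ normc (a i) <= m i, normc (b i) <= m i, 0 <= d i &
                 normc (a i - b i) <= d i * m i]) ->
  normc (\prod_(i <- s) a i - \prod_(i <- s) b i) <=
  (\sum_(i <- s) d i) * \prod_(i <- s) m i.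
Proof.
move=> H; have m0 i : 0 <= m i by have [+ _ _ _] := H i; apply: le_trans; exact: normc_ge0.
have am : normc (\prod_(i <- s) a i) <= \prod_(i <- s) m i.
  rewrite normc_prod; elim: s => [|i s IH]; rewrite ?big_nil // !big_cons.
  by have [ai _ _ _] := H i; apply: ler_pM; rewrite ?normc_ge0 // prodr_ge0 // => *;
    exact: normc_ge0.
elim: s am => [|i s IH]; first by rewrite !big_nil subrr Normc.normc0 mul0r.
rewrite !big_cons => _; have [ai bi di abi] := H i.
have am : normc (\prod_(i <- s) a i) <= \prod_(i <- s) m i.
  rewrite normc_prod; elim: s {IH} => [|j s IH]; rewrite ?big_nil // !big_cons.
  by have [aj _ _ _] := H j; apply: ler_pM; rewrite ?normc_ge0 // prodr_ge0 // => *;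
    exact: normc_ge0.
set A := \prod_(i <- s) a i in IH am *; set B := \prod_(i <- s) b i in IH *.
set M := \prod_(i <- s) m i in IH am *.
have M0 : 0 <= M by apply: le_trans am; exact: normc_ge0.
have -> : a i * A - b i * B = (a i - b i) * A + b i * (A - B) by ring.
apply: (le_trans (normc_add _ _)); rewrite !Normc.normcM.
have -> : (d i + \sum_(j <- s) d j) * (m i * M) =
  d i * m i * M + m i * ((\sum_(j <- s) d j) * M) by ring.
apply: lerD; apply: ler_pM; rewrite ?normc_ge0 //; exact: IH.
Qed.

End Cis.

Section CharacteristicFunction.
Context {R : realType} {I : eqType}.
Local Notation normc := Normc.normc.
Local Notation Re := complex.Re.
Local Notation Im := complex.Im.
Variables (s : seq I) (p t : I -> R).
Hypothesis p_ge0 : forall i, i \in s -> 0 <= p i.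
Hypothesis p_sum : \sum_(i <- s) p i = 1.
Hypothesis t_mean : \sum_(i <- s) p i * t i = 0.

Definition charfun : R[i] := \sum_(i <- s) (p i)%:C * cis (t i).
Definition moment n : R := \sum_(i <- s) p i * t i ^+ n.

Lemma Re_charfun : Re charfun = \sum_(i <- s) p i * cos (t i).
Proof.
rewrite /charfun raddf_sum; apply: eq_bigr => i _.
by rewrite /= mul0r subr0.
Qed.

Lemma Im_charfun : Im charfun = \sum_(i <- s) p i * sin (t i).
Proof.
rewrite /charfun raddf_sum; apply: eq_bigr => i _.
by rewrite /= mul0r addr0.
Qed.

Lemma charfun_le1 : normc charfun <= 1.
Proof.
rewrite -p_sum; apply: (le_trans (normc_sum _ _)).
rewrite big_seq [leRHS]big_seq; apply: ler_sum => i si.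
by rewrite Normc.normcM normc_cis mulr1 normc_real ger0_norm // p_ge0.
Qed.

Lemma double_sum (f : I -> I -> R) (i j : I) : (forall i j, 0 <= f i j) -> i \in s -> j \in s ->
  p i * p j * f i j <= \sum_(i <- s) \sum_(j <- s) p i * p j * f i j.
Proof.
move=> f0 si sj.
have pf0 k l : k \in s -> l \in s -> 0 <= p k * p l * f k l.
  by move=> sk sl; rewrite !mulr_ge0 ?p_ge0.
have le1 (F : I -> R) k : (forall l, l \in s -> 0 <= F l) -> k \in s -> F k <= \sum_(l <- s) F l.
  move=> F0 sk; rewrite (perm_big _ (perm_to_rem sk)) big_cons lerDl big_seq.
  by apply: sumr_ge0 => l /mem_rem /F0.
apply: (le_trans (le1 (fun j => p i * p j * f i j) j _ sj)); first by move=> l; exact: pf0.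
apply: (le1 (fun i => \sum_(j <- s) p i * p j * f i j) i _ si) => k sk.
by rewrite big_seq; apply: sumr_ge0 => l; exact: pf0.
Qed.

(** The square of the modulus is the expectation of cos (t - t') for two independent copies. Its
    difference from 1 is a double sum of nonnegative terms, of which a single one is kept. *)
Lemma charfun_modulus i j : i \in s -> j \in s ->
  normc charfun ^+ 2 <= 1 - p i * p j * (1 - cos (t i - t j)).
Proof.
move=> si sj; suff -> : normc charfun ^+ 2 =
    1 - \sum_(i <- s) \sum_(j <- s) p i * p j * (1 - cos (t i - t j)).
  have f0 k l : 0 <= 1 - cos (t k - t l) by rewrite subr_ge0 cos_le1.
  by rewrite lerD2l lerN2; exact: (double_sum f0 si sj).
rewrite normc_sqr Re_charfun Im_charfun.
transitivity (\sum_(i <- s) \sum_(j <- s) p i * p j * cos (t i - t j)).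
  rewrite !expr2 !mulr_suml -big_split; apply: eq_bigr => k _ /=.
  rewrite !mulr_sumr -big_split; apply: eq_bigr => l _ /=.
  by rewrite cosB; ring.
have pp : \sum_(i <- s) \sum_(j <- s) p i * p j = 1.
  by under eq_bigr do rewrite -mulr_sumr p_sum mulr1; rewrite p_sum.
rewrite -[X in X - _]pp -sumrB; apply: eq_bigr => k _; rewrite -sumrB; apply: eq_bigr => l _; ring.
Qed.

Lemma variance_lb i j : i \in s -> j \in s -> p i * p j * (t i - t j) ^+ 2 <= 2%:R * moment 2.
Proof.
move=> si sj; suff -> : 2%:R * moment 2 =
    \sum_(i <- s) \sum_(j <- s) p i * p j * (t i - t j) ^+ 2.
  by apply: (@double_sum (fun i j => (t i - t j) ^+ 2)) => // k l; exact: sqr_ge0.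
have E k : \sum_(j <- s) p k * p j * (t k - t j) ^+ 2 = p k * t k ^+ 2 + p k * moment 2.
  transitivity (p k * t k ^+ 2 * (\sum_(j <- s) p j)
      - 2%:R * p k * t k * (\sum_(j <- s) p j * t j) + p k * moment 2); last first.
    by rewrite p_sum t_mean; ring.
  rewrite /moment !mulr_sumr -sumrB -big_split; apply: eq_bigr => l _ /=; ring.
under [RHS]eq_bigr do rewrite E.
rewrite big_split -mulr_suml p_sum /= -/(moment 2); ring.
Qed.

Lemma moment_bound n (y : R) : 0 <= y -> (forall i, i \in s -> `|t i| <= y) -> `|moment n| <= y ^+ n.
Proof.
move=> y0 ty; rewrite -[y ^+ n]mul1r -p_sum mulr_suml; apply: (le_trans (ler_norm_sum _ _ _)).
rewrite big_seq [leRHS]big_seq; apply: ler_sum => i si.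
rewrite normrM (ger0_norm (p_ge0 si)) ler_wpM2l ?p_ge0 // normrX lerXn2r ?nnegrE //.
exact: ty.
Qed.

(** The exponential of the contributions of the second and third cumulants; as the mean is 0, these
    cumulants are the moments. *)
Definition gaussian_factor : R[i] :=
  (expR (- (moment 2 / 2%:R)))%:C * cis (- (moment 3 / 6%:R)).

Lemma moment2_ge0 : 0 <= moment 2.
Proof. by rewrite /moment big_seq; apply: sumr_ge0 => i si; rewrite mulr_ge0 ?p_ge0 ?sqr_ge0. Qed.

Lemma normc_gaussian_factor : normc gaussian_factor = expR (- (moment 2 / 2%:R)).
Proof. by rewrite Normc.normcM normc_cis mulr1 normc_real ger0_norm // expR_ge0. Qed.

(** Real and imaginary parts are expanded separately, with an error of order y^4. Products of the
    cumulants bring in y^5 and y^6, which the bound B of y reduces to y^4. *)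
Lemma charfun_taylor (y B : R) : 0 <= y -> y <= B -> 1 <= B ->
  (forall i, i \in s -> `|t i| <= y) ->
  normc (charfun - gaussian_factor) <= B ^+ 2 * y ^+ 4.
Proof.
move=> y0 yB B1 ty.
pose S := moment 2 / 2%:R; pose P := - (moment 3 / 6%:R).
have S0 : 0 <= S by rewrite divr_ge0 ?moment2_ge0.
have m2 := moment_bound 2 y0 ty; have m3 := moment_bound 3 y0 ty; have m4 := moment_bound 4 y0 ty.
have S1 : S <= y ^+ 2 / 2%:R by rewrite ler_wpM2r //; exact: le_trans (ler_norm _) m2.
have P1 : `|P| <= y ^+ 3 / 6%:R.
  by rewrite /P normrN normrM [`|_^-1|]ger0_norm ?invr_ge0 // ler_wpM2r.
have sum4 (f g : R -> R) : (forall x, `|f x - g x| <= x ^+ 4 / 24%:R) ->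
    `|\sum_(i <- s) p i * f (t i) - \sum_(i <- s) p i * g (t i)| <= y ^+ 4 / 24%:R.
  move=> fg; rewrite -sumrB; apply: (le_trans (ler_norm_sum _ _ _)).
  apply: (@le_trans _ _ (moment 4 / 24%:R)); last first.
    by rewrite ler_wpM2r //; exact: le_trans (ler_norm _) m4.
  rewrite /moment mulr_suml big_seq [leRHS]big_seq; apply: ler_sum => i si.
  by rewrite -mulrBr normrM ger0_norm ?p_ge0 // -mulrA ler_wpM2l ?p_ge0.
have e0 := expR_ge0 (- S).
have e1 : expR (- S) <= 1 by rewrite expR_le1 oppr_le0.
have PS2 : `|P| ^+ 2 <= B ^+ 2 * y ^+ 4 / 36%:R.
  apply: (@le_trans _ _ ((y ^+ 3 / 6%:R) ^+ 2)); first by rewrite lerXn2r ?nnegrE ?divr_ge0 ?exprn_ge0.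
  have -> : (y ^+ 3 / 6%:R) ^+ 2 = y ^+ 2 * y ^+ 4 / 36%:R by field.
  by rewrite ler_wpM2r // ler_wpM2r ?exprn_ge0 // lerXn2r ?nnegrE // (le_trans y0).
have y4 : y ^+ 4 <= B ^+ 2 * y ^+ 4.
  by rewrite -[leLHS]mul1r ler_wpM2r ?exprn_ge0 // exprn_ege1.
have y5 : y ^+ 5 <= B ^+ 2 * y ^+ 4.
  rewrite exprS ler_wpM2r ?exprn_ge0 // (le_trans yB) // expr2 -[leLHS]mulr1 ler_wpM2l //.
  exact: le_trans B1.
have y40 : 0 <= y ^+ 4 by exact: exprn_ge0.
have re : `|Re (charfun - gaussian_factor)| <= B ^+ 2 * y ^+ 4 / 2%:R.
  have -> : Re (charfun - gaussian_factor) =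
      (\sum_(i <- s) p i * cos (t i) - \sum_(i <- s) p i * (1 - t i ^+ 2 / 2%:R))
      - (expR (- S) - (1 - S)) - expR (- S) * (cos P - 1).
    rewrite raddfB /= Re_charfun /gaussian_factor /= mul0r subr0 -/S -/P.
    have -> : \sum_(i <- s) p i * (1 - t i ^+ 2 / 2%:R) = 1 - S.
      rewrite /S /moment mulr_suml -[X in X - _]p_sum -sumrB; apply: eq_bigr => i _; ring.
    ring.
  have h1 := sum4 _ _ (@cos_taylor3 R).
  have h2 := expRN_taylor1 S0.
  have h3 : `|expR (- S) * (cos P - 1)| <= `|P| ^+ 2 / 2%:R.
    rewrite normrM (ger0_norm e0) -[leRHS]mul1r ler_pM // real_normK ?num_real //.
    exact: cos_taylor1.
  have S2 : S ^+ 2 <= y ^+ 4 / 4%:R.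
    have -> : y ^+ 4 / 4%:R = (y ^+ 2 / 2%:R) ^+ 2 by field.
    by apply: lerXn2r; rewrite ?nnegrE // divr_ge0 // exprn_ge0.
  apply: (le_trans (ler_normB _ _)); apply: (le_trans (lerD (ler_normB _ _) (lexx _))); lra.
have im : `|Im (charfun - gaussian_factor)| <= B ^+ 2 * y ^+ 4 / 2%:R.
  have -> : Im (charfun - gaussian_factor) =
      (\sum_(i <- s) p i * sin (t i) - \sum_(i <- s) p i * (t i - t i ^+ 3 / 6%:R))
      - expR (- S) * (sin P - P) - P * (expR (- S) - 1).
    rewrite raddfB /= Im_charfun /gaussian_factor /= mul0r addr0 -/S -/P.
    have -> : \sum_(i <- s) p i * (t i - t i ^+ 3 / 6%:R) = P.
      rewrite /P /moment mulr_suml -[RHS]add0r -[X in X - _]t_mean -sumrB; apply: eq_bigr => i _; ring.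
    ring.
  have h1 := sum4 _ _ (@sin_taylor3 R).
  have h2 : `|expR (- S) * (sin P - P)| <= `|P| ^+ 2 / 2%:R.
    rewrite normrM (ger0_norm e0) -[leRHS]mul1r ler_pM // real_normK ?num_real //.
    exact: sin_taylor2.
  have h3 : `|P * (expR (- S) - 1)| <= y ^+ 5 / 12%:R.
    rewrite normrM; have -> : y ^+ 5 / 12%:R = y ^+ 3 / 6%:R * (y ^+ 2 / 2%:R) by field.
    apply: ler_pM => //; rewrite ler0_norm ?subr_le0 //.
    by apply: le_trans S1; have := expR_ge1Dx (- S); lra.
  apply: (le_trans (ler_normB _ _)); apply: (le_trans (lerD (ler_normB _ _) (lexx _))); lra.
apply: (le_trans (normc_le _)); lra.
Qed.

End CharacteristicFunction.

(** * Gibbs measures on the weights *)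

Section GibbsMeasure.
Context {R : realType} {r : nat}.
Implicit Types (c : seq 'rV[R]_r) (u v w x d : 'rV[R]_r).

(** In this exponential family, [mean] and [cov] are the gradient and the Hessian of
    [ln (partition c u)] in u. *)
Definition partition c u : R := \sum_(v <- c) expR (dot v u).
Definition prob c u v : R := expR (dot v u) / partition c u.
Definition mean c u : 'rV[R]_r := \sum_(v <- c) prob c u v *: v.
Definition cov c u : 'M[R]_r :=
  \sum_(v <- c) prob c u v *: ((v - mean c u)^T *m (v - mean c u)).
Definition deviation c u x v : R := dot (v - mean c u) x.

(* The differences of the weights contain a basis of the root lattice: off 2 pi Z^r the
   characteristic function of the Gibbs measure is then less than 1 in modulus. *)
Definition spread c :=
  forall a, exists v w, [/\ v \in c, w \in c & v - w = delta_mx 0 a].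

Lemma dot_ge0 x : 0 <= dot x x.
Proof. by rewrite dotE; apply: sumr_ge0 => a _; rewrite -expr2 sqr_ge0. Qed.

Lemma sqr_coord_le x a : x 0 a ^+ 2 <= dot x x.
Proof.
rewrite dotE (bigD1 a) //= -expr2 lerDl; apply: sumr_ge0 => b _.
by rewrite -expr2 sqr_ge0.
Qed.

Lemma dot_eq0 x : (dot x x == 0) = (x == 0).
Proof.
apply/eqP/eqP => [x0|->]; last exact: dot0l.
apply/rowP => a; rewrite mxE; apply/eqP; rewrite -sqrf_eq0 eq_le sqr_ge0 andbT -x0.
exact: sqr_coord_le.
Qed.

Lemma sum_const_ord (E : R) : \sum_(a < r) E = r%:R * E.
Proof. by rewrite sumr_const card_ord mulr_natl. Qed.

Lemma sum_const_seq (I : Type) (s : seq I) (E : R) : \sum_(i <- s) E = (size s)%:R * E.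
Proof. by rewrite big_const_seq count_predT iter_addr addr0 mulr_natl. Qed.

Lemma dot_bound v x (V X : R) : (forall a, `|v 0 a| <= V) -> (forall a, `|x 0 a| <= X) ->
  `|dot v x| <= r%:R * V * X.
Proof.
move=> vV xX; rewrite dotE; apply: (le_trans (ler_norm_sum _ _ _)).
rewrite -mulrA -sum_const_ord; apply: ler_sum => a _.
by rewrite normrM ler_pM.
Qed.

Section OneFamily.
Variables (c : seq 'rV[R]_r) (u : 'rV[R]_r).
Hypothesis c_ne : c != [::].

Lemma partition_gt0 : 0 < partition c u.
Proof.
case: c c_ne => // v s _; rewrite /partition big_cons ltr_wpDr ?expR_gt0 //.
by apply: sumr_ge0 => *; exact: expR_ge0.
Qed.

Lemma prob_gt0 v : 0 < prob c u v.
Proof. by rewrite divr_gt0 ?expR_gt0 ?partition_gt0. Qed.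

Lemma prob_sum : \sum_(v <- c) prob c u v = 1.
Proof. by rewrite -mulr_suml mulfV // lt0r_neq0 // partition_gt0. Qed.

(** The numerator is at least e^(-L), and each of the [size c] terms of the partition function is at
    most e^L. *)
Lemma prob_lb v (L : R) : v \in c -> (forall w, w \in c -> `|dot w u| <= L) ->
  expR (- (2%:R * L)) / (size c)%:R <= prob c u v.
Proof.
move=> vc cL; have sc : 0 < (size c)%:R :> R by rewrite ltr0n lt0n size_eq0.
have Z : partition c u <= (size c)%:R * expR L.
  rewrite -sum_const_seq /partition big_seq [leRHS]big_seq; apply: ler_sum => w wc.
  by rewrite ler_expR (le_trans (ler_norm _)) // cL.
rewrite /prob ler_pdivrMr // mulrAC ler_pdivlMr ?partition_gt0 //.
apply: (@le_trans _ _ (expR (- (2%:R * L)) * ((size c)%:R * expR L))).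
  by rewrite ler_wpM2l ?expR_ge0.
rewrite mulrCA mulrC ler_pM2r // -expRD ler_expR.
have := cL _ vc; rewrite ler_norml => /andP[+ _]; lra.
Qed.

Lemma deviation_mean x : \sum_(v <- c) prob c u v * deviation c u x v = 0.
Proof.
under eq_bigr do rewrite -dotZl; rewrite -dot_suml.
under eq_bigr do rewrite scalerBr; rewrite sumrB -scaler_suml prob_sum scale1r subrr.
exact: dot0l.
Qed.

Lemma cov_quad x : dot (x *m cov c u) x = moment c (prob c u) (deviation c u x) 2.
Proof.
rewrite /cov mulmx_sumr dot_suml; apply: eq_bigr => v _.
rewrite -scalemxAr dotZl; congr (_ * _).
rewrite /dot mulmxA [x *m _]mx11_scalar mul_scalar_mx -scalemxAl [LHS]mxE.
by rewrite -/(dot _ _) -/(dot _ _) /deviation (dotC x) expr2.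
Qed.

Lemma cov_sym : (cov c u)^T = cov c u.
Proof.
rewrite /cov linear_sum; apply: eq_bigr => v _.
by rewrite linearZ /= trmx_mul trmxK.
Qed.

Lemma mean_bound (V : R) : (forall v, v \in c -> forall a, `|v 0 a| <= V) ->
  forall a, `|mean c u 0 a| <= V.
Proof.
move=> cV a; rewrite /mean summxE; apply: (le_trans (ler_norm_sum _ _ _)).
rewrite -[leRHS]mul1r -prob_sum mulr_suml big_seq [leRHS]big_seq; apply: ler_sum => v vc.
by rewrite mxE normrM gtr0_norm ?prob_gt0 // ler_wpM2l ?cV // ltW // prob_gt0.
Qed.

Lemma deviation_bound (V X : R) x : (forall v, v \in c -> forall a, `|v 0 a| <= V) ->
  (forall a, `|x 0 a| <= X) ->
  forall v, v \in c -> `|deviation c u x v| <= r%:R * (2%:R * V) * X.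
Proof.
move=> cV xX v vc; apply: dot_bound => // a; rewrite !mxE.
apply: (le_trans (ler_normB _ _)); have := cV _ vc a; have := mean_bound cV a; lra.
Qed.

Lemma spread_deviation a x : spread c -> exists v w,
  [/\ v \in c, w \in c & deviation c u x v - deviation c u x w = x 0 a].
Proof.
move=> /(_ a) [v [w [vc wc vw]]]; exists v, w; split=> //.
rewrite /deviation -dotNl -dotDl; have -> : v - mean c u - (w - mean c u) = v - w.
  by rewrite opprB addrA subrK.
by rewrite vw dotC dot_delta.
Qed.

Variable pl : R.
Hypotheses (pl_ge0 : 0 <= pl) (plP : forall v, v \in c -> pl <= prob c u v).

Lemma variance_spread x : spread c ->
  pl ^+ 2 * dot x x <= 2%:R * r%:R * dot (x *m cov c u) x.
Proof.
move=> sc; rewrite dotE mulr_sumr -mulrA mulrCA -sum_const_ord.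
apply: ler_sum => a _; rewrite cov_quad -expr2.
have [v [w [vc wc vw]]] := spread_deviation a x sc.
have := @variance_lb _ _ c (prob c u) (deviation c u x) _ prob_sum (deviation_mean x) v w vc wc.
rewrite vw => /(_ (fun i _ => ltW (prob_gt0 i))); apply: le_trans.
by rewrite ler_wpM2r ?sqr_ge0 // expr2 ler_pM // plP.
Qed.

(** For each coordinate a, a pair of weights that differ by the simple root bounds the square of the
    modulus by 1 - pl^2 x_a^2 / 16. Averaging over the r coordinates and taking the square root
    produce the constant 32 r. *)
Lemma charfun_spread x : (0 < r)%N -> spread c -> (forall a, `|x 0 a| <= pi) ->
  Normc.normc (charfun c (prob c u) (deviation c u x)) <=
  expR (- (pl ^+ 2 / (32%:R * r%:R) * dot x x)).
Proof.
move=> r0 sc xpi; set w := Normc.normc _.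
have rr : 0 < r%:R :> R by rewrite ltr0n.
have w2 : w ^+ 2 <= 1 - pl ^+ 2 / (16%:R * r%:R) * dot x x.
  rewrite -(ler_pM2l rr) mulrBr mulr1.
  have -> : r%:R * (pl ^+ 2 / (16%:R * r%:R) * dot x x) = pl ^+ 2 / 16%:R * dot x x.
    by field; rewrite lt0r_neq0.
  rewrite dotE mulr_sumr lerBrDr -sum_const_ord -big_split /= -[leRHS]mulr1 -sum_const_ord.
  apply: ler_sum => a _; have [v [y [vc yc vy]]] := spread_deviation a x sc.
  have := @charfun_modulus _ _ c (prob c u) (deviation c u x) (fun i _ => ltW (prob_gt0 i))
    prob_sum v y vc yc; rewrite vy -/w.
  have := one_sub_cos_ge (xpi a); rewrite -expr2 => h1.
  have : pl ^+ 2 <= prob c u v * prob c u y by rewrite expr2 ler_pM // plP.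
  have := sqr_ge0 pl; have := sqr_ge0 (x 0 a); move: (x 0 a ^+ 2) (pl ^+ 2) h1.
  move: (1 - cos _) (prob _ _ _ * _) => C P X L h1 X0 L0 LP.
  have : 0 <= (P - L) * C by rewrite mulr_ge0; lra.
  have : 0 <= L * (C - X / 16%:R) by rewrite mulr_ge0; lra.
  lra.
rewrite -(@ler_pXn2r _ 2) ?nnegrE ?normc_ge0 ?expR_ge0 // -expRM_natl.
apply: (le_trans w2); have := expR_ge1Dx (- (pl ^+ 2 / (16%:R * r%:R) * dot x x)).
have -> : 2%:R * - (pl ^+ 2 / (32%:R * r%:R) * dot x x) =
  - (pl ^+ 2 / (16%:R * r%:R) * dot x x) by field; rewrite lt0r_neq0.
by [].
Qed.

End OneFamily.

End GibbsMeasure.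

(** * Comparison of the integrand with a Gaussian *)

Section PointwiseBound.
Context {R : realType} {r m : nat}.
Local Notation normc := Normc.normc.
Local Notation Re := complex.Re.
Local Notation Im := complex.Im.
Variables (c : 'I_m -> seq 'rV[R]_r) (u : 'rV[R]_r) (N : 'I_m -> nat) (ks : 'I_m).
Variables (s : seq (R * 'rV[R]_r)) (V A pl : R).
Hypotheses (r_gt0 : (0 < r)%N) (c_ne : forall k, c k != [::]) (c_spread : spread (c ks)).
Hypotheses (cV : forall k v, v \in c k -> forall a, `|v 0 a| <= V).
Hypotheses (sV : forall p, p \in s -> forall a, `|p.2 0 a| <= V).
Hypotheses (V_ge0 : 0 <= V) (sA : \sum_(p <- s) `|p.1| <= A).
Hypotheses (pl_ge0 : 0 <= pl) (plP : forall v, v \in c ks -> pl <= prob (c ks) u v).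

Let w k x := charfun (c k) (prob (c k) u) (deviation (c k) u x).
Let z k x := gaussian_factor (c k) (prob (c k) u) (deviation (c k) u x).
Let mu k n x := moment (c k) (prob (c k) u) (deviation (c k) u x) n.

Definition prefactor (x : 'rV[R]_r) : R[i] := \sum_(p <- s) (p.1)%:C * cis (- dot p.2 x).
Definition prefactor0 : R := \sum_(p <- s) p.1.
Definition quad_form (x : 'rV[R]_r) : R :=
  (\sum_k (N k)%:R * dot (x *m cov (c k) u) x) / 2%:R.

(** The rate of decay in [charfun_spread], the bound for a deviation relative to the length of x,
    and the total number of tensor factors. *)
Let c0 : R := pl ^+ 2 / (32%:R * r%:R).
Let T : R := r%:R * (2%:R * V).
Let Nt : R := (\sum_k N k)%:R.
Let p0 k v : v \in c k -> 0 <= prob (c k) u v.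
Proof. by move=> _; exact: ltW (prob_gt0 u (c_ne k) v). Qed.
Let p1 k := prob_sum u (c_ne k).
Let t0 k x := deviation_mean u (c_ne k) x.

Lemma pl_le1 : pl <= 1.
Proof.
have [v [w' [vc _ _]]] := c_spread (Ordinal r_gt0).
apply: (le_trans (plP vc)); rewrite -(p1 ks) (perm_big _ (perm_to_rem vc)) big_cons /= lerDl.
by rewrite big_seq; apply: sumr_ge0 => y /mem_rem /p0.
Qed.

Lemma T_ge0 : 0 <= T.
Proof. by rewrite mulr_ge0 // mulr_ge0. Qed.

Lemma norm_coord_le (x : 'rV[R]_r) a : `|x 0 a| <= Num.sqrt (dot x x).
Proof. by rewrite -sqrtr_sqr ler_sqrt ?dot_ge0 // sqr_coord_le. Qed.

Lemma deviation_le k x v : v \in c k -> `|deviation (c k) u x v| <= T * Num.sqrt (dot x x).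
Proof.
by move=> vc; apply: deviation_bound vc => //; [exact: cV | move=> a; exact: norm_coord_le].
Qed.

Lemma variance_exponent x : c0 * dot x x <= dot (x *m cov (c ks) u) x / 2%:R.
Proof.
have rr : 0 < r%:R :> R by rewrite ltr0n.
have := variance_spread (c_ne ks) pl_ge0 plP x c_spread => H.
have L0 : 0 <= pl ^+ 2 * dot x x by rewrite mulr_ge0 ?sqr_ge0 ?dot_ge0.
rewrite /c0 mulrAC ler_pdivrMr ?mulr_gt0 //.
move: H L0; move: (pl ^+ 2 * _) (dot (_ *m _) _) => L Y; lra.
Qed.

Lemma quad_form_lb x : c0 * (N ks)%:R * dot x x <= quad_form x.
Proof.
rewrite /quad_form (bigD1 ks) //= mulrDl.
have := variance_exponent x => H.
have : 0 <= (N ks)%:R * (dot (x *m cov (c ks) u) x / 2%:R - c0 * dot x x).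
  by rewrite mulr_ge0 // subr_ge0.
have : 0 <= \sum_(k | k != ks) (N k)%:R * dot (x *m cov (c k) u) x.
  apply: sumr_ge0 => k _; rewrite mulr_ge0 // cov_quad //.
  exact: moment2_ge0 (@p0 k).
move: (\sum_(k | _) _) => E E0; move: (dot (x *m _) x) => Y; lra.
Qed.

Lemma gaussian_product x : \prod_k z k x ^+ N k =
  (expR (- quad_form x))%:C * cis (- (\sum_k (N k)%:R * mu k 3 x) / 6%:R).
Proof.
transitivity (\prod_k ((expR (- ((N k)%:R * mu k 2 x / 2%:R)))%:C *
    cis (- ((N k)%:R * mu k 3 x / 6%:R)))).
  apply: eq_bigr => k _; rewrite /z /gaussian_factor exprMn -rmorphXn -expRM_natl -cisMn /=.
  by rewrite -/(mu k 2 x) -/(mu k 3 x); congr ((expR _)%:C * cis _); ring.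
rewrite big_split /= -cis_sum -rmorph_prod -expR_sum sumrN sumrN.
congr ((expR (- _))%:C * cis _); last by rewrite mulNr mulr_suml.
rewrite /quad_form mulr_suml; apply: eq_bigr => k _.
by rewrite cov_quad.
Qed.

Lemma product_taylor (x : 'rV[R]_r) : (forall a, `|x 0 a| <= pi) ->
  normc (\prod_k w k x ^+ N k - \prod_k z k x ^+ N k) <=
  3%:R * (1 + 4%:R * r%:R * T) ^+ 2 * T ^+ 4 * (Nt * dot x x ^+ 2) *
    expR (- (c0 * (N ks)%:R * dot x x)).
Proof.
move=> xpi; set q := dot x x; pose X := Num.sqrt q; pose B := 1 + 4%:R * r%:R * T.
have q0 : 0 <= q := dot_ge0 x.
have rr : 1 <= r%:R :> R by rewrite ler1n.
have q16 : q <= 16%:R * r%:R.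
  rewrite /q dotE mulrC -sum_const_ord; apply: ler_sum => a _.
  have := xpi a; have /andP[_ p2] := @pihalf_02 R; rewrite ler_norml => /andP[h1 h2].
  have : 0 <= (4%:R - x 0 a) * (4%:R + x 0 a) by rewrite mulr_ge0; lra.
  lra.
have X0 : 0 <= X := sqrtr_ge0 q.
have Xq : X ^+ 2 = q by rewrite sqr_sqrtr.
have X4 : X <= 4%:R * r%:R.
  rewrite -(@ler_pXn2r _ 2) ?nnegrE ?mulr_ge0 // Xq (le_trans q16) //.
  rewrite exprMn; have -> : 4%:R ^+ 2 = 16%:R :> R by ring.
  by rewrite ler_wpM2l // expr2 -[leLHS]mul1r ler_wpM2r // (le_trans _ rr).
have TX : T * X <= B.
  have := ler_wpM2l T_ge0 X4; rewrite /B; lra.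
have TX0 : 0 <= T * X by rewrite mulr_ge0 // T_ge0.
have B1 : 1 <= B by rewrite lerDl !mulr_ge0 // T_ge0.
pose D : R := B ^+ 2 * (T ^+ 4 * q ^+ 2).
have D0 : 0 <= D.
  by apply: mulr_ge0; [exact: sqr_ge0 | apply: mulr_ge0; apply: exprn_ge0 => //; exact: T_ge0].
have zw k : normc (w k x - z k x) <= D.
  rewrite /w /z /D -Xq -exprM -exprMn.
  apply: (charfun_taylor (@p0 k) (p1 k) (t0 k x) TX0 TX B1) => v vc; exact: deviation_le.
(* A common bound for the factors w and z. Only the module ks is asked to provide decay. *)
pose M k : R := if k == ks then expR (- (c0 * q)) else 1.
(* On the cube q <= 16 r, so c0 q <= 1 / 2 and M k stays away from 0: the absolute error D of a
   factor is a relative error of at most 3 D. *)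
have M1 k : 1 <= 3%:R * M k.
  rewrite /M; case: eqP => _; last by rewrite mulr1 ler1n.
  have : c0 * q <= 2%:R^-1.
    rewrite /c0 mulrAC ler_pdivrMr ?mulr_gt0 ?(lt_le_trans ltr01 rr) //.
    have : pl ^+ 2 <= 1 by rewrite expr_le1 // pl_le1.
    have := ler_wpM2r q0; move=> /(_ (pl ^+ 2) 1) H /H; lra.
  have := expR_ge1Dx (- (c0 * q)); lra.
have M0 k : 0 <= M k by have := M1 k; lra.
have wM k : normc (w k x) <= M k.
  rewrite /M; case: eqP => [->|_]; last exact: charfun_le1 (@p0 k) (p1 k).
  exact: charfun_spread.
have zM k : normc (z k x) <= M k.
  rewrite /z normc_gaussian_factor /M; case: eqP => [->|_].
    by rewrite ler_expR lerN2 -cov_quad //; exact: variance_exponent.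
  rewrite expR_le1 oppr_le0 divr_ge0 //; exact: moment2_ge0 (@p0 k).
have power k : normc (w k x ^+ N k - z k x ^+ N k) <= (N k)%:R * (3%:R * D) * M k ^+ N k.
  have := @normc_prod_sub R 'I_(N k) (index_enum _) (fun=> w k x) (fun=> z k x) (fun=> M k)
    (fun=> 3%:R * D).
  rewrite !prodr_const card_ord sumr_const card_ord -[3%:R * D *+ _]mulr_natl; apply=> _; split=> //.
    by rewrite mulr_ge0.
  by apply: (le_trans (zw k)); rewrite mulrAC -[leLHS]mul1r ler_wpM2r.
have := @normc_prod_sub R 'I_m (index_enum _) (fun k => w k x ^+ N k) (fun k => z k x ^+ N k)
  (fun k => M k ^+ N k) (fun k => (N k)%:R * (3%:R * D)).
have -> : \prod_k M k ^+ N k = expR (- (c0 * (N ks)%:R * q)).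
  rewrite (bigD1 ks) //= big1 ?mulr1 => [|k /negPf kk]; last by rewrite /M kk expr1n.
  by rewrite /M eqxx -expRM_natl; congr expR; ring.
rewrite -mulr_suml -natr_sum -/Nt => H.
apply: (le_trans (H _)) => [k|].
  split=> //; last by apply: mulr_ge0 => //; apply: mulr_ge0.
    by rewrite normc_exp lerXn2r ?nnegrE ?normc_ge0.
  by rewrite normc_exp lerXn2r ?nnegrE ?normc_ge0.
rewrite [leLHS](_ : _ = 3%:R * (1 + 4%:R * r%:R * T) ^+ 2 * T ^+ 4 * (Nt * q ^+ 2) *
  expR (- (c0 * (N ks)%:R * q))) //.
by rewrite /D /B; ring.
Qed.

(** The real part is even in x and varies to second order only; the imaginary part is odd and of
    first order, but it will be multiplied by the sine of the cubic phase. *)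
Lemma prefactor_bounds x (Y := r%:R * V * Num.sqrt (dot x x)) :
  [/\ normc (prefactor x) <= A, `|Re (prefactor x) - prefactor0| <= A * (Y ^+ 2 / 2%:R),
      `|Im (prefactor x)| <= A * Y & `|prefactor0| <= A].
Proof.
have Y0 : 0 <= Y by rewrite !mulr_ge0 ?sqrtr_ge0.
have tY p : p \in s -> `|dot p.2 x| <= Y.
  by move=> ps; apply: dot_bound => [|a]; [exact: sV | exact: norm_coord_le].
have sumle (f : R * 'rV[R]_r -> R) (E : R) : 0 <= E -> (forall p, p \in s -> `|f p| <= E) ->
    `|\sum_(p <- s) p.1 * f p| <= A * E.
  move=> E0 fE; apply: (le_trans (ler_norm_sum _ _ _)).
  apply: (@le_trans _ _ ((\sum_(p <- s) `|p.1|) * E)); last by rewrite ler_wpM2r.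
  rewrite mulr_suml big_seq [leRHS]big_seq; apply: ler_sum => p ps.
  by rewrite normrM ler_wpM2l // fE.
have ReE : Re (prefactor x) = \sum_(p <- s) p.1 * cos (dot p.2 x).
  by rewrite /prefactor raddf_sum; apply: eq_bigr => p _; rewrite /= cosN mul0r subr0.
have ImE : Im (prefactor x) = \sum_(p <- s) p.1 * - sin (dot p.2 x).
  by rewrite /prefactor raddf_sum; apply: eq_bigr => p _; rewrite /= sinN mul0r addr0.
split.
- apply: le_trans sA; apply: (le_trans (normc_sum _ _)); apply: ler_sum => p _.
  by rewrite Normc.normcM normc_cis mulr1 normc_real.
- have -> : Re (prefactor x) - prefactor0 = \sum_(p <- s) p.1 * (cos (dot p.2 x) - 1).
    by rewrite ReE -sumrB; apply: eq_bigr => p _; ring.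
  apply: sumle => [|p ps]; first by rewrite divr_ge0 ?sqr_ge0.
  apply: (le_trans (cos_taylor1 _)); rewrite ler_wpM2r // -[leLHS]real_normK ?num_real //.
  by rewrite lerXn2r ?nnegrE // tY.
- rewrite ImE; apply: sumle => // p ps; rewrite normrN.
  exact: le_trans (sin_taylor1 _) (tY _ ps).
by apply: le_trans sA; exact: ler_norm_sum.
Qed.

(* The product of characteristic functions is compared, factor by factor, with the exponentials of
   their cumulants up to order three; the cubic phase only enters through the even part. *)
Lemma pointwise_bound x (q := dot x x) : (forall a, `|x 0 a| <= pi) ->
  `|Re (prefactor x * \prod_k w k x ^+ N k) - prefactor0 * expR (- quad_form x)| <=
  A * (3%:R * (1 + 4%:R * r%:R * T) ^+ 2 * T ^+ 4 + (r%:R * V) ^+ 2 + T ^+ 6 + r%:R * V * T ^+ 3) *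
    (q + Nt * q ^+ 2 + Nt ^+ 2 * q ^+ 3) * expR (- (c0 * (N ks)%:R * q)).
Proof.
move=> xpi; have q0 : 0 <= q := dot_ge0 x.
have A0 : 0 <= A by apply: le_trans sA; apply: sumr_ge0.
have [g1 g2 g3 g4] := prefactor_bounds x; rewrite -/q in g2 g3 *.
set X := Num.sqrt q in g2 g3 *; have X0 : 0 <= X := sqrtr_ge0 q.
have Xq : X ^+ 2 = q by rewrite sqr_sqrtr.
set G := prefactor x in g1 g2 g3 *; set G0 := prefactor0 in g2 g4 *.
pose Ph := - (\sum_k (N k)%:R * mu k 3 x) / 6%:R.
set E := expR (- (c0 * (N ks)%:R * q)); have E0 : 0 <= E := expR_ge0 _.
set S := quad_form x; have SE : expR (- S) <= E by rewrite ler_expR lerN2 quad_form_lb.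
have S0 : 0 <= expR (- S) := expR_ge0 _.
have Nt0 : 0 <= Nt by [].
have PhX : `|Ph| <= Nt * (T * X) ^+ 3 / 6%:R.
  rewrite /Ph normrM normrN [`|_^-1|]ger0_norm ?invr_ge0 // ler_wpM2r //.
  rewrite /Nt natr_sum mulr_suml; apply: (le_trans (ler_norm_sum _ _ _)); apply: ler_sum => k _.
  rewrite normrM [`|_%:R|]ger0_norm // ler_wpM2l //.
  apply: (@moment_bound _ _ _ _ _ (@p0 k) (p1 k) 3); first by rewrite mulr_ge0 // T_ge0.
  by move=> v vc; exact: deviation_le.
have h1 : normc (G * (\prod_k w k x ^+ N k - \prod_k z k x ^+ N k)) <=
    A * (3%:R * (1 + 4%:R * r%:R * T) ^+ 2 * T ^+ 4 * (Nt * q ^+ 2) * E).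
  by rewrite Normc.normcM; apply: ler_pM; rewrite ?normc_ge0 // product_taylor.
have h2 : `|Re (G * \prod_k z k x ^+ N k) - G0 * expR (- S)| <=
    E * (A * ((r%:R * V * X) ^+ 2 / 2%:R) + A * (`|Ph| ^+ 2 / 2%:R) + A * (r%:R * V * X) * `|Ph|).
  rewrite gaussian_product -/Ph -/S.
  (* Each term is small to second order: by the even part of the prefactor, by the square of the
     phase, or as a product of two odd quantities. *)
  have -> : Re (G * ((expR (- S))%:C * cis Ph)) - G0 * expR (- S) =
      expR (- S) * ((Re G - G0) * cos Ph + G0 * (cos Ph - 1) - Im G * sin Ph).
    by move: (expR _) => e; rewrite /cis; case: (G) => a b /=; ring.
  rewrite normrM (ger0_norm S0); apply: ler_pM => //.
  apply: (le_trans (ler_normB _ _)); apply: lerD.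
    apply: (le_trans (ler_normD _ _)); apply: lerD; rewrite normrM.
      by rewrite -[leRHS]mulr1; apply: ler_pM => //; exact: cos_max.
    by apply: ler_pM => //; rewrite real_normK ?num_real // cos_taylor1.
  by rewrite normrM; apply: ler_pM => //; exact: sin_taylor1.
have -> : Re (G * \prod_k w k x ^+ N k) - G0 * expR (- S) =
   Re (G * (\prod_k w k x ^+ N k - \prod_k z k x ^+ N k)) +
   (Re (G * \prod_k z k x ^+ N k) - G0 * expR (- S)) by rewrite mulrBr raddfB /=; ring.
apply: (le_trans (ler_normD _ _)).
apply: (le_trans (lerD (le_trans (Re_le_normc _) h1) h2)).
have Ph2 : `|Ph| ^+ 2 <= T ^+ 6 * (Nt ^+ 2 * q ^+ 3).
  apply: (@le_trans _ _ ((Nt * (T * X) ^+ 3 / 6%:R) ^+ 2)).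
    by rewrite lerXn2r ?nnegrE // divr_ge0 // !mulr_ge0 ?exprn_ge0 // mulr_ge0 // T_ge0.
  have -> : (Nt * (T * X) ^+ 3 / 6%:R) ^+ 2 = T ^+ 6 * (Nt ^+ 2 * (X ^+ 2) ^+ 3) / 36%:R by field.
  rewrite Xq ler_pdivrMr // ler_peMr ?ler1n // !mulr_ge0 ?exprn_ge0 ?T_ge0 //.
have XPh : X * `|Ph| <= T ^+ 3 * (Nt * q ^+ 2).
  apply: (le_trans (ler_wpM2l X0 PhX)).
  have -> : X * (Nt * (T * X) ^+ 3 / 6%:R) = T ^+ 3 * (Nt * (X ^+ 2) ^+ 2) / 6%:R by field.
  rewrite Xq ler_pdivrMr // ler_peMr ?ler1n // !mulr_ge0 ?exprn_ge0 ?T_ge0 //.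
have -> : (r%:R * V * X) ^+ 2 = (r%:R * V) ^+ 2 * q by rewrite exprMn Xq.
have Q1 : 0 <= Nt * q ^+ 2 by rewrite mulr_ge0 ?exprn_ge0.
have Q2 : 0 <= Nt ^+ 2 * q ^+ 3 by rewrite mulr_ge0 ?exprn_ge0.
have T0 := T_ge0; have T4 := exprn_ge0 4 T0; have T6 := exprn_ge0 6 T0; have T3 := exprn_ge0 3 T0.
have rV0 : 0 <= r%:R * V by rewrite mulr_ge0.
have B2 := sqr_ge0 (1 + 4%:R * r%:R * T).
have AE : 0 <= A * E by rewrite mulr_ge0.
set c1 := 3%:R * _ * _; have c10 : 0 <= c1 by apply: mulr_ge0 => //; apply: mulr_ge0.
have rV2 := sqr_ge0 (r%:R * V).
have : r%:R * V * (X * `|Ph|) <= r%:R * V * (T ^+ 3 * (Nt * q ^+ 2)) by rewrite ler_wpM2l.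
have {}rV3 : 0 <= r%:R * V * T ^+ 3 by rewrite mulr_ge0.
move: XPh => _; move: Ph2 => Ph2 XPh.
have main : c1 * (Nt * q ^+ 2) + ((r%:R * V) ^+ 2 * q / 2%:R + `|Ph| ^+ 2 / 2%:R +
      r%:R * V * (X * `|Ph|)) <=
   (c1 + (r%:R * V) ^+ 2 + T ^+ 6 + r%:R * V * T ^+ 3) *
     (q + Nt * q ^+ 2 + Nt ^+ 2 * q ^+ 3).
  move: XPh Ph2 Q1 Q2 c10 rV2 T6 rV3.
  rewrite [r%:R * V * (T ^+ 3 * _)]mulrA.
  move: (r%:R * V * T ^+ 3) (r%:R * V * (X * _)) ((r%:R * V) ^+ 2) (`|Ph| ^+ 2) (T ^+ 6).
  move: (Nt * q ^+ 2) (Nt ^+ 2 * q ^+ 3) c1 => q2 q3 c1' a1 a2 a3 a4 a5 b1 b2 b3 b4 b5 b6 b7 b8.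
  have := mulr_ge0 b5 q0; have := mulr_ge0 b5 b4; have := mulr_ge0 b6 q0.
  have := mulr_ge0 b6 b3; have := mulr_ge0 b6 b4; have := mulr_ge0 b7 q0.
  have := mulr_ge0 b7 b3; have := mulr_ge0 b8 q0; have := mulr_ge0 b8 b4.
  have := mulr_ge0 b7 b4; lra.
have := ler_wpM2l AE main; move: (`|Ph|) => ph; lra.
Qed.

End PointwiseBound.

(** * Coefficients of Laurent polynomials *)

Lemma sum_tensor_exponents (R : realType) (r m : nat) (S : comPzSemiRingType)
    (E : 'rV[R]_r -> S) (c : 'I_m -> seq 'rV[R]_r) (N : 'I_m -> nat) :
  (forall a b, E (a + b) = E a * E b) -> E 0 = 1 ->
  \sum_(v <- tensor_exponents c N) E v = \prod_k (\sum_(v <- c k) E v) ^+ N k.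
Proof.
move=> ED E0; rewrite -[RHS]big_enum /tensor_exponents /=; elim: (enum _) => [|k l IH] /=.
  by rewrite big_seq1 E0 big_nil.
rewrite big_cons -IH map_cat foldr_cat map_nseq.
elim: (N k) => [|n IHn]; first by rewrite expr0 mul1r.
rewrite /= big_allpairs_dep exprS -mulrA -IHn mulr_suml; apply: eq_bigr => a _.
by rewrite mulr_sumr; apply: eq_bigr => b _.
Qed.

(** * Coefficients as saddle point integrals *)

Section CoefficientEstimate.
Context {R : realType} {r m : nat}.
Local Notation Re := complex.Re.
Implicit Types (c : 'I_m -> seq 'rV[R]_r) (u lam x : 'rV[R]_r) (N : 'I_m -> nat).
Implicit Types (s : seq (R * 'rV[R]_r)).

Definition tensor_cov c u N : 'M[R]_r := \sum_k (N k)%:R *: cov (c k) u.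
Definition tensor_partition c u N : R := \prod_k partition (c k) u ^+ N k.
(* Moving the torus of integration to the saddle point u multiplies the coefficients of a
   Laurent polynomial by exponentials. *)
Definition twist s u : seq (R * 'rV[R]_r) := [seq (p.1 * expR (- dot p.2 u), p.2) | p <- s].
Definition coefficient c N s lam : R :=
  \sum_(v <- tensor_exponents c N) \sum_(p <- s) p.1 * (v == lam + p.2)%:R.

Lemma quad_formE c u N x : (forall k, c k != [::]) ->
  quad_form c u N x = dot (x *m tensor_cov c u N) x / 2%:R.
Proof.
move=> c_ne; rewrite /quad_form /tensor_cov mulmx_sumr dot_suml; congr (_ / _).
by apply: eq_bigr => k _; rewrite -scalemxAr dotZl.
Qed.

Lemma charfun_product c u N lam x : (forall k, c k != [::]) ->
  \sum_k (N k)%:R *: mean (c k) u = lam ->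
  \prod_k charfun (c k) (prob (c k) u) (deviation (c k) u x) ^+ N k =
  (tensor_partition c u N)^-1%:C *
    \sum_(v <- tensor_exponents c N) (expR (dot v u))%:C * cis (dot (v - lam) x).
Proof.
move=> c_ne lamE; pose E v : R[i] := (expR (dot v u))%:C * cis (dot v x).
transitivity ((tensor_partition c u N)^-1%:C * cis (- dot lam x) *
    \sum_(v <- tensor_exponents c N) E v); last first.
  rewrite -mulrA; congr (_ * _); rewrite mulr_sumr; apply: eq_bigr => v _.
  by rewrite mulrCA -cisD dotDl dotNl addrC.
rewrite (@sum_tensor_exponents _ _ _ _ E); first last.
- by rewrite /E !dot0l expR0 cis0 mulr1.
- by move=> a b; rewrite /E !dotDl expRD cisD rmorphM /=; ring.
rewrite -lamE dot_suml -sumrN cis_sum /tensor_partition -prodfV rmorph_prod -!big_split /=.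
apply: eq_bigr => k _; rewrite dotZl -mulrN cisMn -exprVn rmorphXn -!exprMn /=; congr (_ ^+ _).
rewrite /charfun mulr_sumr; apply: eq_bigr => v _; rewrite /prob /E /deviation dotDl dotNl cisD.
rewrite rmorphM /=; ring.
Qed.

Lemma laurent_expansion c u N s lam x : (forall k, c k != [::]) ->
  \sum_k (N k)%:R *: mean (c k) u = lam ->
  Re (prefactor (twist s u) x *
      \prod_k charfun (c k) (prob (c k) u) (deviation (c k) u x) ^+ N k) =
  \sum_(v <- tensor_exponents c N) \sum_(p <- s)
    (tensor_partition c u N)^-1 * expR (dot (v - p.2) u) * p.1 * cos (dot (v - lam - p.2) x).
Proof.
move=> c_ne lamE; rewrite (charfun_product _ c_ne lamE) /prefactor big_map mulrCA mulr_sumr.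
rewrite mulr_sumr raddf_sum; apply: eq_bigr => v _.
rewrite mulr_suml mulr_sumr raddf_sum; apply: eq_bigr => p _ /=.
have -> : cos (dot (v - lam - p.2) x) =
    cos (dot (v - lam) x) * cos (dot p.2 x) + sin (dot (v - lam) x) * sin (dot p.2 x).
  by rewrite dotDl dotNl cosB.
rewrite cosN sinN (dotDl v (- p.2) u) (dotNl p.2 u) expRD.
move: (cos (dot p.2 x)) (sin (dot p.2 x)) (cos (dot _ x)) (sin (dot _ x)) => a1 a2 a3 a4.
ring.
Qed.

(** Each power of t is bounded through one term of the exponential series of a t. A part of the
    Gaussian decay thus pays for the polynomial factor of the error. *)
Lemma cubic_le_exp (a mu t : R) : 0 < a -> 0 <= mu -> 0 <= t ->
  t + mu * t ^+ 2 + mu ^+ 2 * t ^+ 3 <=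
  (a^-1 + 2%:R * mu / a ^+ 2 + 6%:R * mu ^+ 2 / a ^+ 3) * expR (a * t).
Proof.
move=> a0 mu0 t0; have at0 : 0 <= a * t by rewrite mulr_ge0 // ltW.
have E n : t ^+ n.+1 <= n.+1`!%:R / a ^+ n.+1 * expR (a * t).
  have := expR_ge1Dxn n at0; set f : R := _`!%:R => H.
  have f0 : 0 < f by rewrite ltr0n fact_gt0.
  have {}H : (a * t) ^+ n.+1 <= expR (a * t) * f.
    by rewrite -ler_pdivrMr //; apply: le_trans H; rewrite lerDr.
  by rewrite mulrAC ler_pdivlMr ?exprn_gt0 // -exprMn [t * a]mulrC [f * _]mulrC.
have := E 0%N; have := ler_wpM2l mu0 (E 1%N); have := ler_wpM2l (sqr_ge0 mu) (E 2%N).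
rewrite -[(3`!)%N]/6%N -[(2`!)%N]/2%N -[(1`!)%N]/1%N !expr1.
by move: (expR _) => e; lra.
Qed.

(** K and cc are chosen before the weights, the point u and epsilon: they depend only on V, A, pl,
    mu, nu (and r), bounds that will hold uniformly along the sequence. The last hypothesis makes
    the integrand a Laurent polynomial with integral exponents. *)
Lemma coefficient_estimate (V A pl mu nu : R) :
  (0 < r)%N -> 0 <= V -> 0 <= A -> 0 < pl -> 0 <= mu -> 0 < nu ->
  exists K cc : R, [/\ 0 <= K, 0 < cc & forall c u N ks s lam eps,
    (forall k, c k != [::]) -> spread (c ks) ->
    (forall k v, v \in c k -> forall a, `|v 0 a| <= V) ->
    (forall p, p \in s -> forall a, `|p.2 0 a| <= V) ->
    \sum_(p <- twist s u) `|p.1| <= A ->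
    (forall v, v \in c ks -> pl <= prob (c ks) u v) ->
    0 < eps -> (\sum_k N k)%:R * eps <= mu -> nu <= (N ks)%:R * eps ->
    \sum_k (N k)%:R *: mean (c k) u = lam ->
    (forall v p, v \in tensor_exponents c N -> p \in s ->
      exists k : 'rV[int]_r, v - lam - p.2 = map_mx intr k) ->
    posdef (tensor_cov c u N) /\
    `|(2%:R * pi) ^+ r * (coefficient c N s lam * (expR (dot lam u) / tensor_partition c u N))
      - (\sum_(p <- s) p.1 * expR (- dot p.2 u))
        * Num.sqrt ((2%:R * pi) ^+ r / \det (tensor_cov c u N))|
    <= K * eps * Num.sqrt ((2%:R * pi) ^+ r / (cc / eps) ^+ r)].
Proof.
move=> r0 V0 A0 pl0 mu0 nu0; have rr : 0 < r%:R :> R by rewrite ltr0n.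
pose c0 := pl ^+ 2 / (32%:R * r%:R).
have c00 : 0 < c0 by rewrite divr_gt0 ?exprn_gt0 // mulr_gt0.
(* With t = dot x x / eps the decay is e^(- 2 a t): one half absorbs the polynomial factor, the
   other is the Gaussian majorant. *)
pose a := c0 * nu / 2%:R; have a0 : 0 < a by rewrite divr_gt0 // mulr_gt0.
pose T := r%:R * (2%:R * V); have T0 : 0 <= T by rewrite mulr_ge0 ?mulr_ge0 // ltW.
pose C := A * (3%:R * (1 + 4%:R * r%:R * T) ^+ 2 * T ^+ 4 + (r%:R * V) ^+ 2 + T ^+ 6
  + r%:R * V * T ^+ 3).
have C0 : 0 <= C.
  have rV0 : 0 <= r%:R * V by rewrite mulr_ge0 // ltW.
  rewrite /C mulr_ge0 // !addr_ge0 ?sqr_ge0 ?exprn_ge0 //.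
    by apply: mulr_ge0; [apply: mulr_ge0 => //; exact: sqr_ge0 | exact: exprn_ge0].
  by apply: mulr_ge0 => //; exact: exprn_ge0.
pose K1 := a^-1 + 2%:R * mu / a ^+ 2 + 6%:R * mu ^+ 2 / a ^+ 3.
have K10 : 0 <= K1.
  by rewrite !addr_ge0 ?invr_ge0 ?(ltW a0) // divr_ge0 ?exprn_ge0 ?(ltW a0) // mulr_ge0 // exprn_ge0.
(* C K1 accounts for the error inside the cube, and A / a for the part of the Gaussian outside. *)
exists (C * K1 + A / a), (c0 * nu); split; [|by rewrite mulr_gt0|].
  by apply: addr_ge0; [exact: mulr_ge0 | apply: divr_ge0 => //; exact: ltW].
move=> c u N ks s lam eps c_ne sp cV sV sA plP eps0 Nmu Nnu lamE sint.
have sV' p : p \in twist s u -> forall a, `|p.2 0 a| <= V.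
  by move=> /mapP[q qs ->] b; exact: (sV q qs b).
have lb x : c0 * nu / eps * dot x x <= quad_form c u N x.
  have H := quad_form_lb N r0 c_ne sp (ltW pl0) plP x.
  apply: le_trans H; rewrite -/c0 ler_wpM2r ?dot_ge0 // -mulrA ler_wpM2l ?(ltW c00) //.
  by rewrite ler_pdivrMr.
have Qpos : posdef (tensor_cov c u N).
  split=> [|x x0].
    by rewrite /tensor_cov linear_sum; apply: eq_bigr => k _; rewrite linearZ /= cov_sym.
  have x1 : 0 < dot x x by rewrite lt0r dot_eq0 x0 dot_ge0.
  have := lb x; rewrite quad_formE //.
  have : 0 < c0 * nu / eps * dot x x by rewrite mulr_gt0 // divr_gt0 // mulr_gt0.
  lra.
split=> //; set G0 := \sum_(p <- s) _.
have G0E : prefactor0 (twist s u) = G0 by rewrite /prefactor0 big_map.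
have G0A : `|G0| <= A by rewrite -G0E; apply: le_trans sA; exact: ler_norm_sum.
have [kf kfP] : exists kf : 'rV[R]_r * (R * 'rV[R]_r) -> 'rV[int]_r, forall vp,
    vp.1 \in tensor_exponents c N -> vp.2 \in s -> vp.1 - lam - vp.2.2 = map_mx intr (kf vp).
  have /choice[f fP] : forall vp : 'rV[R]_r * (R * 'rV[R]_r), exists k : 'rV[int]_r,
      vp.1 \in tensor_exponents c N -> vp.2 \in s -> vp.1 - lam - vp.2.2 = map_mx intr k.
    move=> vp; case: (boolP (vp.1 \in tensor_exponents c N)) => v1; last by exists 0.
    case: (boolP (vp.2 \in s)) => v2; last by exists 0.
    by have [k kE] := sint _ _ v1 v2; exists k.
  by exists f.
pose Z := (tensor_partition c u N)^-1.
pose P := [seq (Z * expR (dot (v - p.2) u) * p.1, kf (v, p)) | v <- tensor_exponents c N, p <- s].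
have PE x : \sum_(q <- P) q.1 * wave q.2 x = Re (prefactor (twist s u) x *
    \prod_k charfun (c k) (prob (c k) u) (deviation (c k) u x) ^+ N k).
  rewrite (laurent_expansion _ _ c_ne lamE) big_allpairs_dep.
  rewrite big_seq [RHS]big_seq; apply: eq_bigr => v vE.
  rewrite big_seq [RHS]big_seq; apply: eq_bigr => p ps /=; congr (_ * _).
  rewrite (kfP (v, p) vE ps) /wave dotE; congr cos.
  by apply: eq_bigr => b _; rewrite mxE.
have P0 : \sum_(q <- P) q.1 * (q.2 == 0)%:R =
    coefficient c N s lam * (expR (dot lam u) / tensor_partition c u N).
  rewrite big_allpairs_dep /coefficient mulr_suml.
  rewrite big_seq [RHS]big_seq; apply: eq_bigr => v vE.
  rewrite mulr_suml big_seq [RHS]big_seq; apply: eq_bigr => p ps /=.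
  have -> : (kf (v, p) == 0) = (v == lam + p.2).
    have := kfP (v, p) vE ps => /= E; rewrite -[RHS]subr_eq0 opprD addrA E.
    apply/eqP/eqP => [->|/rowP k0]; first by apply/rowP => b; rewrite !mxE.
    by apply/rowP => b; have /eqP := k0 b; rewrite !mxE intr_eq0 => /eqP.
  case: eqP => [->|_]; last by rewrite !(mulr0, mul0r).
  by rewrite addrK !mulr1 /Z; ring.
rewrite -P0; apply: fourier_gaussian => // [|x]; first by rewrite divr_gt0 // mulr_gt0.
rewrite PE.
have -> : - dot (x *m tensor_cov c u N) x / 2%:R = - quad_form c u N x by rewrite quad_formE // mulNr.
set q := dot x x; have q0 : 0 <= q := dot_ge0 x.
pose t := q / eps; have t0 : 0 <= t by rewrite divr_ge0 // ltW.
have qt : q = eps * t by rewrite mulrC divfK // lt0r_neq0.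
have -> : - (c0 * nu / eps * q) / 2%:R = - (a * t).
  by rewrite /a /t; field; exact: lt0r_neq0.
have e2 : expR (- (c0 * (N ks)%:R * q)) <= expR (- (a * t)) * expR (- (a * t)).
  rewrite -expRD ler_expR -opprD lerN2 qt.
  have : 0 <= c0 * t * ((N ks)%:R * eps - nu) by rewrite mulr_ge0 ?subr_ge0 // mulr_ge0 // ltW.
  rewrite /a; lra.
have e3 := expRxMexpNx_1 (a * t); have e4 := expR_ge0 (- (a * t)).
have [[-> xD]|[-> [b xb]]] := cube_indicator_cases x; last first.
  rewrite mul0r sub0r normrN normrM [`|expR _|]ger0_norm ?expR_ge0 //.
  have h1 : expR (- quad_form c u N x) <= expR (- (a * t)) * expR (- (a * t)).
    apply: le_trans e2; rewrite ler_expR lerN2.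
    by have := quad_form_lb N r0 c_ne sp (ltW pl0) plP x; rewrite -/c0 -/q.
  (* Outside the cube q >= 1, so one of the two factors e^(- a t) is itself at most eps / a. *)
  have q1 : 1 <= q.
    apply: (le_trans _ (sqr_coord_le x b)); rewrite -[x 0 b ^+ 2]real_normK ?num_real //.
    rewrite -[leLHS](expr1n _ 2) lerXn2r ?nnegrE //.
    by have := @pi_ge2 R; lra.
  have h2 : 1 <= eps / a * expR (a * t).
    have := expR_ge1Dx (a * t) => h3.
    rewrite mulrAC ler_pdivlMr // mul1r.
    have : eps * (a * t) <= eps * expR (a * t) by rewrite ler_wpM2l ?(ltW eps0) //; lra.
    rewrite mulrCA -qt; have := ler_wpM2l (ltW a0) q1; lra.
  apply: (@le_trans _ _ (A * (expR (- (a * t)) * expR (- (a * t))))).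
    by apply: ler_pM => //; exact: expR_ge0.
  have h3 : expR (- (a * t)) <= eps / a.
    have := ler_wpM2r e4 h2; rewrite mul1r; congr (_ <= _).
    by rewrite -[LHS]mulrA e3 mulr1.
  apply: (@le_trans _ _ (A * (eps / a * expR (- (a * t))))).
    by rewrite ler_wpM2l // ler_wpM2r.
  have CK : 0 <= C * K1 := mulr_ge0 C0 K10.
  have : 0 <= C * K1 * eps * expR (- (a * t)).
    by apply: mulr_ge0 => //; apply: mulr_ge0 => //; exact: ltW.
  move: (expR _) => e; lra.
rewrite mul1r -G0E.
have H := pointwise_bound N r0 c_ne sp cV sV' V0 sA (ltW pl0) plP xD.
apply: (le_trans H); rewrite -/T -/c0 -/C -/q.
set Nt : R := (\sum_k N k)%:R; have Nt0 : 0 <= Nt by [].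
have b1 : q + Nt * q ^+ 2 + Nt ^+ 2 * q ^+ 3 <= eps * (t + mu * t ^+ 2 + mu ^+ 2 * t ^+ 3).
  have n1 : (Nt * eps) * t ^+ 2 <= mu * t ^+ 2 by rewrite ler_wpM2r ?exprn_ge0.
  have n2 : (Nt * eps) ^+ 2 * t ^+ 3 <= mu ^+ 2 * t ^+ 3.
    by rewrite ler_wpM2r ?exprn_ge0 // lerXn2r ?nnegrE // mulr_ge0 // ltW.
  rewrite qt; have := ler_wpM2l (ltW eps0) n1; have := ler_wpM2l (ltW eps0) n2; lra.
have b2 := cubic_le_exp a0 mu0 t0; rewrite -/K1 in b2.
have b3 : q + Nt * q ^+ 2 + Nt ^+ 2 * q ^+ 3 <= eps * (K1 * expR (a * t)).
  by apply: (le_trans b1); rewrite ler_wpM2l ?(ltW eps0).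
apply: (@le_trans _ _ (C * (eps * (K1 * expR (a * t))) * (expR (- (a * t)) * expR (- (a * t))))).
  apply: ler_pM => //; rewrite ?expR_ge0 //.
    by rewrite mulr_ge0 // !addr_ge0 // mulr_ge0 // exprn_ge0.
  by rewrite ler_wpM2l.
have -> : C * (eps * (K1 * expR (a * t))) * (expR (- (a * t)) * expR (- (a * t))) =
  C * K1 * eps * expR (- (a * t)) * (expR (a * t) * expR (- (a * t))) by ring.
rewrite e3 mulr1; have Aa : 0 <= A / a by apply: divr_ge0 => //; exact: ltW.
have : 0 <= A / a * eps * expR (- (a * t)).
  by apply: mulr_ge0 => //; apply: mulr_ge0 => //; exact: ltW.
move: (expR _) => e; lra.
Qed.

End CoefficientEstimate.

(** * The Legendre transform *)

(** A quadratic bound for the remainder at one point determines the directional derivative. The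
    derivatives of the potential and of its Legendre transform are all obtained from such bounds. *)
Lemma derive_quad {R : realType} {r : nat} (f : 'rV[R]_r -> R) (x v : 'rV[R]_r) (l K del : R) :
  0 < del -> (forall h, `|h| < del -> `|f (x + h *: v) - f x - h * l| <= K * h ^+ 2) ->
  'D_v f x = l.
Proof.
move=> del0 H; apply: (@cvg_lim R) => //.
apply/cvgrPdist_le => /= e e0; near=> h.
have h0 : h != 0 by near: h; exact: nbhs_dnbhs_neq.
have hd : `|h| < del.
  by near: h; apply: dnbhs0_lt.
have he : `|h| * (`|K| + 1) <= e.
  rewrite -ler_pdivlMr ?ltr_wpDl //; near: h; apply: dnbhs0_le.
  by rewrite divr_gt0 // ltr_wpDl.
rewrite [h *: v + x]addrC.
have -> : l - h^-1 *: (f (x + h *: v) - f x) = - (h^-1 * (f (x + h *: v) - f x - h * l)).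
  by rewrite /GRing.scale /=; field.
rewrite normrN normrM normfV ler_pdivrMl ?normr_gt0 //.
apply: (le_trans (H h hd)); apply: le_trans (ler_wpM2l (normr_ge0 h) he).
have -> : `|h| * (`|h| * (`|K| + 1)) = (`|K| + 1) * h ^+ 2.
  by rewrite -[in RHS](real_normK (num_real h)); ring.
by rewrite ler_wpM2r ?sqr_ge0 //; have := ler_norm K; lra.
Unshelve. all: by end_near.
Qed.

(** * Second order bounds for the logarithm of a partition function *)

Section LogPartition.
Context {R : realType} {r : nat}.
Variables (c : seq 'rV[R]_r) (V : R) (u : 'rV[R]_r).
Hypothesis c_ne : c != [::].
Hypothesis cV : forall v, v \in c -> forall a, `|v 0 a| <= V.
Let T : R := r%:R * (2%:R * V) * 1.
Let p0 v : 0 <= prob c u v := ltW (prob_gt0 u c_ne v).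

(** The moment generating function of the centered weight; its logarithm is the Bregman divergence
    of [ln partition] from u to u + d. *)
Definition tilted d : R := \sum_(v <- c) prob c u v * expR (deviation c u d v).
Definition variance d : R := dot (d *m cov c u) d.

Lemma V_ge0 : 0 < r%:R :> R -> 0 <= V.
Proof.
rewrite ltr0n => r0; case: c c_ne cV => // v s _ /(_ v (mem_head _ _) (Ordinal r0)).
exact: le_trans.
Qed.

Lemma partitionD d : partition c (u + d) = partition c u * (expR (dot (mean c u) d) * tilted d).
Proof.
rewrite /tilted /partition mulrA mulr_sumr; apply: eq_bigr => v _.
rewrite /prob /deviation (dotDl v (- mean c u) d) dotNl !dotDr !expRD expRN.
have := lt0r_neq0 (partition_gt0 u c_ne); have := lt0r_neq0 (expR_gt0 (dot (mean c u) d)).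
by rewrite /partition; move: (expR (dot (mean c u) d)) (\sum_(w <- c) _) => a b a0 b0; field;
  rewrite a0.
Qed.

Lemma variance_sum d : variance d = \sum_(v <- c) prob c u v * deviation c u d v ^+ 2.
Proof. by rewrite /variance cov_quad. Qed.

Lemma quadratic_sum d (A : R) :
  \sum_(v <- c) prob c u v * (1 + deviation c u d v + A * deviation c u d v ^+ 2) =
  1 + A * variance d.
Proof.
under eq_bigr do rewrite !mulrDr mulr1 [_ * (A * _)]mulrCA.
by rewrite !big_split /= prob_sum // deviation_mean // addr0 -mulr_sumr variance_sum.
Qed.

Lemma tilted_ge1 d : 1 <= tilted d.
Proof.
rewrite -[leLHS]addr0 -(mul0r (variance d)) -quadratic_sum; apply: ler_sum => v _.
by rewrite mul0r addr0 ler_wpM2l // expR_ge1Dx.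
Qed.

Lemma ln_partitionD d :
  ln (partition c (u + d)) = ln (partition c u) + dot (mean c u) d + ln (tilted d).
Proof.
have t0 : 0 < tilted d := lt_le_trans ltr01 (tilted_ge1 d).
have Z0 := partition_gt0 u c_ne.
by rewrite partitionD !lnM ?posrE ?mulr_gt0 ?expR_gt0 // expRK addrA.
Qed.

Lemma meanD d a : (mean c (u + d)) 0 a - (mean c u) 0 a =
  (\sum_(v <- c) prob c u v * expR (deviation c u d v) * (v 0 a - mean c u 0 a)) / tilted d.
Proof.
have t0 := lt0r_neq0 (lt_le_trans ltr01 (tilted_ge1 d)).
have pE v : prob c (u + d) v = prob c u v * expR (deviation c u d v) / tilted d.
  rewrite /prob partitionD /deviation dotDr (dotDl v (- mean c u) d) dotNl !expRD expRN.
  have := lt0r_neq0 (partition_gt0 u c_ne); have := lt0r_neq0 (expR_gt0 (dot (mean c u) d)).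
  by move: (partition c u) (tilted d) t0 (expR (dot (mean c u) d)) => z t t0 e e0 z0; field;
    rewrite z0 e0 t0.
rewrite {1}/mean summxE; apply: (mulIf t0); rewrite mulfVK // mulrBl mulr_suml.
have -> : mean c u 0 a * tilted d =
    \sum_(v <- c) prob c u v * expR (deviation c u d v) * mean c u 0 a.
  by rewrite mulrC /tilted mulr_suml.
rewrite -sumrB; apply: eq_bigr => v _.
rewrite mxE pE; field; exact: t0.
Qed.

Section SmallDisplacement.
Variable d : 'rV[R]_r.
Hypothesis d1 : forall a, `|d 0 a| <= 1.

Lemma deviation_small v : v \in c -> `|deviation c u d v| <= T.
Proof. exact: deviation_bound cV d1 v. Qed.

Lemma tilted_lb : 1 + expR (- T) / 2%:R * variance d <= tilted d.
Proof.
rewrite -quadratic_sum /tilted big_seq [leRHS]big_seq; apply: ler_sum => v vc.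
by rewrite ler_wpM2l // expR_quad_lb // deviation_small.
Qed.

Lemma tilted_ub : tilted d <= 1 + expR T / 2%:R * variance d.
Proof.
rewrite -quadratic_sum /tilted big_seq [leRHS]big_seq; apply: ler_sum => v vc.
by rewrite ler_wpM2l // expR_quad_ub // deviation_small.
Qed.

Lemma tilted_le : tilted d <= expR T.
Proof.
rewrite -[leRHS]mul1r -(prob_sum u c_ne) mulr_suml /tilted big_seq [leRHS]big_seq.
apply: ler_sum => v vc; apply: ler_wpM2l => //; by rewrite ler_expR (le_trans (ler_norm _)) // deviation_small.
Qed.

Lemma variance_ge0 : 0 <= variance d.
Proof. by rewrite variance_sum; apply: sumr_ge0 => v _; rewrite mulr_ge0 ?sqr_ge0. Qed.

Lemma variance_ub : variance d <= (r%:R * (2%:R * V)) ^+ 2 * dot d d.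
Proof.
have -> : (r%:R * (2%:R * V)) ^+ 2 * dot d d = (r%:R * (2%:R * V) * Num.sqrt (dot d d)) ^+ 2.
  by rewrite [RHS]exprMn sqr_sqrtr // dot_ge0.
rewrite /variance cov_quad //; apply: (le_trans (ler_norm _)).
have [r0|r0] := posnP r; last first.
  have rr : 0 < r%:R :> R by rewrite ltr0n.
  have V0 := V_ge0 rr.
  apply: (@moment_bound _ _ _ _ _ (fun v _ => p0 v) (prob_sum u c_ne) 2).
    by rewrite !mulr_ge0 ?sqrtr_ge0 // ltW.
  move=> v vc; apply: deviation_bound => // a; exact: norm_coord_le.
rewrite /moment big1 ?normr0 ?sqr_ge0 // => v _.
rewrite /deviation dotE big1 ?expr0n ?mulr0 // => a _; case: a => a ar.
by exfalso; rewrite r0 in ar.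
Qed.

Lemma ln_tilted_lb : expR (- T) / 2%:R * expR (- T) * variance d <= ln (tilted d).
Proof.
have t1 := tilted_ge1 d; have t0 : 0 < tilted d := lt_le_trans ltr01 t1.
have i0 : 0 < (tilted d)^-1 by rewrite invr_gt0.
have h : (tilted d)^-1 * tilted d = 1 by rewrite mulVf // lt0r_neq0.
(* Applied to the inverse, the upper bound of the logarithm becomes ln t >= 1 - 1 / t. *)
have := @le_ln1Dx R ((tilted d)^-1 - 1).
rewrite [1 + _]addrC subrK lnV ?posrE // => /(_ _) H.
have {}H : 1 - (tilted d)^-1 <= ln (tilted d) by have := H ltac:(lra); lra.
apply: le_trans H; have lb := tilted_lb; have ub := tilted_le.
have e1 := expRxMexpNx_1 T; have e0 := expR_gt0 (- T).
have ie : expR (- T) <= (tilted d)^-1 by rewrite expRN lef_pV2 ?posrE ?expR_gt0.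
have S0 := variance_ge0.
have : expR (- T) / 2%:R * variance d * expR (- T) <= (tilted d - 1) * (tilted d)^-1.
  by apply: ler_pM => //; [rewrite !mulr_ge0 // ltW | lra].
lra.
Qed.

Lemma ln_tilted_ub : ln (tilted d) <= expR T / 2%:R * variance d.
Proof.
have t1 := tilted_ge1 d; have := @le_ln1Dx R (tilted d - 1).
rewrite [1 + _]addrC subrK => H; apply: (le_trans (H _)); first lra.
by have := tilted_ub; lra.
Qed.

Lemma mean_taylor a :
  `|(mean c (u + d)) 0 a - (mean c u) 0 a - (d *m cov c u) 0 a| <= 2%:R * V * expR T * variance d.
Proof.
have t1 := tilted_ge1 d; have t0 : 0 < tilted d := lt_le_trans ltr01 t1.
pose y (v : 'rV[R]_r) := v 0 a - mean c u 0 a.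
have y1 v : v \in c -> `|y v| <= 2%:R * V.
  move=> vc; apply: (le_trans (ler_normB _ _)).
  by have := cV vc a; have := mean_bound u c_ne cV a; lra.
have dcov : (d *m cov c u) 0 a = \sum_(v <- c) prob c u v * (deviation c u d v * y v).
  rewrite /cov mulmx_sumr summxE; apply: eq_bigr => v _.
  rewrite -scalemxAr mxE mulmxA [d *m _]mx11_scalar mul_scalar_mx !mxE; congr (_ * (_ * _)).
  by rewrite /deviation dotC /dot mxE.
have ymean : \sum_(v <- c) prob c u v * y v = 0.
  rewrite /y; under eq_bigr do rewrite mulrBr; rewrite sumrB -mulr_suml prob_sum // mul1r.
  by rewrite /mean summxE; apply/eqP; rewrite subr_eq0; apply/eqP; apply: eq_bigr => v _; rewrite mxE.
pose X := \sum_(v <- c) prob c u v * expR (deviation c u d v) * y v.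
have V20 : 0 <= 2%:R * V.
  by case: c c_ne y1 => // v s _ /(_ v (mem_head _ _)); apply: le_trans.
have X1 : `|X - (d *m cov c u) 0 a| <= 2%:R * V * (expR T / 2%:R * variance d).
  have -> : X - (d *m cov c u) 0 a =
      \sum_(v <- c) prob c u v * ((expR (deviation c u d v) - 1 - deviation c u d v) * y v).
    by rewrite dcov -[LHS]subr0 -[X in _ - X = _]ymean -!sumrB; apply: eq_bigr => v _; ring.
  apply: (le_trans (ler_norm_sum _ _ _)); rewrite variance_sum !mulr_sumr.
  rewrite big_seq [leRHS]big_seq; apply: ler_sum => v vc.
  rewrite normrM (ger0_norm (p0 v)) normrM.
  have lb := expR_ge1Dx (deviation c u d v); have ub := expR_quad_ub (deviation_small vc).
  rewrite [X in _ * (X * _)]ger0_norm; last lra.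
  have -> : 2%:R * V * (expR T / 2%:R * (prob c u v * deviation c u d v ^+ 2)) =
    prob c u v * ((expR T / 2%:R * deviation c u d v ^+ 2) * (2%:R * V)) by ring.
  by apply: ler_wpM2l => //; apply: ler_pM; rewrite ?y1 //; lra.
have X2 : `|X| <= tilted d * (2%:R * V).
  apply: (le_trans (ler_norm_sum _ _ _)); rewrite /tilted mulr_suml.
  rewrite big_seq [leRHS]big_seq; apply: ler_sum => v vc.
  by rewrite normrM normrM (ger0_norm (p0 v)) (ger0_norm (expR_ge0 _)) ler_wpM2l ?y1 // mulr_ge0 ?expR_ge0.
rewrite meanD -/X.
have -> : X / tilted d - (d *m cov c u) 0 a =
    (X - (d *m cov c u) 0 a) - X / tilted d * (tilted d - 1).
  by field; exact: lt0r_neq0.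
apply: (le_trans (ler_normB _ _)).
have X3 : `|X / tilted d * (tilted d - 1)| <= 2%:R * V * (expR T / 2%:R * variance d).
  rewrite normrM; apply: ler_pM => //.
    by rewrite normrM normfV (ger0_norm (ltW t0)) ler_pdivrMr // mulrC.
  by rewrite ger0_norm; have := tilted_ub; lra.
lra.
Qed.

End SmallDisplacement.
End LogPartition.

Lemma posdef_det_gt0 (R : realType) r (Q : 'M[R]_r) : posdef Q -> 0 < \det Q.
Proof.
elim: r Q => [|r IH] Q Qpos; first by rewrite det_mx00.
by rewrite (schur_det Qpos) mulr_gt0 ?IH //; [exact: schur_a_gt0 | exact: schur_posdef].
Qed.

Lemma continuous_sumr (R : realType) (T : topologicalType) (I : Type) (s : seq I)
    (f : I -> T -> R) :
  (forall i, continuous (f i)) -> continuous (fun x => \sum_(i <- s) f i x).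
Proof.
move=> cf; elim: s => [|i s IH]; first by under eq_fun do rewrite big_nil; exact: cst_continuous.
under eq_fun do rewrite big_cons; move=> x; apply: cvgD; [exact: cf | exact: IH].
Qed.

Section LegendreTransform.
Context {R : realType} {r m : nat}.
Variables (c : 'I_m -> seq 'rV[R]_r) (V : R).
Hypotheses (r_gt0 : (0 < r)%N) (c_ne : forall k, c k != [::]).
Hypotheses (V_ge0 : 0 <= V) (cV : forall k v, v \in c k -> forall a, `|v 0 a| <= V).
Implicit Types (tau : 'I_m -> R) (u v d z : 'rV[R]_r).
Let T : R := r%:R * (2%:R * V) * 1.

(* The potential f(tau, y), its derivatives and its Legendre transform, in the coordinates
   u = y B, for which the pairing (y, xi) is the dot product of u and xi. *)
Definition pot tau u : R := \sum_k tau k * ln (partition (c k) u).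
Definition grad tau u : 'rV[R]_r := \sum_k tau k *: mean (c k) u.
Definition hess tau u : 'M[R]_r := \sum_k tau k *: cov (c k) u.
Definition bregman tau u d : R := pot tau (u + d) - pot tau u - dot (grad tau u) d.
Definition leg tau z : R := inf (range (fun u => pot tau u - dot u z)).

Lemma bregmanE tau u d : bregman tau u d = \sum_k tau k * ln (tilted (c k) u d).
Proof.
rewrite /bregman /pot /grad dot_suml -!sumrB; apply: eq_bigr => k _.
by rewrite dotZl ln_partitionD //; ring.
Qed.

Lemma hess_quad tau u d : dot (d *m hess tau u) d = \sum_k tau k * variance (c k) u d.
Proof.
rewrite /hess mulmx_sumr dot_suml; apply: eq_bigr => k _.
by rewrite -scalemxAr dotZl.
Qed.

Lemma norm_coord_dot d a : `|d 0 a| <= Num.sqrt (dot d d).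
Proof. by rewrite -sqrtr_sqr ler_sqrt ?dot_ge0 // sqr_coord_le. Qed.

Section Tau.
Variable tau : 'I_m -> R.
Hypothesis tau_ge0 : forall k, 0 <= tau k.

Lemma bregman_ge0 u d : 0 <= bregman tau u d.
Proof.
rewrite bregmanE; apply: sumr_ge0 => k _; rewrite mulr_ge0 // ln_ge0 //.
exact: tilted_ge1.
Qed.

Lemma bregman_ub u d : (forall a, `|d 0 a| <= 1) ->
  bregman tau u d <= (\sum_k tau k) * (expR T / 2%:R * (r%:R * (2%:R * V)) ^+ 2) * dot d d.
Proof.
move=> d1; rewrite bregmanE -mulrA mulr_suml; apply: ler_sum => k _; rewrite ler_wpM2l //.
apply: (le_trans (ln_tilted_ub u (c_ne k) (@cV k) d1)); rewrite -[leRHS]mulrA.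
by apply: ler_wpM2l; [rewrite divr_ge0 ?expR_ge0 | exact: (variance_ub u (c_ne k) (@cV k) d)].
Qed.

Lemma bregman_lb ks pl u d : spread (c ks) -> 0 <= pl ->
  (forall v, v \in c ks -> pl <= prob (c ks) u v) -> (forall a, `|d 0 a| <= 1) ->
  tau ks * (expR (- T) / 2%:R * expR (- T) * (pl ^+ 2 / (2%:R * r%:R))) * dot d d <=
  bregman tau u d.
Proof.
move=> sc pl0 plP d1; rewrite bregmanE (bigD1 ks) //= -[leLHS]addr0; apply: lerD; last first.
  apply: sumr_ge0 => k _; rewrite mulr_ge0 // ln_ge0 //; exact: tilted_ge1.
rewrite -[leLHS]mulrA ler_wpM2l //; apply: le_trans (ln_tilted_lb u (c_ne ks) (@cV ks) d1).
rewrite -[leLHS]mulrA; apply: ler_wpM2l; first by rewrite !mulr_ge0 ?expR_ge0.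
have := variance_spread (c_ne ks) pl0 plP d sc => H.
by rewrite mulrAC ler_pdivrMr ?mulr_gt0 ?ltr0n // [leRHS]mulrC.
Qed.

Lemma grad_taylor u d a : (forall a, `|d 0 a| <= 1) ->
  `|(grad tau (u + d) - grad tau u - d *m hess tau u) 0 a| <=
  (\sum_k tau k) * (2%:R * V * expR T * (r%:R * (2%:R * V)) ^+ 2) * dot d d.
Proof.
move=> d1; rewrite /grad /hess mulmx_sumr -!sumrB summxE; apply: (le_trans (ler_norm_sum _ _ _)).
rewrite -mulrA mulr_suml; apply: ler_sum => k _.
rewrite -scalerBr -scalemxAr -scalerBr mxE normrM ger0_norm // ler_wpM2l //.
rewrite !mxE; have := mean_taylor u (c_ne k) (@cV k) d1 a; rewrite !mxE => H.
apply: (le_trans H); rewrite -[leRHS]mulrA; apply: ler_wpM2l; last exact: (variance_ub u (c_ne k) (@cV k) d).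
by rewrite !mulr_ge0 ?expR_ge0.
Qed.

Definition excess z u : R := pot tau u - dot u z.

Lemma excess_min u v z : grad tau u = z -> excess z u <= excess z v.
Proof.
move=> gu; have := bregman_ge0 u (v - u); rewrite /bregman /excess [u + _]addrC subrK gu.
by rewrite dotDr dotNr !(dotC z); lra.
Qed.

Lemma legE u z : grad tau u = z -> leg tau z = excess z u.
Proof.
move=> gu; apply/eqP; rewrite eq_le; apply/andP; split.
  apply: ge_inf; last by exists u.
  by exists (excess z u) => _ [v _ <-]; exact: excess_min.
apply: lb_le_inf; first by exists (excess z u), u.
by move=> _ [v _ <-]; exact: excess_min.
Qed.

(** The tangent inequalities at the intermediate point, in the directions of the two ends, are
    averaged. *)
Lemma excess_convex z u d s : 0 <= s <= 1 ->
  excess z (u + s *: d) <= (1 - s) * excess z u + s * excess z (u + d).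
Proof.
move=> /andP[s0 s1]; pose y := u + s *: d.
have h1 := bregman_ge0 y (- (s *: d)); have h2 := bregman_ge0 y ((1 - s) *: d).
have e1 : y + - (s *: d) = u by rewrite /y addrK.
have e2 : y + (1 - s) *: d = u + d.
  by rewrite /y -addrA -scalerDl addrC addrC [s + _]addrC subrK scale1r.
move: h1 h2; rewrite /bregman e1 e2 dotNr !dotZr /excess !dotDl -/y.
rewrite !dotZl.
move: (pot tau y) (pot tau u) (pot tau (u + d)) (dot (grad tau y) d) (dot d z) (dot u z).
move=> py pu pd g dz uz h1 h2.
have := mulr_ge0 (_ : 0 <= 1 - s) h1; have := mulr_ge0 s0 h2.
move=> k2 k1; have {}k1 := k1 ltac:(lra); lra.
Qed.

Section Localization.
Variables (u z : 'rV[R]_r) (kap e : R).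
Hypothesis kap_gt0 : 0 < kap.
Hypothesis kapP : forall d, (forall a, `|d 0 a| <= 1) -> kap * dot d d <= bregman tau u d.
Hypothesis ze : forall a, `|z 0 a - grad tau u 0 a| <= e.
Hypothesis e_small : r%:R * e < kap.

Lemma e_ge0 : 0 <= e.
Proof. exact: le_trans (ze (Ordinal r_gt0)). Qed.

(** In the unit box the excess grows at least like kap |d|^2, up to a linear term r e |d| from the
    error in the gradient; a point that does not increase it is therefore close to u. *)
Lemma localize d : (forall a, `|d 0 a| <= 1) -> excess z (u + d) <= excess z u ->
  Num.sqrt (dot d d) <= r%:R * e / kap.
Proof.
move=> d1; set L := Num.sqrt _; have L0 : 0 <= L := sqrtr_ge0 _.
have L2 : L ^+ 2 = dot d d by rewrite sqr_sqrtr // dot_ge0.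
rewrite /excess dotDl => H; have := kapP d1; rewrite -L2 /bregman => K.
have dz : dot (z - grad tau u) d <= r%:R * e * L.
  apply: (le_trans (ler_norm _)); apply: dot_bound => a; last exact: norm_coord_dot.
  by rewrite !mxE ze.
have {}K : kap * L ^+ 2 <= r%:R * e * L.
  by move: dz; rewrite dotDl dotNl (dotC z); lra.
rewrite ler_pdivlMr //; have [L1|/le_gtF L1] := ltP 0 L.
  by rewrite -(ler_pM2r L1); move: K; rewrite expr2; lra.
have -> : L = 0 by apply/eqP; rewrite eq_le L0 andbT leNgt L1.
by rewrite mul0r mulr_ge0 // e_ge0.
Qed.

(** [localize] applies only in the unit box. By convexity the excess on the segment from u to v is
    at most its value at u, so v may be scaled into the box; if v were outside, the scaled point of
    length 1 would contradict r e < kap. *)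
Lemma grad_stable v : grad tau v = z -> forall a, `|v 0 a - u 0 a| <= r%:R * e / kap.
Proof.
move=> gv; set D := v - u; pose L := Num.sqrt (dot D D).
have L0 : 0 <= L := sqrtr_ge0 _.
have DE : u + D = v by rewrite addrC subrK.
have small : r%:R * e / kap < 1 by rewrite ltr_pdivrMr // mul1r.
have scaled s : 0 <= s <= 1 -> s * L <= 1 -> s * L <= r%:R * e / kap.
  move=> s01 sL; have /andP[s0 s1] := s01.
  have E : Num.sqrt (dot (s *: D) (s *: D)) = s * L.
    by rewrite dotZl dotZr mulrA -expr2 sqrtrM ?sqr_ge0 // sqrtr_sqr ger0_norm.
  rewrite -E; apply: localize => [a|].
    by apply: (le_trans (norm_coord_dot _ a)); rewrite E.
  apply: (le_trans (excess_convex z u D s01)); rewrite DE.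
  have := ler_wpM2l s0 (excess_min u gv); lra.
have L1 : L <= 1.
  rewrite leNgt; apply/negP => L1; have L0' : 0 < L := lt_trans ltr01 L1.
  have := scaled L^-1; rewrite mulVf ?lt0r_neq0 // lexx invr_ge0 L0 invf_le1 // (ltW L1).
  by move=> /(_ isT isT); rewrite leNgt small.
move=> a; have -> : v 0 a - u 0 a = D 0 a by rewrite !mxE.
apply: (le_trans (norm_coord_dot _ a)); rewrite -/L -[leLHS]mul1r.
by apply: scaled; rewrite ?mul1r // ler01 lexx.
Qed.

(** The excess attains its minimum on the closed unit box around u by compactness. [localize] keeps
    the minimum point in the interior, and there a small change of one coordinate, with [bregman_ub]
    as second order bound, forces the gradient to be z. *)
Lemma grad_solve : exists v, grad tau v = z.
Proof.
pose A := [set v : 'rV[R]_r | forall a, `[u 0 a - 1, u 0 a + 1]%classic (v ord0 a)].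
have cA : compact A by apply: (@rV_compact _ _ (fun a => `[u 0 a - 1, u 0 a + 1]%classic)) => a; exact: segment_compact.
have AP v : A v <-> forall a, `|(v - u) 0 a| <= 1.
  split=> [Av a|H a]; first by have := Av a; rewrite /= in_itv /= !mxE ler_norml => /andP[h1 h2]; apply/andP; split; lra.
  by have := H a; rewrite /= in_itv /= !mxE ler_norml => /andP[h1 h2]; apply/andP; split; lra.
have Au : A u by apply/AP => a; rewrite subrr mxE normr0.
have cont_dot w : continuous (fun y : 'rV[R]_r => dot w y).
  under eq_fun do rewrite dotE; apply: continuous_sumr => a y.
  apply: (@continuous_comp _ _ _ (fun x : 'rV[R]_r => x 0 a) ( *%R (w 0 a))).
    exact: coord_continuous.
  exact: mulrl_continuous.
have cE : continuous (excess z).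
  have cz : continuous (fun y : 'rV[R]_r => dot y z).
    by under eq_fun do rewrite dotC; exact: cont_dot.
  move=> y; apply: (@continuousB _ _ _ (pot tau) (fun y : 'rV[R]_r => dot y z)); last exact: cz.
  apply: continuous_sumr => k {}y.
  apply: (@continuous_comp _ _ _ (partition (c k)) (fun t => tau k * ln t)); last first.
    apply: (@continuous_comp _ _ _ (@ln R) ( *%R (tau k))); last exact: mulrl_continuous.
    by apply: continuous_ln; exact: partition_gt0.
  apply: continuous_sumr => v {}y.
  by apply: (@continuous_comp _ _ _ (dot v) expR); [exact: cont_dot | exact: continuous_expR].
have [v + vmin] := compact_EVT_min (ex_intro _ u Au) cA (continuous_subspaceT cE).
rewrite inE => /AP vA.
have uE : u + (v - u) = v by rewrite addrC subrK.
have vL := localize vA; rewrite uE in vL; have {}vL := vL (vmin _ (mem_set Au)).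
have small : r%:R * e / kap < 1 by rewrite ltr_pdivrMr // mul1r.
set q := r%:R * e / kap in vL small.
exists v; apply/rowP => a; apply/eqP; rewrite -subr_eq0; apply/eqP.
set C := (\sum_k tau k) * (expR T / 2%:R * (r%:R * (2%:R * V)) ^+ 2).
have C0 : 0 <= C.
  by rewrite mulr_ge0 ?sumr_ge0 // mulr_ge0 ?sqr_ge0 // divr_ge0 // expR_ge0.
have q0 : 0 <= q by apply: divr_ge0; [rewrite mulr_ge0 // e_ge0 | exact: ltW].
have step eta : `|eta| <= 1 - q -> 0 <= eta * (grad tau v 0 a - z 0 a) + C * eta ^+ 2.
  move=> h; pose d : 'rV[R]_r := eta *: delta_mx 0 a.
  have dE b : `|d 0 b| <= `|eta|.
    by rewrite !mxE eqxx /=; case: (b == a); rewrite ?mulr1 // mulr0 normr0.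
  have Ad : A (v + d).
    apply/AP => b; have -> : (v + d - u) = (v - u) + d by rewrite addrAC.
    rewrite mxE; apply: (le_trans (ler_normD _ _)).
    by have := dE b; have := norm_coord_dot (v - u) b; lra.
  have := vmin _ (mem_set Ad); rewrite /excess dotDl.
  have d1 b : `|d 0 b| <= 1 by have := dE b; lra.
  have := bregman_ub v d1; rewrite /bregman -/C.
  have e1 : dot (grad tau v) d = eta * grad tau v 0 a by rewrite /d dotZr dot_delta.
  have e2 : dot d z = eta * z 0 a by rewrite dotC /d dotZr dot_delta.
  have e3 : dot d d = eta ^+ 2 by rewrite {2}/d dotZr dot_delta !mxE !eqxx mulr1 expr2.
  rewrite e1 e2 e3; move: (pot tau _) (pot tau v) (dot v z) => p1 p2 p3; lra.
have [g0|g0] := eqVneq (grad tau v 0 a - z 0 a) 0; first by [].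
set g := grad tau v 0 a - z 0 a in g0 step *.
have n0 : 0 < `|g| by rewrite normr_gt0.
(* The step - g t has to stay in the box and to make the quadratic term at most half of the linear
   one. *)
pose t := Num.min ((1 - q) / `|g|) ((2%:R * (C + 1))^-1).
have t0 : 0 < t.
  by rewrite lt_min; apply/andP; split; [rewrite divr_gt0 // subr_gt0 | rewrite invr_gt0 mulr_gt0 // ltr_wpDl].
have := step (- (g * t)); rewrite normrN normrM (ger0_norm (ltW t0)) mulrC -ler_pdivlMr // => /(_ _) H.
have {}H := H ltac:(by rewrite ge_min lexx).
have Ct : C * t <= 2%:R^-1.
  have h : t <= (2%:R * (C + 1))^-1 by rewrite ge_min lexx orbT.
  apply: (le_trans (ler_wpM2l C0 h)); rewrite ler_pdivrMr ?mulr_gt0 ?ltr_wpDl //; lra.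
have g2 : 0 < g ^+ 2 * t by rewrite mulr_gt0 // lt0r sqrf_eq0 g0 sqr_ge0.
have K := ler_wpM2l (ltW g2) Ct; exfalso; move: K H g2; move: (t) (g) (C) => t' g' C'; lra.
Qed.

End Localization.

Section Derivatives.
Variables (u : 'rV[R]_r) (kap : R).
Hypothesis kap_gt0 : 0 < kap.
Hypothesis kapP : forall d, (forall a, `|d 0 a| <= 1) -> kap * dot d d <= bregman tau u d.

Lemma grad_perturb h a : r%:R * `|h| < kap -> exists v,
  grad tau v = grad tau u + h *: delta_mx 0 a /\ forall b, `|v 0 b - u 0 b| <= r%:R * `|h| / kap.
Proof.
move=> hk; set z := grad tau u + _.
have ze b : `|z 0 b - grad tau u 0 b| <= `|h|.
  by rewrite !mxE addrC addKr eqxx /=; case: (b == a); rewrite ?mulr1 // mulr0 normr0.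
have [v vz] := grad_solve kap_gt0 kapP ze hk.
by exists v; split=> //; exact: grad_stable kap_gt0 kapP ze hk v vz.
Qed.

(** Both u and v minimize their own excess. Testing each at the other point places the increment of
    [leg] between - h v_a and - h u_a, and v is at distance O(h) from u. *)
Lemma derive_leg a : 'D_(delta_mx 0 a) (leg tau) (grad tau u) = - u 0 a.
Proof.
apply: (@derive_quad _ _ _ _ _ _ (r%:R / kap) (kap / r%:R)) => [|h hk].
  by rewrite divr_gt0 // ltr0n.
rewrite ltr_pdivlMr ?ltr0n // mulrC in hk.
have [v [gv vu]] := grad_perturb a hk.
rewrite (legE gv) (legE (erefl (grad tau u))).
have h1 := excess_min u gv; have h2 := excess_min v (erefl (grad tau u)).
move: h1 h2; rewrite /excess !dotDr !dotZr !dot_delta => h1 h2.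
have vh : `|h * (v 0 a - u 0 a)| <= r%:R / kap * h ^+ 2.
  rewrite normrM -[h ^+ 2]real_normK ?num_real //.
  have := ler_wpM2l (normr_ge0 h) (vu a); move: (`|h|) => H; lra.
apply: le_trans vh; move: h1 h2; rewrite ler_norml.
have := ler_norm (h * (v 0 a - u 0 a)); have := ler_norm (- (h * (v 0 a - u 0 a))).
rewrite normrN; move: (`|_|) (pot tau u) (pot tau v) (dot u _) (dot v _) => n pu pv du dv.
by move=> k1 k2 k3 k4; apply/andP; split; lra.
Qed.

End Derivatives.
End Tau.

(** The constant kap depends on u but not on tau, which varies along the sequence; only the
    coefficient of the module ks enters, as a factor. *)
Lemma strong_convexity ks u : spread (c ks) -> exists2 kap, 0 < kap &
  forall tau, (forall k, 0 <= tau k) -> forall d, (forall a, `|d 0 a| <= 1) ->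
    tau ks * kap * dot d d <= bregman tau u d.
Proof.
move=> sc; pose pl : R := expR (- (2%:R * (r%:R * V * Num.sqrt (dot u u)))) / (size (c ks))%:R.
have pl0 : 0 < pl by rewrite divr_gt0 ?expR_gt0 // ltr0n lt0n size_eq0.
have plP v : v \in c ks -> pl <= prob (c ks) u v.
  move=> vc; apply: prob_lb => // w wc; apply: dot_bound => [|a]; first exact: cV wc.
  exact: norm_coord_dot.
exists (expR (- T) / 2%:R * expR (- T) * (pl ^+ 2 / (2%:R * r%:R))) => [|tau t0 d d1].
  apply: mulr_gt0; last by rewrite divr_gt0 ?exprn_gt0 // mulr_gt0 ?ltr0n.
  by apply: mulr_gt0; rewrite ?divr_gt0 ?expR_gt0.
exact: bregman_lb (ltW pl0) plP d1.
Qed.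

(** The vector is scaled into the unit box, where strong convexity bounds the divergence from below
    and the Hessian bounds it from above. *)
Lemma hess_posdef tau ks u : (forall k, 0 <= tau k) -> 0 < tau ks -> spread (c ks) ->
  posdef (hess tau u).
Proof.
move=> t0 ks0 sc; split=> [|x x0].
  by rewrite /hess linear_sum; apply: eq_bigr => k _; rewrite linearZ /= cov_sym.
have [kap kap0 H] := strong_convexity u sc.
pose s := (Num.sqrt (dot x x))^-1; have x1 : 0 < dot x x by rewrite lt0r dot_eq0 x0 dot_ge0.
have s0 : 0 < s by rewrite invr_gt0 sqrtr_gt0.
have sx a : `|(s *: x) 0 a| <= 1.
  rewrite mxE normrM (ger0_norm (ltW s0)) /s mulrC ler_pdivrMr ?sqrtr_gt0 // mul1r.
  exact: norm_coord_dot.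
have q0 : 0 < tau ks * kap * dot (s *: x) (s *: x).
  by rewrite mulr_gt0 ?mulr_gt0 // dotZl dotZr !mulr_gt0.
have := lt_le_trans q0 (H tau t0 _ sx); rewrite bregmanE => B0.
have : 0 < expR T / 2%:R * dot ((s *: x) *m hess tau u) (s *: x).
  apply: (lt_le_trans B0); rewrite hess_quad mulr_sumr; apply: ler_sum => k _.
  rewrite [leRHS]mulrCA ler_wpM2l //; exact: (ln_tilted_ub u (c_ne k) (@cV k) sx).
rewrite -scalemxAl dotZl dotZr !pmulr_rgt0 // ?divr_gt0 ?expR_gt0 //.
Qed.

(** By [derive_leg] the gradient of [leg] is minus the inverse of the map [grad]. The expansion of
    [grad] at u, solved for the displacement v - u, gives the derivative of this inverse with a
    quadratic remainder. *)
Lemma derive2_leg tau ks u a b : (forall k, 0 <= tau k) -> 0 < tau ks -> spread (c ks) ->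
  'D_(delta_mx 0 a) (fun z => 'D_(delta_mx 0 b) (leg tau) z) (grad tau u) =
  - invmx (hess tau u) a b.
Proof.
move=> t0 ks0 sc; set H := hess tau u.
have Hu : H \in unitmx.
  by rewrite unitmxE unitfE lt0r_neq0 // posdef_det_gt0 //; exact: hess_posdef u t0 ks0 sc.
have conv v : exists2 kap, 0 < kap &
    forall d, (forall a, `|d 0 a| <= 1) -> kap * dot d d <= bregman tau v d.
  have [kap kap0 kapP] := strong_convexity v sc.
  by exists (tau ks * kap) => [|d d1]; [rewrite mulr_gt0 | exact: kapP].
have [kap kap0 kapP] := conv u.
set C := (\sum_k tau k) * (2%:R * V * expR T * (r%:R * (2%:R * V)) ^+ 2).
have rr : 0 < r%:R :> R by rewrite ltr0n.
have C0 : 0 <= C by rewrite mulr_ge0 ?sumr_ge0 // !mulr_ge0 ?sqr_ge0 ?expR_ge0.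
pose M := \sum_i `|invmx H i b|; have M0 : 0 <= M by apply: sumr_ge0.
apply: (@derive_quad _ _ _ _ _ _ (C * (r%:R * (r%:R / kap) ^+ 2) * M) (kap / r%:R)) => [|h hk].
  by rewrite divr_gt0.
rewrite ltr_pdivlMr // mulrC in hk.
have [v [gv vu]] := grad_perturb t0 kap0 kapP a hk.
rewrite -gv; have [kv kv0 kvP] := conv v.
rewrite (derive_leg t0 kv0 kvP) (derive_leg t0 kap0 kapP).
pose d := v - u; have vE : v = u + d by rewrite addrC subrK.
have dq : dot d d <= r%:R * (r%:R / kap) ^+ 2 * h ^+ 2.
  apply: (le_trans (ler_norm _)); have dc i : `|d 0 i| <= r%:R * `|h| / kap by rewrite !mxE.
  apply: (le_trans (dot_bound dc dc)).
  by rewrite -[h ^+ 2]real_normK ?num_real //; move: (`|h|) => y; lra.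
have d1 i : `|d 0 i| <= 1.
  have -> : d 0 i = v 0 i - u 0 i by rewrite !mxE.
  apply: (le_trans (vu i)); rewrite ler_pdivrMr // mul1r; exact: ltW.
pose rem := grad tau (u + d) - grad tau u - d *m H.
have remE : rem = h *: delta_mx 0 a - d *m H by rewrite /rem -vE gv [_ + h *: _]addrC addrK.
have remC i : `|rem 0 i| <= C * dot d d by exact: grad_taylor.
have dE : d = h *: row a (invmx H) - rem *m invmx H.
  by rewrite remE mulmxBl mulmxK // -scalemxAl -rowE opprB addrC subrK.
have -> : - v 0 b - - u 0 b - h * - invmx H a b = (rem *m invmx H) 0 b.
  have : d 0 b = h * invmx H a b - (rem *m invmx H) 0 b by rewrite {1}dE !mxE.
  have -> : d 0 b = v 0 b - u 0 b by rewrite !mxE.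
  move: ((rem *m _) 0 b) => y; lra.
rewrite mxE; apply: (le_trans (ler_norm_sum _ _ _)).
apply: (@le_trans _ _ (\sum_i C * (r%:R * (r%:R / kap) ^+ 2 * h ^+ 2) * `|invmx H i b|)).
  apply: ler_sum => i _; rewrite normrM ler_wpM2r //.
  by apply: (le_trans (remC i)); rewrite ler_wpM2l.
by rewrite -mulr_sumr -/M mulrA mulrAC mulrA.
Qed.

End LegendreTransform.

(** * Asymptotics of the multiplicities *)

Section IntegerVectors.
Context {R : realType} {r : nat}.
Implicit Types v w : 'rV[R]_r.

Definition intvec v := exists k : 'rV[int]_r, v = map_mx intr k.

Lemma intvec0 : intvec 0.
Proof. by exists 0; apply/rowP => a; rewrite !mxE. Qed.

Lemma intvecB v w : intvec v -> intvec w -> intvec (v - w).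
Proof.
move=> [k ->] [l ->]; exists (k - l); apply/rowP => a.
by rewrite !mxE intrB.
Qed.

Lemma intvecD v w : intvec v -> intvec w -> intvec (v + w).
Proof.
by move=> iv iw; rewrite -[w]opprK -[- w]sub0r; apply: intvecB iv _; exact: intvecB intvec0 iw.
Qed.

Lemma intvec_tensor m (c : 'I_m -> seq 'rV[R]_r) (n : 'I_m -> 'rV[R]_r) (N : 'I_m -> nat) v :
  (forall k w, w \in c k -> intvec (w - n k)) -> v \in tensor_exponents c N ->
  intvec (v - \sum_k (N k)%:R *: n k).
Proof.
move=> cn; rewrite -big_enum /= /tensor_exponents; elim: (enum _) v => [|k l IH] v /=.
  by rewrite inE big_nil subr0 => /eqP ->; exact: intvec0.
rewrite big_cons map_cat foldr_cat map_nseq; elim: (N k) v => [|i IHi] v /=.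
  by rewrite scale0r add0r; exact: IH.
move=> /allpairsP[[a b] /= [ac bt ->]].
have -> : a + b - ((i.+1%:R *: n k) + \sum_(j <- l) (N j)%:R *: n j) =
    (a - n k) + (b - ((i%:R *: n k) + \sum_(j <- l) (N j)%:R *: n j)).
  by move: (\sum_(j <- l) _) => S; apply/rowP => j; rewrite !mxE -natr1; ring.
by apply: intvecD; [exact: cn | exact: IHi].
Qed.

End IntegerVectors.

(** * The denominator in real coordinates *)

Section RealDenominator.
Context {R : realType} {r : nat}.
Implicit Types (b u : 'rV[R]_r) (s : seq 'rV[R]_r).

Fixpoint real_terms s : seq (R * 'rV[R]_r) :=
  if s is b :: s' then
    [seq (p.1, p.2 - 2%:R^-1 *: b) | p <- real_terms s'] ++
    [seq (- p.1, p.2 + 2%:R^-1 *: b) | p <- real_terms s']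
  else [:: (1, 0)].

Definition real_rho s := 2%:R^-1 *: \sum_(b <- s) b.
(* Multiplied by e^rho, the Weyl denominator has its exponents in the root lattice. *)
Definition shifted_terms s := [seq (p.1, real_rho s + p.2) | p <- real_terms s].

Lemma real_terms_prod s u :
  \sum_(p <- real_terms s) p.1 * expR (- dot p.2 u) =
  \prod_(b <- s) (expR (dot b u / 2%:R) - expR (- (dot b u / 2%:R))).
Proof.
elim: s => [|b s IH]; first by rewrite big_seq1 big_nil dot0l oppr0 expR0 mulr1.
rewrite big_cons -IH /= big_cat !big_map /= -big_split mulr_sumr; apply: eq_bigr => p _ /=.
rewrite !dotDl dotNl dotZl !opprD opprK !expRD [2%:R^-1 * _]mulrC; ring.
Qed.

Lemma shifted_terms_prod s u :
  \sum_(p <- shifted_terms s) p.1 * expR (- dot p.2 u) =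
  \prod_(b <- s) (expR (dot b u / 2%:R) - expR (- (dot b u / 2%:R))) *
  expR (- dot (real_rho s) u).
Proof.
rewrite -real_terms_prod big_map mulr_suml; apply: eq_bigr => p _ /=.
by rewrite dotDl opprD expRD; ring.
Qed.

Lemma shifted_terms_int s p : (forall b, b \in s -> intvec b) -> p \in shifted_terms s ->
  intvec p.2.
Proof.
have E1 (x y z : 'rV[R]_r) : x + y + (z - x) = y + z.
  by apply/rowP => j; rewrite !mxE; ring.
have E2 (x y z : 'rV[R]_r) : x + y + (z + x) = x + x + (y + z).
  by apply/rowP => j; rewrite !mxE; ring.
move=> + /mapP[q + ->] /=; rewrite /real_rho; elim: s q => [|b s IH] q sP /=.
  by rewrite inE big_nil scaler0 add0r => /eqP -> /=; exact: intvec0.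
have ib := sP b (mem_head _ _).
have bb : b = 2%:R^-1 *: b + 2%:R^-1 *: b.
  by rewrite -scalerDl -[LHS]scale1r; congr (_ *: _); field.
rewrite mem_cat big_cons scalerDr; set x := 2%:R^-1 *: b in bb *; set y := 2%:R^-1 *: _ in IH *.
have {}IH p' := IH p' (fun c cs => sP c (mem_behead (s := b :: s) cs)).
case/orP => /mapP[p' /IH p's ->] /=.
  by rewrite E1.
by rewrite E2 -bb; exact: intvecD.
Qed.

End RealDenominator.

Lemma term_sum_real (R : realType) (g : lieAlgebra R[i]) (h : {vspace g}) r
    (al : r.-tuple (dual h)) (s : seq 'rV[R]_r) (F : dual h -> R[i]) :
  term_sum (map (comb al) s) F = \sum_(p <- real_terms s) (p.1)%:C * F (comb al p.2).
Proof.
elim: s F => [|b s IH] F.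
  rewrite term_sum_nil big_seq1 mul1r; congr F.
  by rewrite /comb big1 // => a _; rewrite mxE scale0r.
have h2 : (2%:R^-1 : R[i]) = (2%:R^-1)%:C by rewrite fmorphV rmorph_nat.
rewrite /= term_sum_cons !IH big_cat !big_map -sumrN /=; congr (_ + _); apply: eq_bigr => p _ /=.
  by rewrite combB combZ h2.
by rewrite combD combZ h2 rmorphN mulNr.
Qed.

(** With s the reflection, symmetrization shows that twice the unnormalized mean of f is the sum of
    the (e^(v.u) - e^(sv.u)) f(v). The two exponents differ by 2 f(v) u_a / B_aa, so for u_a <= 0
    each term is nonpositive. *)
Lemma reflect_mean_le0 (R : realType) (g : lieAlgebra R[i]) (h : {vspace g}) r
    (al : r.-tuple (dual h)) (c : seq 'rV[R]_r) (u : 'rV[R]_r) a :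
  (Bmx al)^T = Bmx al -> 0 < Bmx al a a -> perm_eq (map (simple_reflection (al := al) a) c) c -> c != [::] ->
  u 0 a <= 0 -> (mean c u *m Bmx al) 0 a <= 0.
Proof.
set B := Bmx al => Bs Ba pc c_ne ua.
pose f (v : 'rV[R]_r) := (v *m B) 0 a.
have E : (mean c u *m B) 0 a = (\sum_(v <- c) expR (dot v u) * f v) / partition c u.
  rewrite /mean mulmx_suml summxE mulr_suml; apply: eq_bigr => v _.
  by rewrite -scalemxAl mxE /prob /f; ring.
have Z0 := partition_gt0 u c_ne.
rewrite E pmulr_lle0 ?invr_gt0 //.
have fs v : f (simple_reflection (al := al) a v) = - f v.
  have rB : (delta_mx 0 a *m B : 'rV_r) 0 a = B a a by rewrite -rowE mxE.
  have mE (w z : 'rV[R]_r) k : (w - k *: z) 0 a = w 0 a - k * z 0 a by rewrite !mxE.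
  rewrite /f /simple_reflection mulmxBl -scalemxAl -/B mE rB.
  by field; exact: lt0r_neq0.
have es v : expR (dot (simple_reflection (al := al) a v) u) = expR (dot v u - 2%:R * f v / B a a * u 0 a).
  by rewrite /simple_reflection dotDl dotNl dotZl [dot (delta_mx _ _) _]dotC dot_delta.
have : 2%:R * \sum_(v <- c) expR (dot v u) * f v =
    \sum_(v <- c) (expR (dot v u) - expR (dot v u - 2%:R * f v / B a a * u 0 a)) * f v.
  rewrite mulr_natl mulr2n -[X in _ + X = _](perm_big _ pc) big_map /= -big_split.
  by apply: eq_bigr => v _ /=; rewrite fs es; ring.
suff : \sum_(v <- c) (expR (dot v u) - expR (dot v u - 2%:R * f v / B a a * u 0 a)) * f v <= 0.
  by move: (\sum_(v <- c) _) (\sum_(v <- c) _) => x y; lra.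
apply: sumr_le0 => v _.
have [f0|/ltW f0] := leP 0 (f v).
  rewrite mulr_le0_ge0 // subr_le0 ler_expR.
  have : 2%:R * f v / B a a * u 0 a <= 0 by rewrite mulr_ge0_le0 // divr_ge0 ?mulr_ge0 // ltW.
  lra.
rewrite mulr_ge0_le0 // subr_ge0 ler_expR.
have : 0 <= 2%:R * f v / B a a * u 0 a by rewrite mulr_le0 // mulr_le0_ge0 ?invr_ge0 ?(ltW Ba) // mulr_ge0_le0.
lra.
Qed.

Lemma det_le (R : realType) r (A : 'M[R]_r) (E : R) : (forall a b, `|A a b| <= E) ->
  `|\det A| <= r`!%:R * E ^+ r.
Proof.
move=> AE; rewrite /determinant; apply: (le_trans (ler_norm_sum _ _ _)).
rewrite mulr_natl -[r`!]card_Sn -sumr_const; apply: ler_sum => s _.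
rewrite normrM normrX normrN normr1 expr1n mul1r normr_prod.
by rewrite -[r in E ^+ r]card_ord -prodr_const; apply: ler_prod => i _; rewrite normr_ge0 AE.
Qed.

Lemma powR_half (R : realType) (x : R) n : 0 <= x -> x `^ (n%:R / 2%:R) = Num.sqrt (x ^+ n).
Proof. by move=> x0; rewrite powRrM powR_mulrn // powR12_sqrt // exprn_ge0. Qed.

(** * The estimate with relative error *)

Section LocalLimit.
Context {R : realType} {r m : nat}.
Variables (c : 'I_m -> seq 'rV[R]_r) (V : R) (ks : 'I_m).
Hypotheses (r_gt0 : (0 < r)%N) (c_ne : forall k, c k != [::]) (c_spread : spread (c ks)).
Hypotheses (V_ge0 : 0 <= V) (cV : forall k v, v \in c k -> forall a, `|v 0 a| <= V).

Lemma hess_le tau u a b (t : R) : (forall k, 0 <= tau k) -> \sum_k tau k <= t ->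
  `|hess c tau u a b| <= t * (2%:R * V) ^+ 2.
Proof.
move=> t0 tt; apply: (@le_trans _ _ ((\sum_k tau k) * (2%:R * V) ^+ 2)); last first.
  by rewrite ler_wpM2r ?sqr_ge0.
rewrite /hess summxE mulr_suml; apply: (le_trans (ler_norm_sum _ _ _)); apply: ler_sum => k _.
rewrite mxE normrM ger0_norm // ler_wpM2l // /cov summxE; apply: (le_trans (ler_norm_sum _ _ _)).
rewrite -[leRHS]mul1r -[X in _ <= X * _](prob_sum u (c_ne k)) mulr_suml big_seq [leRHS]big_seq.
apply: ler_sum => v vc; have p0 := ltW (prob_gt0 u (c_ne k) v).
rewrite mxE normrM ger0_norm // ler_wpM2l // mxE big_ord1 normrM expr2.
have d i : `|(v - mean (c k) u) 0 i| <= 2%:R * V.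
  rewrite !mxE; apply: (le_trans (ler_normB _ _)).
  by have := cV vc i; have := mean_bound u (c_ne k) (@cV k) i; lra.
by apply: ler_pM => //; rewrite ?d // mxE d.
Qed.

Definition main_value (eps : R) tau u (G : R) (z : 'rV[R]_r) : R :=
  eps `^ (r%:R / 2%:R) *
  (Num.sqrt (\det (invmx (hess c tau u))) / (2%:R * pi) `^ (r%:R / 2%:R)) *
  G * expR (eps^-1 * excess c tau z u).

(** The absolute error in [coefficient_estimate] becomes relative: the determinant of the Hessian is
    bounded above by D, the denominator below by gmin, and the factor e^(S / epsilon) is common to
    the main value and the error. *)
Lemma local_limit (A pl tmin tmax gmin : R) :
  0 <= A -> 0 < pl -> 0 < tmin -> 0 <= tmax -> 0 < gmin ->
  exists2 K : R, 0 <= K & forall (eps : R) (N : 'I_m -> nat) (tau : 'I_m -> R)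
      (u lam : 'rV[R]_r) (s : seq (R * 'rV[R]_r)),
    0 < eps -> (forall k, (N k)%:R = tau k / eps) -> (forall k, 0 <= tau k) ->
    \sum_k tau k <= tmax -> tmin <= tau ks ->
    (forall v, v \in c ks -> pl <= prob (c ks) u v) ->
    (forall p, p \in s -> forall a, `|p.2 0 a| <= V) ->
    \sum_(p <- twist s u) `|p.1| <= A -> gmin <= \sum_(p <- s) p.1 * expR (- dot p.2 u) ->
    grad c tau u = eps *: lam ->
    (forall v p, v \in tensor_exponents c N -> p \in s -> intvec (v - lam - p.2)) ->
    let M := main_value eps tau u (\sum_(p <- s) p.1 * expR (- dot p.2 u)) (eps *: lam) in
    0 < M /\ `|coefficient c N s lam - M| <= K * eps * M.
Proof.
move=> A0 pl0 tmin0 tmax0 gmin0.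
have [K [cc [K0 cc0 H]]] := @coefficient_estimate R r m V A pl tmax tmin r_gt0 V_ge0 A0 pl0 tmax0 tmin0.
pose D : R := r`!%:R * (tmax * (2%:R * V) ^+ 2) ^+ r.
have D0 : 0 <= D by rewrite mulr_ge0 // exprn_ge0 // mulr_ge0 ?sqr_ge0.
exists (K * Num.sqrt (D / cc ^+ r) / gmin) => [|eps N tau u lam s eps0 Nt t0 tt tk plP sV sA gG gu int].
  by apply: divr_ge0; [apply: mulr_ge0 => //; exact: sqrtr_ge0 | exact: ltW].
have tks : 0 < tau ks := lt_le_trans tmin0 tk.
have e0 := lt0r_neq0 eps0.
have [| | | |Qpos est] := H c u N ks s lam eps c_ne c_spread cV sV sA plP eps0.
- by under eq_bigr do idtac; rewrite natr_sum; under eq_bigr do rewrite Nt; rewrite -mulr_suml divfK.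
- by rewrite Nt divfK.
- have -> : lam = eps^-1 *: grad c tau u by rewrite gu scalerA mulVf // scale1r.
  by rewrite /grad scaler_sumr; apply: eq_bigr => k _; rewrite scalerA Nt mulrC.
- exact: int.
set G := \sum_(p <- s) _ in gG est *; have G0 : 0 < G := lt_le_trans gmin0 gG.
have Hpos := hess_posdef r_gt0 c_ne cV u t0 tks c_spread.
set h := \det (hess c tau u); have h0 : 0 < h := posdef_det_gt0 Hpos.
have hD : h <= D.
  by apply: (le_trans (ler_norm _)); apply: det_le => a b; exact: hess_le.
have Qdet : \det (tensor_cov c u N) = h / eps ^+ r.
  have -> : tensor_cov c u N = eps^-1 *: hess c tau u.
    by rewrite /tensor_cov /hess scaler_sumr; apply: eq_bigr => k _; rewrite scalerA Nt mulrC.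
  by rewrite detZ exprVn mulrC.
have p0 : 0 < (2%:R * pi) ^+ r :> R by rewrite exprn_gt0 // mulr_gt0 // pi_gt0.
have er0 : 0 < eps ^+ r by rewrite exprn_gt0.
set P : R := (2%:R * pi) ^+ r in p0 est *.
set M := main_value _ _ _ _ _; set X := expR (eps^-1 * excess c tau (eps *: lam) u).
have X0 : 0 < X := expR_gt0 _.
have LX : expR (dot lam u) / tensor_partition c u N = X^-1.
  rewrite /X -expRN /excess mulrBr dotZr mulKf // opprB expRD dotC expRN; congr (_ / _).
  rewrite /pot mulr_sumr expR_sum; apply: eq_bigr => k _.
  rewrite mulrA [eps^-1 * _]mulrC -Nt expRM_natl lnK // posrE; exact: partition_gt0.
have ME : M = Num.sqrt (eps ^+ r / P / h) * G * X.
  rewrite /M /main_value -/X !powR_half ?(ltW eps0) //; last by rewrite mulr_ge0 // pi_ge0.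
  rewrite det_inv -/h -/P; congr (_ * _ * _).
  rewrite sqrtrM; last by rewrite divr_ge0 ?ltW.
  rewrite sqrtrM ?ltW // mulrA mulrAC; congr (_ * _).
  by rewrite sqrtrV // ltW.
have M0 : 0 < M by rewrite ME !mulr_gt0 // sqrtr_gt0 !divr_gt0.
split=> //; move: est; rewrite LX Qdet.
have s1 : Num.sqrt (P / (h / eps ^+ r)) = P * Num.sqrt (eps ^+ r / P / h).
  have PE : P = Num.sqrt (P ^+ 2) by rewrite sqrtr_sqr ger0_norm // ltW.
  rewrite [X in _ = X * _]PE -sqrtrM ?sqr_ge0 //.
  by congr Num.sqrt; field; rewrite !lt0r_neq0.
have s2 : Num.sqrt (P / (cc / eps) ^+ r) = P * Num.sqrt (eps ^+ r / P / h) * Num.sqrt (h / cc ^+ r).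
  rewrite -s1 -sqrtrM; last by rewrite !divr_ge0 ?ltW // divr_gt0.
  rewrite expr_div_n; congr Num.sqrt; field; rewrite !lt0r_neq0 ?exprn_gt0 //.
rewrite s1 s2; set S := Num.sqrt (eps ^+ r / P / h).
have S0 : 0 < S by rewrite sqrtr_gt0 !divr_gt0.
set Y := coefficient _ _ _ _.
have -> : P * (Y * X^-1) - G * (P * S) = P / X * (Y - M).
  by rewrite ME -/S; field; exact: lt0r_neq0.
have PX : 0 < P / X by rewrite divr_gt0.
rewrite normrM (gtr0_norm PX) => est.
rewrite -(ler_pM2l PX); apply: (le_trans est).
have -> : P / X * (K * Num.sqrt (D / cc ^+ r) / gmin * eps * M) =
    K * eps * (P * S * (Num.sqrt (D / cc ^+ r) * (G / gmin))).
  by rewrite ME -/S; field; rewrite !lt0r_neq0.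
rewrite ler_wpM2l ?mulr_ge0 ?(ltW eps0) // ler_wpM2l ?mulr_ge0 ?(ltW p0) ?(ltW S0) //.
rewrite -[leLHS]mulr1; apply: ler_pM; rewrite ?sqrtr_ge0 //.
  by rewrite ler_sqrt ?divr_ge0 ?exprn_ge0 ?(ltW cc0) // ler_wpM2r // invr_ge0 exprn_ge0 // ltW.
by rewrite ler_pdivlMr // mul1r.
Qed.

End LocalLimit.

Lemma coord_bound (R : realType) r (s : seq 'rV[R]_r) v : v \in s ->
  forall a, `|v 0 a| <= \sum_(w <- s) \sum_a `|w 0 a|.
Proof.
move=> vs a; rewrite (perm_big _ (perm_to_rem vs)) big_cons (bigD1 a) //= -addrA lerDl.
by rewrite addr_ge0 // sumr_ge0 // => w _; apply: sumr_ge0.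
Qed.

Section LegendreOfCharacters.
Context {R : realType} {g : lieAlgebra R[i]} {h : {vspace g}} {r : nat} {al : r.-tuple (dual h)}.
Hypotheses (g_simple : simple_lie g) (h_cartan : cartan_subalgebra h).
Hypothesis al_simple : simple_roots al.
Variables (P : 'M[R[i]]_(\dim {:g})) (be : 'I_(\dim {:g}) -> dual h).
Hypothesis wb : weight_basis (V := adjoint_module) P be.
Variables (m : nat) (V : 'I_m -> lieModule g) (c : 'I_m -> seq 'rV[R]_r) (Vb : R).
Hypothesis cw : forall k, has_weights (V k) (map (comb al) (c k)).
Hypotheses (c_ne : forall k, c k != [::]) (Vb_ge0 : 0 <= Vb).
Hypothesis cV : forall k v, v \in c k -> forall a, `|v 0 a| <= Vb.
Local Notation B := (Bmx al).

(** Without simple roots the dual of h would be 0, so that h would act by 0 on g; as h is its own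
    centralizer, g would be h, hence commutative. *)
Lemma rank_gt0 : (0 < r)%N.
Proof.
rewrite lt0n; apply/eqP => r0; have [[x [y xy]] _] := g_simple.
have [hc hmax _] := h_cartan.
have dual0 (b : dual h) : b = 0.
  have [bas _ _] := al_simple; rewrite (coord_basis bas (memvf b)) big1 // => -[i ir].
  by exfalso; rewrite r0 in ir.
have inh z : z \in h.
  apply: hmax => H Hh; pose H' := vsproj h H; have HE : vsval H' = H by rewrite vsprojK.
  have [Pu PW] := wb.
  have : adjoint_module (vsval H') *m P = 0.
    apply/matrixP => i j; have := PW j H'; rewrite (dual0 (be j)) lfunE /= scale0r.
    by rewrite colE mulmxA -colE => /colP /(_ i); rewrite !mxE.
  move=> E; have {}E : adjoint_module (vsval H') = 0 by rewrite -[LHS](mulmxK Pu) E mul0mx.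
  by have := adj_colv H z; rewrite -[adj_act H]/(adjoint_module H) -HE E mul0mx => /(congr1 vcol); rewrite colvK linear0.
by apply: xy; exact: hc.
Qed.

Lemma Bposdef : posdef B.
Proof.
split; first exact: Bmx_sym.
by move=> x x0; exact: (Bmx_pos g_simple h_cartan al_simple wb x0).
Qed.

Lemma dot_B v w : dot (v *m B) w = dot v (w *m B).
Proof. by rewrite dotMr Bposdef.1. Qed.

Lemma rform_dot v w : rform (comb al v) (comb al w) = dot v (w *m B).
Proof. by rewrite -dot_B /rform (form_comb g_simple h_cartan al_simple wb). Qed.

Lemma fpotE tau y : fpot al V tau y = pot c tau (y *m B).
Proof.
apply: eq_bigr => k _; rewrite (chi_weights g_simple h_cartan al_simple wb y (cw k)).
by congr (_ * ln _); apply: eq_bigr => v _; rewrite -dot_B.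
Qed.

Lemma B_unit : B \in unitmx.
Proof. by rewrite unitmxE unitfE lt0r_neq0 // posdef_det_gt0 //; exact: Bposdef. Qed.

Lemma legendreE tau xi : legendre al V tau xi = leg c tau xi.
Proof.
rewrite /legendre /leg; congr inf; apply/seteqP; split=> _ [y _ <-].
  by exists (y *m B) => //; rewrite fpotE rform_dot -dot_B.
by exists (y *m invmx B) => //; rewrite fpotE rform_dot -dot_B mulmxKV // B_unit.
Qed.

Section Tau.
Variable tau : 'I_m -> R.
Hypothesis tau_ge0 : forall k, 0 <= tau k.

Lemma derive_fpot x a : 'D_(delta_mx 0 a) (fpot al V tau) x = dot (grad c tau (x *m B)) (row a B).
Proof.
(* W keeps the displacement in the unit box, where [bregman_ub] applies. *)
set u := x *m B; set w := row a B; pose W := 1 + \sum_i `|w 0 i|.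
have W0 : 0 < W by rewrite ltr_wpDr ?sumr_ge0.
set C : R := (\sum_k tau k) * (expR (r%:R * (2%:R * Vb) * 1) / 2%:R * (r%:R * (2%:R * Vb)) ^+ 2).
apply: (@derive_quad _ _ _ _ _ _ (C * dot w w) W^-1) => [|e eW]; first by rewrite invr_gt0.
have -> : fpot al V tau (x + e *: delta_mx 0 a) = pot c tau (u + e *: w).
  by rewrite fpotE mulmxDl -scalemxAl -rowE.
have ew i : `|(e *: w) 0 i| <= 1.
  rewrite mxE normrM; apply: (@le_trans _ _ (W^-1 * W)); last by rewrite mulVf // lt0r_neq0.
  apply: ler_pM => //; first exact: ltW.
  by rewrite /W (bigD1 i) //= addrCA lerDl addr_ge0 // sumr_ge0.
rewrite fpotE -/u.
have := bregman_ub c_ne cV tau_ge0 u ew; have := bregman_ge0 c_ne tau_ge0 u (e *: w).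
rewrite /bregman -/C !dotZr dotZl => b0 b1.
rewrite ger0_norm; first by apply: (le_trans b1); rewrite -[leRHS]mulrA [dot w w * _]mulrC expr2 !mulrA.
exact: b0.
Qed.

Lemma legendre_image_grad xi x : legendre_image al V tau xi x -> grad c tau (x *m B) = xi.
Proof.
move=> li; apply/eqP; rewrite -subr_eq0; apply/eqP.
set d := _ - xi; suff : d *m B = 0 by move=> E; rewrite -[d](mulmxK B_unit) E mul0mx.
apply/rowP => a; have := li a; rewrite derive_fpot => E.
have rowB (v : 'rV[R]_r) : (v *m B) 0 a = dot v (row a B).
  by rewrite rowE -dot_B dotC dotC dot_delta.
have subE (w z : 'rV[R]_r) : (w - z) 0 a = w 0 a - z 0 a by rewrite !mxE.
rewrite /d mulmxBl subE !rowB E [RHS]mxE dotE; apply/eqP; rewrite subr_eq0; apply/eqP.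
by apply: eq_bigr => b _; rewrite [row a B 0 b]mxE mulrC.
Qed.

(** In the coordinates u = y B the Hessian D of f in y is B H B, with H the Hessian of the potential
    in u; so B D^(-1) B is the inverse of H. *)
Lemma Kmx_hess ks xi u : 0 < tau ks -> spread (c ks) -> grad c tau u = xi ->
  Kmx al V tau xi = invmx (hess c tau u).
Proof.
move=> t0 sp gu; apply/matrixP => a b; rewrite mxE.
have -> : (fun z => 'D_(delta_mx 0 b) (legendre al V tau) z) =
    (fun z => 'D_(delta_mx 0 b) (leg c tau) z).
  by have -> : legendre al V tau = leg c tau by apply/funext => z; exact: legendreE.
by rewrite -gu (derive2_leg rank_gt0 c_ne Vb_ge0 cV u a b tau_ge0 t0 sp) opprK.
Qed.

Lemma main_term_value (bs : seq 'rV[R]_r) eps ks xi x :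
  0 < tau ks -> spread (c ks) -> grad c tau (x *m B) = xi ->
  main_term al (map (comb al) bs) V eps tau xi x =
  main_value c eps tau (x *m B)
    (\sum_(p <- shifted_terms bs) p.1 * expR (- dot p.2 (x *m B))) xi.
Proof.
move=> t0 sp gu; rewrite /main_term /main_value (Kmx_hess t0 sp gu) legendreE.
rewrite (legE c_ne tau_ge0 gu) shifted_terms_prod mulrA; congr (_ * _ * _ * _).
  rewrite /weyl_denominator big_map; apply: eq_bigr => b _.
  by rewrite rform_dot dotC -dot_B [dot (b *m B) x]dot_B.
have -> : weyl_vector (map (comb al) bs) = comb al (real_rho bs).
  rewrite /weyl_vector big_map /real_rho combZ fmorphV rmorph_nat; congr (_ *: _).
  elim: bs => [|b bs IH]; last by rewrite !big_cons combD IH.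
  by rewrite !big_nil /comb big1 // => a _; rewrite mxE scale0r.
by rewrite rform_dot.
Qed.

End Tau.
End LegendreOfCharacters.

Lemma seq_coord_bound (R : realType) r (s : seq 'rV[R]_r) :
  exists2 V, 0 <= V & forall v, v \in s -> forall a, `|v 0 a| <= V.
Proof.
exists (\sum_(w <- s) \sum_a `|w 0 a|); last exact: coord_bound.
by apply: sumr_ge0 => w _; apply: sumr_ge0.
Qed.

Lemma cvg_ge0 (R : realType) (f : nat -> R) (l : R) :
  (forall n, 0 <= f n) -> f @ \oo --> l -> 0 <= l.
Proof.
move=> f0 fl; rewrite leNgt; apply/negP => l0.
have H : \forall n \near \oo, f n < 0 by apply: (cvgr_lt _ fl).
by have [n] := filter_ex H; rewrite ltNge f0.
Qed.

(** * Convergence of the saddle points, and uniform constants *)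

Section Limit.
Context {R : realType} {r m : nat} {c : 'I_m -> seq 'rV[R]_r} {ks : 'I_m}.
Hypotheses (r_gt0 : (0 < r)%N) (c_ne : forall k, c k != [::]) (c_spread : spread (c ks)).
Variables (tau : nat -> 'I_m -> R) (tau0 : 'I_m -> R).
Variables (xi u : nat -> 'rV[R]_r) (u0 : 'rV[R]_r).
Hypothesis tau_ge0 : forall n k, 0 <= tau n k.
Hypothesis tau_cvg : forall k, tau n k @[n --> \oo] --> tau0 k.
Hypothesis tau0_ks : 0 < tau0 ks.
Hypothesis xi_cvg : xi @ \oo --> grad c tau0 u0.
Hypothesis grad_u : forall n, grad c (tau n) (u n) = xi n.

Lemma grad_coord t v a : grad c t v 0 a = \sum_k t k * mean (c k) v 0 a.
Proof. by rewrite /grad summxE; apply: eq_bigr => k _; rewrite mxE. Qed.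

(** [grad_stable] is applied at the fixed point u0 to the potential of index n. Its gradient at u0
    and xi n have the same limit, and the convexity constant is uniform once tau n ks >= tau0 ks /
    2. *)
Lemma grad_preimage_cvg e : 0 < e ->
  \forall n \near \oo, forall a, `|u n 0 a - u0 0 a| <= e.
Proof.
move=> e0; have [V V0 cV] := seq_coord_bound (flatten (codom c)).
have {}cV k v : v \in c k -> forall a, `|v 0 a| <= V.
  by move=> vk; apply: cV; apply/flattenP; exists (c k) => //; exact: codom_f.
have [kap kap0 kapP] := strong_convexity r_gt0 c_ne cV u0 c_spread.
have r0 : 0 < r%:R :> R by rewrite ltr0n.
set k1 := tau0 ks / 2%:R * kap.
have k10 : 0 < k1 by rewrite mulr_gt0 // divr_gt0.
(* The mismatch e1 of the gradients must satisfy r e1 < k1, as required by [grad_stable], and r e1 /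
   k1 <= e. *)
pose e1 : R := Num.min (k1 / 2%:R) (k1 * e) / r%:R.
have e10 : 0 < e1 by rewrite divr_gt0 // lt_min (mulr_gt0 k10 e0) andbT divr_gt0.
have re1 : r%:R * e1 = Num.min (k1 / 2%:R) (k1 * e).
  by rewrite /e1 mulrC divfK // lt0r_neq0.
have re1k : r%:R * e1 < k1 by rewrite re1 gt_min; apply/orP; left; rewrite ltr_pdivrMr //; lra.
have re1e : r%:R * e1 / k1 <= e.
  by rewrite ler_pdivrMr // re1 ge_min [e * k1]mulrC lexx orbT.
have near_tau : \forall n \near \oo, tau0 ks / 2%:R <= tau n ks.
  by apply: (cvgr_ge _ (@tau_cvg ks)); rewrite ltr_pdivrMr // mulr_natr mulr2n ltrDl.
have near_xi : \forall n \near \oo, forall a, `|xi n 0 a - grad c (tau n) u0 0 a| <= e1.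
  apply: filter_forall => a.
  have cx : xi n 0 a - grad c (tau n) u0 0 a @[n --> \oo] --> (0 : R).
    rewrite -(subrr (grad c tau0 u0 0 a)); apply: cvgB.
      exact: (cvg_comp _ _ xi_cvg (@coord_continuous R _ _ 0 a _)).
    rewrite grad_coord; under eq_fun do rewrite grad_coord.
    apply: cvg_big => [|k _]; first exact: add_continuous.
    by apply: cvgM; [exact: (@tau_cvg k) | exact: cvg_cst].
  have /cvgrPdist_le /(_ _ e10) := cx.
  by apply: filterS => n; rewrite sub0r normrN.
near=> n => a; apply: le_trans re1e.
apply: (grad_stable r_gt0 c_ne (tau_ge0 n) k10) (grad_u n) a => //; last first.
  by near: n.
move=> d d1; apply: le_trans (kapP _ (tau_ge0 n) d d1).
apply: ler_wpM2r; first exact: dot_ge0.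
by apply: ler_wpM2r; [exact: ltW | near: n].
Unshelve. all: by end_near.
Qed.

Lemma denominator_ge (b : 'rV[R]_r) (v : 'rV[R]_r) : 0 <= dot b v ->
  dot b v / 2%:R <= expR (dot b v / 2%:R) - expR (- (dot b v / 2%:R)).
Proof.
move=> b0; set t := _ / _; have t0 : 0 <= t by rewrite divr_ge0.
have := expR_ge1Dx t; have : expR (- t) <= 1 by rewrite expRN invf_le1 ?expR_gt0 // -expR0 ler_expR.
lra.
Qed.

Variables (eps : nat -> R) (N : nat -> 'I_m -> nat) (lam : nat -> 'rV[R]_r).
Hypothesis eps_gt0 : forall n, 0 < eps n.
Hypothesis N_tau : forall n k, (N n k)%:R = tau n k / eps n.
Hypothesis lam_xi : forall n, xi n = eps n *: lam n.
Variable bs : seq 'rV[R]_r.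
Hypothesis bs_ge0 : forall b, b \in bs -> forall a, 0 <= b 0 a.
Hypothesis bs_gt0 : forall b, b \in bs -> exists a, 0 < b 0 a.
Hypothesis u0_gt0 : forall a, 0 < u0 0 a.
Hypothesis lam_int : forall n v p, v \in tensor_exponents c (N n) ->
  p \in shifted_terms bs -> intvec (v - lam n - p.2).

(** For large n the point u n lies coordinatewise between u0 / 2 and 2 u0. This yields the
    probability, exponent and denominator bounds required by [local_limit], with constants
    independent of n. *)
Lemma local_limit_cvg : exists2 K, 0 <= K & \forall n \near \oo,
  let M := main_value c (eps n) (tau n) (u n)
    (\sum_(p <- shifted_terms bs) p.1 * expR (- dot p.2 (u n))) (xi n) in
  0 < M /\ `|coefficient c (N n) (shifted_terms bs) (lam n) - M| <= K * eps n * M.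
Proof.
set s := shifted_terms bs.
have [V V0 LV] := seq_coord_bound (real_rho bs :: flatten (codom c) ++ map snd s).
have cV k v : v \in c k -> forall a, `|v 0 a| <= V.
  move=> vk; apply: LV; rewrite inE mem_cat; apply/orP; right; apply/orP; left.
  by apply/flattenP; exists (c k) => //; exact: codom_f.
have sV (p : R * 'rV[R]_r) : p \in s -> forall a, `|p.2 0 a| <= V.
  by move=> ps; apply: LV; rewrite inE mem_cat map_f ?orbT.
have rhoV : forall a, `|(real_rho bs) 0 a| <= V by apply: LV; rewrite inE eqxx.
set U := \sum_a 2%:R * u0 0 a.
have U0 : 0 <= U by apply: sumr_ge0 => a _; rewrite mulr_ge0 // ltW.
set L := r%:R * V * U.
have L0 : 0 <= L by rewrite !mulr_ge0.
set A := \sum_(p <- s) `|p.1| * expR L.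
have A0 : 0 <= A by apply: sumr_ge0 => p _; rewrite mulr_ge0 ?expR_ge0.
have [v0 v0k] : exists v, v \in c ks.
  by case: (c ks) (c_ne ks) => // v c' _; exists v; rewrite inE eqxx.
set pl := expR (- (2%:R * L)) / (size (c ks))%:R.
have pl0 : 0 < pl by rewrite divr_gt0 ?expR_gt0 // ltr0n lt0n size_eq0.
have tmin0 : 0 < tau0 ks / 2%:R by rewrite divr_gt0.
have tau0_ge0 k : 0 <= tau0 k.
  exact: (cvg_ge0 (tau_ge0^~ k) (@tau_cvg k)).
set tmax := \sum_k (tau0 k + 1).
have tmax0 : 0 <= tmax by apply: sumr_ge0 => k _; rewrite addr_ge0.
have bu0 b : b \in bs -> 0 < dot b u0.
  move=> bb; have [a ba] := bs_gt0 bb; rewrite dotE (bigD1 a) //=.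
  rewrite ltr_pwDl ?mulr_gt0 // sumr_ge0 // => i _.
  by apply: mulr_ge0; [exact: bs_ge0 | exact: ltW].
(* Each factor is at least dot b (u n) / 2 by [denominator_ge], and dot b (u n) >= dot b u0 / 2; the
   exponential is a lower bound for e^(-rho) at u n. *)
set gmin := (\prod_(b <- bs) (dot b u0 / 4%:R)) * expR (- L).
have gmin0 : 0 < gmin.
  rewrite mulr_gt0 ?expR_gt0 // big_seq; apply: prodr_gt0 => b bb.
  by rewrite divr_gt0 ?bu0.
have [K K0 KP] := local_limit r_gt0 c_ne c_spread V0 cV A0 pl0 tmin0 tmax0 gmin0.
exists K => //.
have near_tau : \forall n \near \oo, tau0 ks / 2%:R <= tau n ks.
  by apply: (cvgr_ge _ (@tau_cvg ks)); rewrite ltr_pdivrMr // mulr_natr mulr2n ltrDl.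
have near_tmax : \forall n \near \oo, forall k, tau n k <= tau0 k + 1.
  apply: filter_forall => k.
  by apply: (cvgr_le _ (@tau_cvg k)); lra.
have near_u : \forall n \near \oo, forall a, `|u n 0 a - u0 0 a| <= u0 0 a / 2%:R.
  apply: filter_forall => a.
  have ua : 0 < u0 0 a / 2%:R by rewrite divr_gt0.
  by apply: filterS (grad_preimage_cvg ua) => n; exact.
near=> n.
have un a : u0 0 a / 2%:R <= u n 0 a <= 2%:R * u0 0 a.
  have : `|u n 0 a - u0 0 a| <= u0 0 a / 2%:R by move: a; near: n.
  by rewrite ler_norml; have := u0_gt0 a; lra.
have uU a : `|u n 0 a| <= U.
  have /andP[u1 u2] := un a; rewrite ger0_norm; last first.
    by apply: le_trans u1; rewrite divr_ge0 // ltW.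
  apply: (le_trans u2); rewrite /U (bigD1 a) //= lerDl sumr_ge0 // => i _.
  by rewrite mulr_ge0 // ltW.
have dL (v : 'rV[R]_r) : (forall a, `|v 0 a| <= V) -> `|dot v (u n)| <= L.
  by move=> vV; apply: dot_bound.
rewrite /= lam_xi; apply: KP => //.
- by apply: ler_sum => k _; move: k; near: n.
- by near: n.
- by move=> v vk; apply: prob_lb => // w wk; apply: dL; exact: cV wk.
- rewrite /twist big_map big_seq [leRHS]big_seq; apply: ler_sum => p ps /=.
  rewrite normrM ler_wpM2l // ger0_norm ?expR_ge0 // ler_expR.
  by apply: le_trans (dL _ (sV _ ps)); rewrite -normrN ler_norm.
- rewrite shifted_terms_prod; apply: ler_pM.
  + by rewrite big_seq; apply: prodr_ge0 => b bb; rewrite divr_ge0 // ltW // bu0.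
  + exact: expR_ge0.
  + rewrite big_seq [leRHS]big_seq; apply: ler_prod => b bb.
    have bun : dot b u0 / 2%:R <= dot b (u n).
      rewrite !dotE mulr_suml; apply: ler_sum => a _; rewrite -mulrA ler_wpM2l ?bs_ge0 //.
      by have /andP[] := un a.
    have b0 := bu0 b bb.
    apply/andP; split; first by rewrite divr_ge0 // ltW.
    have bun0 : 0 <= dot b (u n) by lra.
    by have := denominator_ge bun0; lra.
  + by rewrite ler_expR lerN2; apply: le_trans (dL _ rhoV); rewrite ler_norm.
- by rewrite -lam_xi.
- by move=> v p; exact: lam_int.
Unshelve. all: by end_near.
Qed.

End Limit.

(** * From the Lie algebra to the analytic hypotheses *)

Section Setting.
Context {R : realType} {g : lieAlgebra R[i]} {h : {vspace g}} {r : nat} {al : r.-tuple (dual h)}.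
Hypotheses (g_simple : simple_lie g) (h_cartan : cartan_subalgebra h).
Hypothesis al_simple : simple_roots al.
Variables (P : 'M[R[i]]_(\dim {:g})) (be : 'I_(\dim {:g}) -> dual h).
Hypothesis wb : weight_basis (V := adjoint_module) P be.
Variable Dp : seq (dual h).
Hypotheses (Dp_uniq : uniq Dp) (DpP : forall b : dual h, b \in Dp <-> positive_root al b).
Local Notation B := (Bmx al).

Lemma form_comb_simple v a : Defs.form (comb al v) (tnth al a) = ((v *m B) 0 a)%:C.
Proof.
by rewrite -comb_delta (form_comb g_simple h_cartan al_simple wb) trmx_delta -colE [col _ _ _ _]mxE.
Qed.

(** If xi were orthogonal to a simple root, the reflection in this root would fix xi; it is not the
    identity, since it changes the sign of the root. *)
Lemma regular_dominant_gt0 xi : regular (comb al xi) ->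
  (forall a, 0 <= (xi *m B) 0 a) -> forall a, 0 < (xi *m B) 0 a.
Proof.
move=> reg dom a; rewrite lt_neqAle dom andbT eq_sym; apply/eqP => xa0.
have ra := al_root al_simple a.
have fix_xi : weyl_act [:: tnth al a] (comb al xi) = comb al xi.
  by rewrite /= /reflection form_comb_simple xa0 rmorph0 mulr0 mul0r scale0r subr0.
have := reg [:: tnth al a] _ fix_xi (tnth al a); rewrite /= (reflection_self g_simple h_cartan al_simple wb ra).
have wr : {in [:: tnth al a], forall b, is_root b} by move=> b; rewrite inE => /eqP ->.
move=> /(_ wr) aN; have [a0 _] := ra; apply: a0.
have n2 : (2%:R : R[i]) != 0 by rewrite pnatr_eq0.
have E : 2%:R *: tnth al a = 0 by rewrite scaler_nat mulr2n -{1}aN addNr.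
by rewrite -[LHS]scale1r -(mulVf n2) -scalerA E scaler0.
Qed.

Lemma grad_preimage_gt0 m (c : 'I_m -> seq 'rV[R]_r) tau u a :
  (forall k, c k != [::]) -> (forall k, 0 <= tau k) ->
  (forall k a, perm_eq (map (simple_reflection (al := al) a) (c k)) (c k)) ->
  0 < (grad c tau u *m B) 0 a -> 0 < u 0 a.
Proof.
move=> c_ne tau0 cW; apply: contraTT; rewrite -!leNgt => ua.
rewrite /grad mulmx_suml summxE; apply: sumr_le0 => k _.
rewrite -scalemxAl mxE; apply: mulr_ge0_le0 => //.
apply: reflect_mean_le0 => //; first exact: Bmx_sym.
exact: (Bmx_diag_gt0 g_simple h_cartan al_simple wb).
Qed.

Lemma positive_root_exponents : exists2 bs, Dp = map (comb al) bs &
  forall b, b \in bs -> [/\ intvec b, forall a, 0 <= b 0 a & exists a, 0 < b 0 a].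
Proof.
have E b : exists n : 'I_r -> nat, b \in Dp ->
    b = comb al (\row_a (n a)%:R) /\ exists a, (0 < n a)%N.
  case: (boolP (b \in Dp)) => [bD|]; last by exists (fun=> 0%N).
  by have [n nP] := root_comb DpP bD; exists n.
have [f fP] := choice E.
exists [seq \row_a (f b a)%:R | b <- Dp].
  rewrite -map_comp -[LHS]map_id; apply/eq_in_map => b bD /=.
  by have [] := fP b bD.
move=> _ /mapP[b bD ->]; split.
- by exists (\row_a (f b a)%:Z); apply/rowP => a; rewrite !mxE.
- by move=> a; rewrite mxE ler0n.
- by have [_ [a fa]] := fP b bD; exists a; rewrite mxE ltr0n.
Qed.

Lemma comb_sum (I : Type) (s : seq I) (F : I -> 'rV[R]_r) :
  comb al (\sum_(i <- s) F i) = \sum_(i <- s) comb al (F i).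
Proof. by elim: s => [|i s IH]; rewrite !(big_nil, big_cons) ?comb0 // combD IH. Qed.

Lemma comb_rho bs : half_sum (map (comb al) bs) = comb al (real_rho bs).
Proof. by rewrite /half_sum big_map /real_rho combZ fmorphV rmorph_nat comb_sum. Qed.

Lemma coefficient_mult m (V : 'I_m -> lieModule g) c N bs lam n :
  Dp = map (comb al) bs ->
  (forall k, has_weights (V k) (map (comb al) (c k))) ->
  (forall a, 0 <= (lam *m B) 0 a) ->
  multiplicity al (tensor_powers V N) (comb al lam) n ->
  coefficient c N (shifted_terms bs) lam = n%:R.
Proof.
move=> DpE cw dom mu; apply: (@complexI R).
have dom' a : 0 <= Defs.form (comb al lam) (tnth al a) by rewrite form_comb_simple ler0c.
have := multiplicity_exponents g_simple h_cartan al_simple wb Dp_uniq DpP cw dom' mu.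
rewrite rmorph_nat => <-; rewrite DpE comb_rho /coefficient rmorph_sum /=.
apply: eq_bigr => v _; rewrite term_sum_real /shifted_terms big_map rmorph_sum /=.
apply: eq_bigr => p _; rewrite rmorphM rmorph_nat /= -addrA -!combD.
by rewrite (inj_eq (comb_inj al_simple)).
Qed.

(** Modulo the root lattice the weights of each module agree with its highest weight, so v and lam
    lie in the same coset; the shifted exponents of the denominator lie in the lattice itself. *)
Lemma tensor_exponents_int m (c : 'I_m -> seq 'rV[R]_r) (n : 'I_m -> 'rV[R]_r)
    (nu : 'I_m -> dual h) N lam bs v (p : R * 'rV[R]_r) :
  (forall k v, v \in c k -> exists j : 'I_r -> nat, n k - v = \row_a (j a)%:R) ->
  (forall k, comb al (n k) = nu k) ->
  in_root_lattice al (comb al lam - \sum_k nu k *+ N k) ->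
  (forall b, b \in bs -> intvec b) ->
  v \in tensor_exponents c N -> p \in shifted_terms bs -> intvec (v - lam - p.2).
Proof.
move=> cn nE [j lamE] bsI vt pt.
apply: intvecB; last exact: shifted_terms_int pt.
have cI k w : w \in c k -> intvec (w - n k).
  move=> wk; have [i iE] := cn k w wk; rewrite -opprB iE.
  by exists (\row_a - (i a)%:Z); apply/rowP => a; rewrite !mxE rmorphN.
have -> : v - lam = (v - \sum_k (N k)%:R *: n k) - (lam - \sum_k (N k)%:R *: n k).
  by rewrite opprB addrA subrK.
apply: intvecB; first exact: intvec_tensor vt.
exists (\row_a j a); apply: (comb_inj al_simple).
rewrite combB comb_sum; transitivity (comb al lam - \sum_k nu k *+ N k).
  by congr (_ - _); apply: eq_bigr => k _; rewrite combZ rmorph_nat scaler_nat nE.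
by rewrite lamE; apply: eq_bigr => a _; rewrite !mxE rmorph_int.
Qed.

(** If the modules with tau k > 0 had only the weight 0, their means and hence the gradient would
    vanish. *)
Lemma grad_neq0_spread m (c : 'I_m -> seq 'rV[R]_r) tau u :
  (forall k, 0 <= tau k) -> grad c tau u != 0 ->
  (forall k, (forall v, v \in c k -> v = 0) \/ spread (c k)) ->
  exists2 ks, 0 < tau ks & spread (c ks).
Proof.
move=> tau0 g0 cP; apply: contrapT => nk; move/eqP: g0; apply.
rewrite /grad big1 // => k _; have := tau0 k; rewrite le_eqVlt => /orP[/eqP <-|tk].
  by rewrite scale0r.
case: (cP k) => [c0|sp]; last by case: nk; exists k.
by rewrite /mean big_seq big1 ?scaler0 // => v vk; rewrite (c0 v vk) scaler0.
Qed.

End Setting.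

Lemma cvg_mulmx_coord (R : realType) r (xi : nat -> 'rV[R]_r) (xi0 : 'rV[R]_r) (B : 'M[R]_r) a :
  xi @ \oo --> xi0 -> (xi n *m B) 0 a @[n --> \oo] --> (xi0 *m B) 0 a.
Proof.
move=> xi_cvg; rewrite mxE; under eq_fun do rewrite mxE.
apply: cvg_big => [|b _]; first exact: add_continuous.
apply: cvgM; last exact: cvg_cst.
exact: (cvg_comp _ _ xi_cvg (@coord_continuous R _ _ 0 b _)).
Qed.

Lemma bigO_ratio (R : realType) (f M eps : nat -> R) K : 0 <= K -> (forall n, 0 < eps n) ->
  (\forall n \near \oo, 0 < M n /\ `|f n - M n| <= K * eps n * M n) ->
  exists2 delta : nat -> R, delta =O_\oo eps & \forall n \near \oo, f n = M n * (1 + delta n).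
Proof.
move=> K0 eps0 H; exists (fun n => f n / M n - 1).
  (* K + 1 instead of K makes the constant positive and the inequality strict. *)
  apply/eqO_exP; exists (K + 1); first by rewrite ltr_wpDl.
  apply: filterS H => n [M0 fM]; rewrite [`|eps n|]ger0_norm ?ltW //.
  have -> : f n / M n - 1 = (f n - M n) / M n by rewrite mulrBl divff // lt0r_neq0.
  rewrite normrM normfV (gtr0_norm M0) ltr_pdivrMr //; apply: (le_lt_trans fM).
  by rewrite ltr_pM2r // ltr_pM2r // ltrDl.
apply: filterS H => n [M0 _].
by rewrite [1 + _]addrC subrK mulrC divfK // lt0r_neq0.
Qed.

Theorem theorem1
  (R : realType)
  (* the simple Lie algebra, its Cartan subalgebra and its root system *)
  (g : lieAlgebra R[i]) (g_simple : simple_lie g)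
  (h : {vspace g}) (h_cartan : cartan_subalgebra h)
  (r : nat) (al : r.-tuple (dual h)) (al_simple : simple_roots al)
  (Dp : seq (dual h)) (Dp_uniq : uniq Dp)
  (DpP : forall b : dual h, b \in Dp <-> positive_root al b)
  (* the irreducible modules V_k, with highest weights nu_k *)
  (m : nat) (nu : 'I_m -> dual h) (V : 'I_m -> lieModule g)
  (V_irr : forall k, irreducible_hw al (V k) (nu k))
  (* epsilon tends to 0 from above *)
  (eps : nat -> R) (eps_gt0 : forall n, 0 < eps n) (eps_cvg : eps @ \oo --> 0)
  (* N_k = tau_k / epsilon and lambda = xi / epsilon *)
  (N : nat -> 'I_m -> nat) (lam : nat -> 'rV[R]_r)
  (tau : nat -> 'I_m -> R) (xi : nat -> 'rV[R]_r)
  (tau_ge0 : forall n k, 0 <= tau n k)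
  (xi_ge0 : forall n a, 0 <= xi n 0 a)
  (N_tau : forall n k, (N n k)%:R = tau n k / eps n)
  (lam_xi : forall n, lam n = (eps n)^-1 *: xi n)
  (* lambda is in the main Weyl chamber and in the coset of the root lattice
     containing the weights of the tensor product *)
  (lam_chamber : forall n a, 0 <= rform (comb al (lam n)) (tnth al a))
  (lam_coset : forall n,
     in_root_lattice al (comb al (lam n) - \sum_k nu k *+ N n k))
  (* tau and xi converge, and xi remains regular, as epsilon tends to 0 *)
  (tau0 : 'I_m -> R) (xi0 : 'rV[R]_r)
  (tau_cvg : forall k, tau n k @[n --> \oo] --> tau0 k)
  (xi_cvg : xi @ \oo --> xi0)
  (xi0_regular : regular (comb al xi0))
  (* Legendre images *)
  (x : nat -> 'rV[R]_r) (x0 : 'rV[R]_r)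
  (x_legendre : forall n, legendre_image al V (tau n) (xi n) (x n))
  (x0_legendre : legendre_image al V tau0 xi0 x0)
  (* the multiplicities of V_lambda in the tensor products *)
  (mult : nat -> nat)
  (multP : forall n,
     multiplicity al (tensor_powers V (N n)) (comb al (lam n)) (mult n)) :
  exists2 delta : nat -> R, delta =O_\oo eps &
    \forall n \near \oo,
      (mult n)%:R = main_term al Dp V (eps n) (tau n) (xi n) (x n)
                    * (1 + delta n).

Proof.
have [P [be wb]] := adjoint_weight_basis h_cartan.
have H k : exists c, exists n, [/\ has_weights (V k) (map (comb al) c),
    n \in c /\ comb al n = nu k,
    forall v, v \in c -> exists j : 'I_r -> nat, n - v = \row_a (j a)%:R,
    forall a, perm_eq (map (simple_reflection (al := al) a) c) c &
    (forall v, v \in c -> v = 0) \/ spread c].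
  have [c cw [[n nc [nE ncone]] cW csp _]] :=
    irreducible_weights g_simple h_cartan al_simple wb Dp_uniq DpP (V_irr k).
  by exists c, n.
have [c cP] := choice H; have {cP}[hw {}H] := choice cP.
have cw k : has_weights (V k) (map (comb al) (c k)) by have [] := H k.
have c_ne k : c k != [::] by have [_ [+ _] _ _ _] := H k; case: (c k).
have cone k v : v \in c k -> exists j : 'I_r -> nat, hw k - v = \row_a (j a)%:R.
  by have [_ _ + _ _] := H k; exact.
have hwE k : comb al (hw k) = nu k by have [_ [_ +] _ _ _] := H k.
have cW k a : perm_eq (map (simple_reflection (al := al) a) (c k)) (c k).
  by have [_ _ _ + _] := H k; exact.
have csp k : (forall v, v \in c k -> v = 0) \/ spread (c k) by have [] := H k.
have [bs DpE bsP] := positive_root_exponents DpP.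
have [Vb Vb0 cV'] := seq_coord_bound (flatten (codom c)).
have cV k v : v \in c k -> forall a, `|v 0 a| <= Vb.
  by move=> vk; apply: cV'; apply/flattenP; exists (c k) => //; exact: codom_f.
have r_gt0 := rank_gt0 g_simple h_cartan al_simple wb.
have tau0_ge0 k : 0 <= tau0 k := cvg_ge0 (fun n => tau_ge0 n k) (tau_cvg k).
have lamE n : xi n = eps n *: lam n by rewrite lam_xi scalerA divff ?scale1r // lt0r_neq0.
have lam_dom n a : 0 <= (lam n *m Bmx al) 0 a.
  by have := lam_chamber n a; rewrite /rform (form_comb_simple g_simple h_cartan al_simple wb).
have xi0_dom a : 0 <= (xi0 *m Bmx al) 0 a.
  apply: (@cvg_ge0 R (fun n => (xi n *m Bmx al) 0 a)) => [n|].
    by rewrite lamE -scalemxAl mxE; apply: mulr_ge0; [exact: ltW | exact: lam_dom].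
  exact: cvg_mulmx_coord.
have xi0_gt0 := regular_dominant_gt0 g_simple h_cartan al_simple wb xi0_regular xi0_dom.
pose u n := x n *m Bmx al; pose u0 := x0 *m Bmx al.
have gu n : grad c (tau n) (u n) = xi n.
  exact: (legendre_image_grad g_simple h_cartan al_simple wb cw c_ne cV (tau_ge0 n) (x_legendre n)).
have gu0 : grad c tau0 u0 = xi0.
  exact: (legendre_image_grad g_simple h_cartan al_simple wb cw c_ne cV tau0_ge0 x0_legendre).
have u0_gt0 a : 0 < u0 0 a.
  apply: (grad_preimage_gt0 g_simple h_cartan al_simple wb c_ne tau0_ge0 cW).
  by rewrite gu0.
(* A nonzero gradient provides a module with nonzero weights and positive tau0, the source of all
   decay. *)
have xi0_neq0 : grad c tau0 u0 != 0.
  apply/eqP => E; have := xi0_gt0 (Ordinal r_gt0).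
  by rewrite -gu0 E mul0mx mxE ltxx.
have [ks tks sp] := grad_neq0_spread tau0_ge0 xi0_neq0 csp.
have bsI b : b \in bs -> intvec b by move=> /bsP[].
have bs_ge0 b : b \in bs -> forall a, 0 <= b 0 a by move=> /bsP[].
have bs_gt0 b : b \in bs -> exists a, 0 < b 0 a by move=> /bsP[].
have lam_int n v p : v \in tensor_exponents c (N n) -> p \in shifted_terms bs ->
    intvec (v - lam n - p.2).
  exact: (tensor_exponents_int al_simple cone hwE (lam_coset n) bsI).
have xi_cvg' : xi @ \oo --> grad c tau0 u0 by rewrite gu0.
have [K K0 KP] := local_limit_cvg r_gt0 c_ne sp tau_ge0 tau_cvg tks xi_cvg' gu eps_gt0
  N_tau lamE bs_ge0 bs_gt0 u0_gt0 lam_int.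
apply: (bigO_ratio K0 eps_gt0).
have near_tau : \forall n \near \oo, 0 < tau n ks by apply: (cvgr_gt _ (tau_cvg ks)).
apply: filterS2 near_tau KP => n tn.
rewrite (coefficient_mult g_simple h_cartan al_simple wb Dp_uniq DpP DpE cw (lam_dom n) (multP n)).
by rewrite DpE (main_term_value g_simple h_cartan al_simple wb cw c_ne Vb0 cV (tau_ge0 n) bs (eps n) tn sp (gu n)).
Qed.
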